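(* Let $A\subset K$ be an $R$-subalgebra of Fock type. Let $\theta_{K,A,R}\subset\theta_{K,R}$ be the Lie subalgebra of continuous $\mathbb C$-derivations $K\to K$ that preserve both $R$ and $A$, and let $\hat\theta_{K,A,R}$ be its preimage in $\hat\theta_{K,R}$. Then $\hat\theta_{K,A,R}$ preserves $A\circ\bar U\hat K[\hbar^{-1}]$ and hence acts on the space of coinvariants $\mathbb F(K,\mathcal O)_A=\mathbb F(K,\mathcal O)/A\circ\mathbb F(K,\mathcal O)$. This action of $\hat\theta_{K,A,R}$ on $\mathbb F(K,\mathcal O)_A$ factors through an action of a central extension of $\theta_R$ by $R$.
   Context: $R$ is a commutative $\mathbb C$-algebra and $\mathcal O$ is an $R$-algebra isomorphic to $R[[t]]$, with principal ideal $\mathfrak m$ corresponding to $(t)$. $K$ is the localization of $\mathcal O$ at a generator of $\mathfrak m$, so $K\cong R((t))$, with the $\mathfrak m$-adic topology. $\operatorname{Res}:\omega_{K/R}\cong R((t))dt\to R$ takes the coefficient of $t^{-1}dt$, and $(f,g):=\operatorname{Res}(g\,df)$ is the residue form on $K$. $\theta_R$ is the Lie algebra of $\mathbb C$-derivations of $R$; $\theta_{K,R}$ is the Lie algebra of continuous $\mathbb C$-derivations of $K$ that preserve $R$, and $\theta_{K/R}$ the subalgebra of those that kill $R$. An $R$-subalgebra $A\subset K$ is of Fock type if: (FT1) $A$ is flat and of finite type as an $R$-algebra; (FT2) $A\cap\mathcal O=R$ and the $R$-module $K/(A+\mathcal O)$ is free of finite rank; (FT3) $A$ is totally isotropic for the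 residue form; (FT4) any continuous $R$-derivation of $K$ which preserves $A$ maps $A^\perp:=\{f\in K:(f,a)=0\text{ for all }a\in A\}$ to $A$. $\hat K=K\oplus R\hbar$ is the Heisenberg $R$-Lie algebra with $[f+r\hbar,g+r'\hbar]=\operatorname{Res}(g\,df)\hbar$; $U\hat K$ is its enveloping algebra with product $\circ$ (the $R[\hbar]$-algebra generated by $K$ with relations $f\circ g-g\circ f=(f,g)\hbar$), and $\bar U\hat K:=\varprojlim_N U\hat K/U\hat K\circ\mathfrak m^N$. The Fock representation is $\mathbb F(K,\mathcal O):=U\hat K\otimes_{U\hat{\mathcal O}}R$, where $\hat{\mathcal O}=\mathcal O\oplus R\hbar$ acts on $R$ through the coefficient of $\hbar$, with generator $v_o$; it is a left $\bar U\hat K[\hbar^{-1}]$-module on which $\hbar$ acts as $1$. Choose a generator $t$ of $\mathfrak m$ and put $e_i=t^i$, so $(e_i,e_j)=i\delta_{i+j,0}$. For $D\in\theta_{K/R}$ put $$\hat\tau(D)=\frac1{2\hbar}\sum_{i,j\in\mathbb Z-\{0\}}\frac{(D(e_i),e_j)}{ij}:e_{-i}\circ e_{-j}:\ \in\bar U\hat K[\hbar^{-1}],$$ where the colons (normal ordering) mean that the two factors are written with indices in nondecreasing order. The elements $\hat\tau(D)+r$ ($r\in R$) form a Lie algebra $\hat\theta_{K/R}$, an extension of $\theta_{K/R}$ by $R$. Every $D\in\theta_{K,R}$ is uniquely $D=D_{\rm hor}+D_{\rm vert}$ with $D_{\rm hor}$ killing $t$ (so acting coefficientwise on Laurent series in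 $t$) and $D_{\rm vert}\in\theta_{K/R}$. The Lie algebra $\hat\theta_{K,R}$ consists of the elements $\hat D$ given by $D\in\theta_{K,R}$ and $r\in R$, acting on $\bar U\hat K[\hbar^{-1}]$ and on $\mathbb F(K,\mathcal O)$ as left multiplication by $\hat\tau(D_{\rm vert})+r$ plus coefficientwise derivation by $D_{\rm hor}$ (derivation by $D$ of the coefficients in $R$ with respect to the monomials in the $e_i$ and $\hbar$). It is an extension of $\theta_{K,R}$ by $R$ which does not depend on the choice of $t$. A central extension of a Lie algebra of derivations (such as $\theta_{K,R}$ or $\theta_R$) by $R$ is here an extension of Lie algebras with kernel $R$ in which the bracket of a lift of $D$ with $r\in R$ is $D(r)$; the copy of $R$ acts on representations by scalar multiplication.
   Formalization: The central extension by R is one of the image of θ_{K,A,R} in θ_R, not of all of θ_R; the two agree when every derivation of R lifts to one preserving A. With full θ_R the claim fails, e.g. for the nodal Weierstrass family s = y² − x³ − x² over C[s]. *)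

(* Defs.v *)
From HB Require Import structures.
From mathcomp Require Import all_boot all_order all_algebra.
From mathcomp Require Import generic_quotient ring_quotient sesquilinear.
From mathcomp Require Import boolp classical_sets.
From mathcomp Require Import zify ring.

Set Implicit Arguments.
Unset Strict Implicit.
Unset Printing Implicit Defensive.

Import GRing.Theory.
Local Open Scope classical_set_scope.
Local Open Scope ring_scope.
Local Open Scope quotient_scope.

Notation "{ 'quot' I }" := (Quotient.quot I) : type_scope.

(* An [R]-algebra [K] with an isomorphism [K ~ R((t))], that is, the
   localization K of O ~ R[[t]] together with the choice of a generator [t] of
   the ideal m. [coef f i] is the coefficient of [t^i] in [f]; [series] is the
   inverse isomorphism, specified on the families bounded below. [coefM] is the
   Cauchy product for series of order at least [m] and [n]. *)
HB.mixin Record isLaurent (R : comNzRingType) K of GRing.ComAlgebra R K := {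
  coef : K -> int -> R;
  series : (int -> R) -> K;
  coef_bounded : forall f, exists n : int, forall i, (i < n)%R -> coef f i = 0;
  coefK : forall f, series (coef f) = f;
  seriesK : forall a, (exists n : int, forall i, (i < n)%R -> a i = 0) ->
    forall i, coef (series a) i = a i;
  coef_linear : forall r f g i, coef (r *: f + g) i = r * coef f i + coef g i;
  coef1 : forall i, coef 1 i = (i == 0)%:R;
  coefM : forall f g (m n : int),
    (forall i, (i < m)%R -> coef f i = 0) ->
    (forall i, (i < n)%R -> coef g i = 0) ->
    forall k : nat, coef (f * g) (m + n + k%:Z) =
      \sum_(j < k.+1) coef f (m + j%:Z) * coef g (n + (k - j)%:Z)
}.

#[short(type="laurentType")]
HB.structure Definition Laurent (R : comNzRingType) :=
  {K of GRing.ComAlgebra R K & isLaurent R K}.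

Section Laurent.
Variables (R : comNzRingType) (K : laurentType R).
Implicit Types (f g : K) (i : int).

(* [mpow N] is m^N = t^N R[[t]]; in particular [mpow 0] is O = R[[t]]. *)
Definition mpow (N : nat) : set K :=
  [set f | forall i, (i < N%:Z)%R -> coef f i = 0].

(* t^i *)
Definition eseries i : K := series (fun j => (j == i)%:R).

(* df / dt *)
Definition dt f : K := series (fun i => coef f (i + 1) *~ (i + 1)).

(* Res (f dt) *)
Definition Res f : R := coef f (- 1).

(* (f, g) = Res (g df) *)
Definition res_form f g : R := Res (g * dt f).

Definition continuous_mad (D : K -> K) : Prop :=
  forall N, exists M, forall f, mpow M f -> mpow N (D f).

Lemma coef_ext f g : (forall i, coef f i = coef g i) -> f = g.
Proof. by move=> fg; rewrite -(coefK f) -(coefK g); congr series; apply/funext. Qed.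

Lemma coefD f g i : coef (f + g) i = coef f i + coef g i.
Proof. by rewrite -{1}(scale1r f) coef_linear mul1r. Qed.

Lemma coef0 i : coef (0 : K) i = 0.
Proof. by apply: (@addrI _ (coef (0 : K) i)); rewrite -coefD !addr0. Qed.

Lemma coefZ r f i : coef (r *: f) i = r * coef f i.
Proof. by rewrite -{1}(addr0 (r *: f)) coef_linear coef0 addr0. Qed.

Lemma coefN f i : coef (- f) i = - coef f i.
Proof. by rewrite -scaleN1r coefZ mulN1r. Qed.

Lemma coefB f g i : coef (f - g) i = coef f i - coef g i.
Proof. by rewrite coefD coefN. Qed.

Lemma coefA r i : coef (r%:A : K) i = r *+ (i == 0).
Proof. by rewrite coefZ coef1 mulr_natr. Qed.

Lemma coefA_inj : injective (fun r => r%:A : K).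
Proof. by move=> r s /(congr1 (fun f => coef f 0)); rewrite !coefA eqxx. Qed.

Lemma coefM_lt f g (m n : int) :
  (forall i, (i < m)%R -> coef f i = 0) ->
  (forall i, (i < n)%R -> coef g i = 0) ->
  forall i, (i < m + n)%R -> coef (f * g) i = 0.
Proof.
move=> fm gn i lti.
have f' j : (j < i - n)%R -> coef f j = 0 by move=> ?; apply: fm; lia.
rewrite (_ : i = (i - n) + n + 0%:Z); last lia.
rewrite (coefM _ _ _ _ f' gn) big_ord1 fm ?mul0r //=; lia.
Qed.

Lemma dt_bounded f (n : int) :
  (forall i, (i < n)%R -> coef f i = 0) ->
  forall i, (i < n - 1)%R -> coef f (i + 1) *~ (i + 1) = 0.
Proof. by move=> fn i lti; rewrite fn ?mul0rz //; lia. Qed.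

Lemma coef_dt f i : coef (dt f) i = coef f (i + 1) *~ (i + 1).
Proof.
rewrite seriesK //; have [n fn] := coef_bounded f.
by exists (n - 1); apply: dt_bounded.
Qed.

Lemma mpowS M N : (N <= M)%N -> mpow M `<=` mpow N.
Proof. by move=> NM f fM i lti; apply: fM; lia. Qed.

Lemma res_form_small f : exists M, forall g, mpow M g -> res_form g f = 0.
Proof.
have [n fn] := coef_bounded f.
exists (`|n|%N.+1) => g gM; rewrite /res_form /Res.
apply: (@coefM_lt _ _ n (`|n|%N.+1%:Z - 1)) => //; last lia.
by move=> i lti; rewrite coef_dt (dt_bounded gM).
Qed.

End Laurent.

Section Span.
Variable V : zmodType.

(* The subgroup of [V] generated by [G]. *)
Definition span (G : set V) : {pred V} :=
  [pred x | `[< forall S : {pred V}, zmod_closed S ->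
                  (forall g, G g -> g \in S) -> x \in S >]].

Lemma spanP (G : set V) x :
  reflect (forall S : {pred V}, zmod_closed S ->
             (forall g, G g -> g \in S) -> x \in S) (x \in span G).
Proof. exact: asboolP. Qed.

Lemma span_gen (G : set V) g : G g -> g \in span G.
Proof. by move=> Gg; apply/spanP => S _; exact. Qed.

Lemma span_zmod G : zmod_closed (span G).
Proof.
split=> [|x y /spanP xG /spanP yG]; apply/spanP => S clS GS; first by case: clS.
by case: (clS) => _; apply; [apply: xG | apply: yG].
Qed.

HB.instance Definition _ G := GRing.isZmodClosed.Build V (span G) (span_zmod G).

Lemma span_sub (G : set V) (P : V -> Prop) :
  P 0 -> (forall x y, P x -> P y -> P (x - y)) -> (forall g, G g -> P g) ->
  forall x, x \in span G -> P x.
Proof.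
move=> P0 PB PG x /spanP /(_ [pred x | `[< P x >]]) H.
apply/asboolP; apply: H => [|g Gg]; last exact/asboolP/PG.
split=> [|u v /asboolP Pu /asboolP Pv]; first exact/asboolP.
exact/asboolP/PB.
Qed.

Lemma span_map (G G' : set V) (h : V -> V) :
  h 0 = 0 -> (forall x y, h (x - y) = h x - h y) ->
  (forall g, G g -> h g \in span G') -> {homo h : x / x \in span G >-> x \in span G'}.
Proof.
move=> h0 hB hG; apply: span_sub => [|x y hx hy|//]; first by rewrite h0 rpred0.
by rewrite hB rpredB.
Qed.

End Span.

Lemma quotP (V : zmodType) (G : set V) (x y : V) :
  reflect (\pi_({quot span G}) x = \pi_({quot span G}) y) (x - y \in span G).
Proof. by rewrite Quotient.idealrBE; apply: eqP. Qed.

Lemma repr_quot (V : zmodType) (G : set V) (x : V) :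
  repr (\pi_({quot span G}) x) - x \in span G.
Proof. by apply/quotP; rewrite reprK. Qed.

Section Enveloping.
Variables (R : comNzRingType) (K : laurentType R).

(* Noncommutative polynomials in h-bar and the elements of [K] over [R]. *)
Inductive hterm : Type :=
  | HScal of R
  | HHbar
  | HGen of K
  | HAdd of hterm & hterm
  | HOpp of hterm
  | HMul of hterm & hterm.

(* The congruence generated by the axioms of (associative, unital) R-algebras,
   the R-linearity of [HGen], the centrality of h-bar and the relations
   f o g - g o f = (f, g) h-bar. The unit of the algebra is [HScal 1], which
   differs from [HGen 1]. *)
Inductive heq : hterm -> hterm -> Prop :=
  | heq_refl x : heq x x
  | heq_sym x y : heq x y -> heq y x
  | heq_trans x y z : heq x y -> heq y z -> heq x z
  | heq_add x x' y y' : heq x x' -> heq y y' -> heq (HAdd x y) (HAdd x' y')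
  | heq_opp x x' : heq x x' -> heq (HOpp x) (HOpp x')
  | heq_mul x x' y y' : heq x x' -> heq y y' -> heq (HMul x y) (HMul x' y')
  | heq_addA x y z : heq (HAdd x (HAdd y z)) (HAdd (HAdd x y) z)
  | heq_addC x y : heq (HAdd x y) (HAdd y x)
  | heq_add0 x : heq (HAdd (HScal 0) x) x
  | heq_addN x : heq (HAdd (HOpp x) x) (HScal 0)
  | heq_mulA x y z : heq (HMul x (HMul y z)) (HMul (HMul x y) z)
  | heq_mul1l x : heq (HMul (HScal 1) x) x
  | heq_mul1r x : heq (HMul x (HScal 1)) x
  | heq_mulDl x y z : heq (HMul (HAdd x y) z) (HAdd (HMul x z) (HMul y z))
  | heq_mulDr x y z : heq (HMul x (HAdd y z)) (HAdd (HMul x y) (HMul x z))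
  | heq_scalD r s : heq (HScal (r + s)) (HAdd (HScal r) (HScal s))
  | heq_scalM r s : heq (HScal (r * s)) (HMul (HScal r) (HScal s))
  | heq_scalC r x : heq (HMul (HScal r) x) (HMul x (HScal r))
  | heq_genD f g : heq (HGen (f + g)) (HAdd (HGen f) (HGen g))
  | heq_genZ r f : heq (HGen (r *: f)) (HMul (HScal r) (HGen f))
  | heq_hbarC x : heq (HMul HHbar x) (HMul x HHbar)
  | heq_comm f g :
      heq (HAdd (HMul (HGen f) (HGen g)) (HOpp (HMul (HGen g) (HGen f))))
          (HMul (HScal (res_form f g)) HHbar).

HB.instance Definition _ := gen_eqMixin hterm.
HB.instance Definition _ := gen_choiceMixin hterm.

Definition heqb : rel hterm := fun x y => `[< heq x y >].

Lemma heqb_equiv : equiv_class_of heqb.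
Proof.
split=> [x|x y|y x z]; first exact/asboolP/heq_refl.
- by apply/asboolP/asboolP => /heq_sym.
- by move=> /asboolP xy /asboolP yz; apply/asboolP; apply: heq_trans yz.
Qed.

Canonical heqb_rel := EquivRelPack heqb_equiv.

Definition UK : Type := {eq_quot heqb}.
HB.instance Definition _ := Choice.on UK.
HB.instance Definition _ := EqQuotient.on UK.

Lemma UK_eqP (x y : hterm) : reflect (\pi_UK x = \pi_UK y) `[< heq x y >].
Proof.
have -> : `[< heq x y >] = (\pi_UK x == \pi_UK y) by rewrite piE.
exact: eqP.
Qed.

Lemma UK_eq (x y : hterm) : heq x y -> \pi_UK x = \pi_UK y.
Proof. by move=> ?; apply/UK_eqP/asboolP. Qed.

Lemma UK_heq (x y : hterm) : \pi_UK x = \pi_UK y -> heq x y.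
Proof. by move=> /UK_eqP/asboolP. Qed.

Lemma repr_heq (x : hterm) : heq (repr (\pi_UK x)) x.
Proof. by apply: UK_heq; rewrite reprK. Qed.

Definition UK_add (u v : UK) : UK := \pi_UK (HAdd (repr u) (repr v)).
Definition UK_opp (u : UK) : UK := \pi_UK (HOpp (repr u)).
Definition UK_mul (u v : UK) : UK := \pi_UK (HMul (repr u) (repr v)).

Lemma UK_addE x y : UK_add (\pi_UK x) (\pi_UK y) = \pi_UK (HAdd x y).
Proof. by apply: UK_eq; apply: heq_add; apply: repr_heq. Qed.
Lemma UK_oppE x : UK_opp (\pi_UK x) = \pi_UK (HOpp x).
Proof. by apply: UK_eq; apply: heq_opp; apply: repr_heq. Qed.
Lemma UK_mulE x y : UK_mul (\pi_UK x) (\pi_UK y) = \pi_UK (HMul x y).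
Proof. by apply: UK_eq; apply: heq_mul; apply: repr_heq. Qed.


Lemma UK_addA : associative UK_add.
Proof.
elim/quotW => x; elim/quotW => y; elim/quotW => z.
rewrite (UK_addE y z) (UK_addE x y) (UK_addE x) (UK_addE _ z).
by apply: UK_eq; apply: heq_addA.
Qed.
Lemma UK_addC : commutative UK_add.
Proof.
elim/quotW => x; elim/quotW => y; rewrite (UK_addE x y) (UK_addE y x).
by apply: UK_eq; apply: heq_addC.
Qed.
Lemma UK_add0 : left_id (\pi_UK (HScal 0)) UK_add.
Proof.
by elim/quotW => x; rewrite (UK_addE _ x); apply: UK_eq; apply: heq_add0.
Qed.
Lemma UK_addN : left_inverse (\pi_UK (HScal 0)) UK_opp UK_add.
Proof.
elim/quotW => x; rewrite (UK_oppE x) (UK_addE _ x).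
by apply: UK_eq; apply: heq_addN.
Qed.

HB.instance Definition _ :=
  GRing.isZmodule.Build UK UK_addA UK_addC UK_add0 UK_addN.

Lemma UK_mulA : associative UK_mul.
Proof.
elim/quotW => x; elim/quotW => y; elim/quotW => z.
rewrite (UK_mulE y z) (UK_mulE x y) (UK_mulE x) (UK_mulE _ z).
by apply: UK_eq; apply: heq_mulA.
Qed.
Lemma UK_mul1l : left_id (\pi_UK (HScal 1)) UK_mul.
Proof.
by elim/quotW => x; rewrite (UK_mulE _ x); apply: UK_eq; apply: heq_mul1l.
Qed.
Lemma UK_mul1r : right_id (\pi_UK (HScal 1)) UK_mul.
Proof.
by elim/quotW => x; rewrite (UK_mulE x); apply: UK_eq; apply: heq_mul1r.
Qed.
Lemma UK_mulDl : left_distributive UK_mul UK_add.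
Proof.
elim/quotW => x; elim/quotW => y; elim/quotW => z.
rewrite (UK_addE x y) (UK_mulE x z) (UK_mulE y z) (UK_mulE _ z) UK_addE.
by apply: UK_eq; apply: heq_mulDl.
Qed.
Lemma UK_mulDr : right_distributive UK_mul UK_add.
Proof.
elim/quotW => x; elim/quotW => y; elim/quotW => z.
rewrite (UK_addE y z) (UK_mulE x y) (UK_mulE x z) (UK_mulE x) UK_addE.
by apply: UK_eq; apply: heq_mulDr.
Qed.

HB.instance Definition _ := GRing.Zmodule_isPzRing.Build UK
  UK_mulA UK_mul1l UK_mul1r UK_mulDl UK_mulDr.

Definition scalU (r : R) : UK := \pi_UK (HScal r).
Definition hbarU : UK := \pi_UK HHbar.
Definition genU (f : K) : UK := \pi_UK (HGen f).

Lemma piU_add x y : \pi_UK (HAdd x y) = \pi_UK x + \pi_UK y.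
Proof. by rewrite -UK_addE. Qed.
Lemma piU_opp x : \pi_UK (HOpp x) = - \pi_UK x.
Proof. by rewrite -UK_oppE. Qed.
Lemma piU_mul x y : \pi_UK (HMul x y) = \pi_UK x * \pi_UK y.
Proof. by rewrite -UK_mulE. Qed.

Lemma scalUD r s : scalU (r + s) = scalU r + scalU s.
Proof. by rewrite -piU_add; apply: UK_eq; apply: heq_scalD. Qed.
Lemma scalUM r s : scalU (r * s) = scalU r * scalU s.
Proof. by rewrite -piU_mul; apply: UK_eq; apply: heq_scalM. Qed.
Lemma scalUC r u : scalU r * u = u * scalU r.
Proof. by elim/quotW: u => x; rewrite -!piU_mul; apply: UK_eq; apply: heq_scalC. Qed.
Lemma genUD f g : genU (f + g) = genU f + genU g.
Proof. by rewrite -piU_add; apply: UK_eq; apply: heq_genD. Qed.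
Lemma genUZ r f : genU (r *: f) = scalU r * genU f.
Proof. by rewrite -piU_mul; apply: UK_eq; apply: heq_genZ. Qed.
Lemma hbarUC u : hbarU * u = u * hbarU.
Proof. by elim/quotW: u => x; rewrite -!piU_mul; apply: UK_eq; apply: heq_hbarC. Qed.
Lemma genU_comm f g : genU f * genU g - genU g * genU f = scalU (res_form f g) * hbarU.
Proof. by rewrite -!piU_mul -piU_opp -piU_add; apply: UK_eq; apply: heq_comm. Qed.

Lemma scalU0 : scalU 0 = 0. Proof. by []. Qed.
Lemma scalU1 : scalU 1 = 1. Proof. by []. Qed.

Lemma UK_ind (P : UK -> Prop) :
  (forall r, P (scalU r)) -> P hbarU -> (forall f, P (genU f)) ->
  (forall u v, P u -> P v -> P (u + v)) -> (forall u, P u -> P (- u)) ->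
  (forall u v, P u -> P v -> P (u * v)) -> forall u, P u.
Proof.
move=> Ps Ph Pg PD PN PM; elim/quotW; elim=> //.
- by move=> x Px y Py; rewrite piU_add; apply: PD.
- by move=> x Px; rewrite piU_opp; apply: PN.
- by move=> x Px y Py; rewrite piU_mul; apply: PM.
Qed.

(* The left ideal U o m^N. *)
Definition Um_gen (N : nat) : set UK :=
  [set w | exists u f, mpow N f /\ w = u * genU f].
Definition Um N : {pred UK} := span (Um_gen N).
HB.instance Definition _ N := GRing.ZmodClosed.on (Um N).

Lemma Um_left N u w : w \in Um N -> u * w \in Um N.
Proof.
move: w; apply: span_map => [|x y|_ [v [f [fN ->]]]]; rewrite ?mulr0 ?mulrBr //.
by apply: span_gen; exists (u * v), f; rewrite mulrA.
Qed.

Lemma UmS M N : (N <= M)%N -> {subset Um M <= Um N}.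
Proof.
move=> NM; apply: span_sub => [|x y|w [u [f [fM ->]]]]; first exact: rpred0.
  exact: rpredB.
by apply: span_gen; exists u, f; split=> //; apply: mpowS fM.
Qed.

Lemma Um_right u N : exists M, forall w, w \in Um M -> w * u \in Um N.
Proof.
move: N; elim/UK_ind: u => [r|  |f|u v IHu IHv|u IHu|u v IHu IHv] N.
- by exists N => w wN; rewrite -scalUC Um_left.
- by exists N => w wN; rewrite -hbarUC Um_left.
- have [M gM] := res_form_small f.
  exists (maxn M N); apply: span_sub => [|x y xf yf|_ [u [g [gMN ->]]]].
  + by rewrite mul0r rpred0.
  + by rewrite mulrBl rpredB.
  have gN : mpow N g by apply: mpowS gMN; rewrite leq_maxr.
  have := genU_comm g f; rewrite gM; last by apply: mpowS gMN; rewrite leq_maxl.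
  rewrite scalU0 mul0r => /eqP; rewrite subr_eq0 -mulrA => /eqP ->.
  by rewrite Um_left // Um_left //; apply: span_gen; exists 1, g; rewrite mul1r.
- have [M uM] := IHu N; have [M' vM'] := IHv N.
  exists (maxn M M') => w wM; rewrite mulrDr rpredD ?uM ?vM' //.
  + by apply: UmS wM; rewrite leq_maxl.
  + by apply: UmS wM; rewrite leq_maxr.
- by have [M uM] := IHu N; exists M => w wM; rewrite mulrN rpredN uM.
- have [M vM] := IHv N; have [M' uM'] := IHu M.
  by exists M' => w wM; rewrite mulrA vM ?uM'.
Qed.

Definition modulus N u : nat := projT1 (cid (Um_right u N)).

Lemma modulusP N u w : w \in Um (modulus N u) -> w * u \in Um N.
Proof. by rewrite /modulus; case: cid => M /= uM; apply: uM. Qed.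

Definition Ulevel N : Type := {quot Um N}.

(* Elements of lim_N U / U o m^N; the condition says that the projection of U / U o
   m^(N+1) onto U / U o m^N sends [x N.+1] to [x N]. *)
Definition Ucompatible (x : forall N, Ulevel N) : Prop :=
  forall N, \pi_({quot Um N}) (repr (x N.+1)) = x N.

Record Ubar : Type := MkUbar {
  ubar_fam :> forall N, Ulevel N;
  ubarP : Ucompatible ubar_fam
}.

HB.instance Definition _ := gen_eqMixin Ubar.
HB.instance Definition _ := gen_choiceMixin Ubar.

(* A representative in [UK] of the class of x in U / U o m^N. *)
Definition lvl (x : Ubar) N : UK := repr (x N).

Lemma lvlS (x : Ubar) N : lvl x N.+1 - lvl x N \in Um N.
Proof. by apply/quotP; rewrite ubarP /lvl reprK. Qed.

Lemma lvl_le (x : Ubar) M N : (N <= M)%N -> lvl x M - lvl x N \in Um N.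
Proof.
elim: M => [|M IH]; first by rewrite leqn0 => /eqP->; rewrite subrr rpred0.
rewrite leq_eqVlt => /orP[/eqP->|]; first by rewrite subrr rpred0.
rewrite ltnS => NM; rewrite -(subrK (lvl x M) (lvl x M.+1)) -addrA rpredD ?IH //.
exact: UmS (lvlS x M).
Qed.

Lemma ubar_ext (x y : Ubar) : (forall N, lvl x N - lvl y N \in Um N) -> x = y.
Proof.
case: x y => x xP [y yP] xy; have E : x = y.
  apply: functional_extensionality_dep => N.
  by rewrite -(reprK (x N)) -(reprK (y N)); apply/quotP; apply: xy.
by subst y; congr MkUbar; apply: Prop_irrelevance.
Qed.

Definition coherent (s : nat -> UK) : Prop := forall N, s N.+1 - s N \in Um N.

Lemma mk_ubar_subproof s : coherent s -> Ucompatible (fun N => \pi_({quot Um N}) (s N)).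
Proof.
move=> cs N; apply/quotP; rewrite -(subrK (s N.+1) (repr _)) -addrA rpredD ?cs //.
exact: UmS (leqnSn N) _ (repr_quot _ _).
Qed.

Definition mk_ubar s (cs : coherent s) : Ubar := MkUbar (mk_ubar_subproof cs).

Lemma lvl_mk s (cs : coherent s) N : lvl (mk_ubar cs) N - s N \in Um N.
Proof. exact: repr_quot. Qed.

Lemma Um_sym N u v : u - v \in Um N -> v - u \in Um N.
Proof. by rewrite -opprB rpredN. Qed.

Lemma Um_trans N v u w : u - v \in Um N -> v - w \in Um N -> u - w \in Um N.
Proof. by move=> uv vw; rewrite -(subrK v u) -addrA rpredD. Qed.

Lemma Um_add N u u' v v' :
  u - u' \in Um N -> v - v' \in Um N -> (u + v) - (u' + v') \in Um N.
Proof. by move=> uu vv; rewrite opprD addrACA rpredD. Qed.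

Lemma Um_opp N u u' : u - u' \in Um N -> (- u) - (- u') \in Um N.
Proof. by move=> uu; rewrite -opprD rpredN. Qed.

Lemma const_coherent u : coherent (fun=> u).
Proof. by move=> N; rewrite subrr rpred0. Qed.
Definition ubar_const u : Ubar := mk_ubar (const_coherent u).

Lemma ubar_add_coherent (x y : Ubar) : coherent (fun N => lvl x N + lvl y N).
Proof. by move=> N; apply: Um_add; apply: lvlS. Qed.
Definition ubar_add x y : Ubar := mk_ubar (@ubar_add_coherent x y).

Lemma ubar_opp_coherent (x : Ubar) : coherent (fun N => - lvl x N).
Proof. by move=> N; apply: Um_opp; apply: lvlS. Qed.
Definition ubar_opp x : Ubar := mk_ubar (@ubar_opp_coherent x).

(* To compute a product modulo U o m^N, take y modulo U o m^N, then x modulo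
   U o m^M with M so large that (U o m^M) o y is contained in U o m^N. *)
Definition ubar_mul_seq (x y : Ubar) N : UK :=
  lvl x (modulus N (lvl y N)) * lvl y N.

Lemma ubar_mul_seqP x y N P :
  (modulus N (lvl y N) <= P)%N -> (N <= P)%N ->
  lvl x P * lvl y P - ubar_mul_seq x y N \in Um N.
Proof.
move=> MP NP; apply: (@Um_trans _ (lvl x P * lvl y N)).
  by rewrite -mulrBr Um_left // lvl_le.
by rewrite -mulrBl; apply: modulusP; apply: lvl_le.
Qed.

Lemma ubar_mul_coherent x y : coherent (ubar_mul_seq x y).
Proof.
move=> N; pose P := (modulus N (lvl y N) + modulus N.+1 (lvl y N.+1) + N.+1)%N.
apply: (@Um_trans _ (lvl x P * lvl y P)).
  by apply/Um_sym/(UmS (leqnSn N))/ubar_mul_seqP; rewrite /P; lia.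
by apply: ubar_mul_seqP; rewrite /P; lia.
Qed.
Definition ubar_mul x y : Ubar := mk_ubar (@ubar_mul_coherent x y).

Lemma ubar_mulP x y N : exists P0, forall P, (P0 <= P)%N ->
  lvl (ubar_mul x y) N - lvl x P * lvl y P \in Um N.
Proof.
exists (modulus N (lvl y N) + N)%N => P leP.
apply: Um_trans (lvl_mk _ _) _; apply/Um_sym/ubar_mul_seqP; lia.
Qed.

Lemma ubar_addP x y N P : (N <= P)%N ->
  lvl (ubar_add x y) N - (lvl x P + lvl y P) \in Um N.
Proof.
move=> NP; apply: Um_trans (lvl_mk _ _) _.
by apply: Um_add; apply/Um_sym/lvl_le.
Qed.

Lemma ubar_constP u N : lvl (ubar_const u) N - u \in Um N.
Proof. exact: lvl_mk. Qed.

Lemma ubar_addA : associative ubar_add.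
Proof.
move=> x y z; apply: ubar_ext => N.
apply: Um_trans (lvl_mk _ _) _; apply/Um_sym/(Um_trans (lvl_mk _ _)).
apply/Um_sym; apply: (@Um_trans _ (lvl x N + (lvl y N + lvl z N))).
  by apply: Um_add; rewrite ?subrr ?rpred0 // lvl_mk.
by rewrite addrA; apply: Um_add; rewrite ?subrr ?rpred0 //; apply/Um_sym/lvl_mk.
Qed.

Lemma ubar_addC : commutative ubar_add.
Proof.
move=> x y; apply: ubar_ext => N; apply: Um_trans (lvl_mk _ _) _.
by rewrite (addrC (lvl x N)); apply/Um_sym/lvl_mk.
Qed.

Lemma ubar_add0 : left_id (ubar_const 0) ubar_add.
Proof.
move=> x; apply: ubar_ext => N; apply: Um_trans (lvl_mk _ _) _.
rewrite -{2}(add0r (lvl x N)); apply: Um_add; last by rewrite subrr rpred0.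
exact: lvl_mk.
Qed.

Lemma ubar_addN : left_inverse (ubar_const 0) ubar_opp ubar_add.
Proof.
move=> x; apply: ubar_ext => N; apply: Um_trans (lvl_mk _ _) _.
apply/Um_sym/(Um_trans (lvl_mk _ _)); rewrite -(addNr (lvl x N)).
by apply/Um_sym/Um_add; rewrite ?subrr ?rpred0 // lvl_mk.
Qed.

HB.instance Definition _ :=
  GRing.isZmodule.Build Ubar ubar_addA ubar_addC ubar_add0 ubar_addN.

Lemma ubar_mulA : associative ubar_mul.
Proof.
move=> x y z; apply: ubar_ext => N.
have [P1 H1] := ubar_mulP x (ubar_mul y z) N.
have [P2 H2] := ubar_mulP y z N.
have [P4 H4] := ubar_mulP x y (modulus N (lvl z N)).
pose P := (P1 + P2 + P4 + N)%N.
apply: (@Um_trans _ (lvl x P * lvl (ubar_mul y z) N)).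
  apply: Um_trans (H1 P _) _; first by rewrite /P; lia.
  by rewrite -mulrBr Um_left // lvl_le // /P; lia.
apply: (@Um_trans _ (lvl x P * (lvl y P * lvl z P))).
  by rewrite -mulrBr Um_left // H2 // /P; lia.
apply: (@Um_trans _ (lvl x P * (lvl y P * lvl z N))).
  by rewrite -!mulrBr !Um_left // lvl_le // /P; lia.
rewrite mulrA; apply: (@Um_trans _ (ubar_mul_seq (ubar_mul x y) z N)).
  rewrite /ubar_mul_seq -mulrBl; apply: modulusP; apply/Um_sym/H4.
  by rewrite /P; lia.
exact/Um_sym/lvl_mk.
Qed.

Lemma ubar_mul1l : left_id (ubar_const 1) ubar_mul.
Proof.
move=> x; apply: ubar_ext => N; apply: Um_trans (lvl_mk _ _) _.
rewrite /ubar_mul_seq -{3}(mul1r (lvl x N)) -mulrBl; apply: modulusP.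
exact: lvl_mk.
Qed.

Lemma ubar_mul1r : right_id (ubar_const 1) ubar_mul.
Proof.
move=> x; apply: ubar_ext => N; have [P H] := ubar_mulP x (ubar_const 1) N.
apply: Um_trans (H (P + N)%N _) _; first lia.
apply: (@Um_trans _ (lvl x (P + N)%N * 1)); last by rewrite mulr1 lvl_le //; lia.
rewrite -mulrBr Um_left //; apply: UmS (ubar_constP 1 (P + N)); lia.
Qed.

Lemma ubar_mulDl : left_distributive ubar_mul +%R.
Proof.
move=> x y z; apply: ubar_ext => N.
have [P1 H1] := ubar_mulP (x + y) z N.
have [P2 H2] := ubar_mulP x z N; have [P3 H3] := ubar_mulP y z N.
pose M := modulus N (lvl z N); pose P := (P1 + P2 + P3 + M + N)%N.
apply/Um_sym/(Um_trans (lvl_mk _ _)).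
apply: (@Um_trans _ (lvl x P * lvl z P + lvl y P * lvl z P)).
  by apply: Um_add; [apply: H2 | apply: H3]; rewrite /P; lia.
apply/Um_sym/(Um_trans (lvl_mk _ _)); rewrite /ubar_mul_seq -/M.
apply: (@Um_trans _ ((lvl x P + lvl y P) * lvl z N)); last first.
  by rewrite -mulrDl -mulrBr Um_left //; apply/Um_sym/lvl_le; rewrite /P; lia.
rewrite -mulrBl; apply: modulusP; apply: ubar_addP; rewrite /P -/M; lia.
Qed.

Lemma ubar_mulDr : right_distributive ubar_mul +%R.
Proof.
move=> x y z; apply: ubar_ext => N.
have [P1 H1] := ubar_mulP x (y + z) N.
have [P2 H2] := ubar_mulP x y N; have [P3 H3] := ubar_mulP x z N.
pose P := (P1 + P2 + P3 + N)%N.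
apply/Um_sym/(Um_trans (lvl_mk _ _)).
apply: (@Um_trans _ (lvl x P * lvl y P + lvl x P * lvl z P)).
  by apply: Um_add; [apply: H2 | apply: H3]; rewrite /P; lia.
apply/Um_sym/(Um_trans (H1 P _)); first by rewrite /P; lia.
rewrite -mulrDr -mulrBr Um_left //; apply: (UmS (N := N) (M := P)); first by rewrite /P; lia.
exact: ubar_addP.
Qed.

HB.instance Definition _ := GRing.Zmodule_isPzRing.Build Ubar
  ubar_mulA ubar_mul1l ubar_mul1r ubar_mulDl ubar_mulDr.

Lemma ubar_constD u v : ubar_const (u + v) = ubar_const u + ubar_const v.
Proof.
apply: ubar_ext => N; apply: Um_trans (lvl_mk _ _) _.
by apply/Um_sym/(Um_trans (lvl_mk _ _))/Um_add; apply: lvl_mk.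
Qed.

Lemma ubar_constM u v : ubar_const (u * v) = ubar_const u * ubar_const v.
Proof.
apply: ubar_ext => N; apply: Um_trans (lvl_mk _ _) _.
have [P H] := ubar_mulP (ubar_const u) (ubar_const v) N.
have [M vM] := Um_right v N; pose Q := (P + M + N)%N.
apply/Um_sym/(Um_trans (H Q _)); first by rewrite /Q; lia.
apply: (@Um_trans _ (lvl (ubar_const u) Q * v)).
  by rewrite -mulrBr Um_left //; apply: UmS (lvl_mk _ _); rewrite /Q; lia.
rewrite -mulrBl vM //; apply: UmS (lvl_mk _ _); rewrite /Q; lia.
Qed.

Definition hbar_bar : Ubar := ubar_const hbarU.

Lemma hbar_barC (x : Ubar) : hbar_bar * x = x * hbar_bar.
Proof.
apply: ubar_ext => N.
have [P1 H1] := ubar_mulP hbar_bar x N; have [P2 H2] := ubar_mulP x hbar_bar N.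
have [M HM] := Um_right (lvl x N) N.
pose P := (P1 + P2 + M + N)%N.
apply: Um_trans (H1 P _) _; first by rewrite /P; lia.
apply/Um_sym/(Um_trans (H2 P _)); first by rewrite /P; lia.
apply: (@Um_trans _ (hbarU * lvl x N)).
  rewrite hbarUC; apply: (@Um_trans _ (lvl x P * hbarU)).
    by rewrite -mulrBr Um_left //; apply: UmS (lvl_mk _ _); rewrite /P; lia.
  by rewrite -mulrBl -hbarUC Um_left // lvl_le // /P; lia.
apply/Um_sym; apply: (@Um_trans _ (lvl hbar_bar P * lvl x N)).
  by rewrite -mulrBr Um_left // lvl_le // /P; lia.
rewrite -mulrBl HM //; apply: UmS (lvl_mk _ _); rewrite /P; lia.
Qed.

End Enveloping.

Section CentralLocalization.
Variables (A : pzRingType) (h : A) (hC : forall x, h * x = x * h).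

(* (x, n) stands for the fraction h^(-n) x. *)
Definition loc_rel : rel (A * nat) := fun u v =>
  `[< exists k, h ^+ (k + v.2) * u.1 = h ^+ (k + u.2) * v.1 >].

Lemma hXA a b (x : A) : h ^+ a * (h ^+ b * x) = h ^+ (a + b) * x.
Proof. by rewrite mulrA exprD. Qed.

Lemma hXC n (x : A) : h ^+ n * x = x * h ^+ n.
Proof. by apply/esym/commrX; rewrite /GRing.comm hC. Qed.

Lemma hX_raise l a b (x y : A) : h ^+ a * x = h ^+ b * y ->
  h ^+ (l + a) * x = h ^+ (l + b) * y.
Proof. by move=> E; rewrite -!hXA E. Qed.

Lemma loc_rel_equiv : equiv_class_of loc_rel.
Proof.
split=> [[x n]|[x n] [y m]|[y m] [x n] [z p]]; first by apply/asboolP; exists 0%N.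
  by apply/asboolP/asboolP => -[k E]; exists k.
move=> /asboolP[/= k E] /asboolP[/= l F]; apply/asboolP; exists (k + l + m)%N => /=.
rewrite (_ : k + l + m + p = (l + p) + (k + m))%N; last lia.
rewrite (hX_raise (l + p) E) (_ : l + p + (k + n) = (k + n) + (l + p))%N; last lia.
by rewrite (hX_raise (k + n) F); congr (_ ^+ _ * _); lia.
Qed.

Canonical loc_equiv := EquivRelPack loc_rel_equiv.

(* The centrality of [h] is an argument of the type so that it determines the
   ring structure. *)
Definition loc_at (_ : forall x, h * x = x * h) : Type := {eq_quot loc_rel}.
Local Notation loc := (loc_at hC).
HB.instance Definition _ := Choice.on loc.
HB.instance Definition _ := EqQuotient.on loc.

Definition frac (x : A) (n : nat) : loc := \pi_(loc) (x, n).

Lemma frac_eq x n y m :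
  frac x n = frac y m <-> exists k, h ^+ (k + m) * x = h ^+ (k + n) * y.
Proof.
have E : reflect (frac x n = frac y m) (loc_rel (x, n) (y, m)).
  have -> : loc_rel (x, n) (y, m) = (frac x n == frac y m) by rewrite /frac piE.
  exact: eqP.
by split=> [/E/asboolP//|H]; apply/E/asboolP.
Qed.

Definition numer (u : loc) : A := (repr u).1.
Definition denom (u : loc) : nat := (repr u).2.

Lemma fracE u : u = frac (numer u) (denom u).
Proof. by rewrite /frac -surjective_pairing reprK. Qed.

Lemma frac_reprP x n : exists k,
  h ^+ (k + n) * numer (frac x n) = h ^+ (k + denom (frac x n)) * x.
Proof. by apply/frac_eq; rewrite -fracE. Qed.

Lemma frac_raise k x n : frac (h ^+ k * x) (k + n) = frac x n.
Proof. by apply/frac_eq; exists 0%N; rewrite hXA; congr (_ ^+ _ * _); lia. Qed.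

Definition loc_add (u v : loc) : loc :=
  frac (h ^+ denom v * numer u + h ^+ denom u * numer v) (denom u + denom v).
Definition loc_opp (u : loc) : loc := frac (- numer u) (denom u).
Definition loc_mul (u v : loc) : loc := frac (numer u * numer v) (denom u + denom v).

Lemma loc_addE x n y m :
  loc_add (frac x n) (frac y m) = frac (h ^+ m * x + h ^+ n * y) (n + m).
Proof.
have [k] := frac_reprP x n; have [l] := frac_reprP y m.
rewrite /loc_add; move: (numer (frac x n)) (denom (frac x n)) => x' n'.
move: (numer (frac y m)) (denom (frac y m)) => y' m' F E.
apply/frac_eq; exists (k + l)%N; rewrite !mulrDr !hXA; congr (_ + _).
  rewrite (_ : _ + m' = (l + m + m') + (k + n))%N; last lia.
  by rewrite (hX_raise _ E); congr (_ ^+ _ * _); lia.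
rewrite (_ : _ + n' = (k + n + n') + (l + m))%N; last lia.
by rewrite (hX_raise _ F); congr (_ ^+ _ * _); lia.
Qed.

Lemma loc_oppE x n : loc_opp (frac x n) = frac (- x) n.
Proof.
have [k] := frac_reprP x n; rewrite /loc_opp => E.
by apply/frac_eq; exists k; rewrite !mulrN E.
Qed.

Lemma loc_mulE x n y m : loc_mul (frac x n) (frac y m) = frac (x * y) (n + m).
Proof.
have [k] := frac_reprP x n; have [l] := frac_reprP y m.
rewrite /loc_mul; move: (numer (frac x n)) (denom (frac x n)) => x' n'.
move: (numer (frac y m)) (denom (frac y m)) => y' m' F E.
have M a b (z w : A) : h ^+ (a + b) * (z * w) = (h ^+ a * z) * (h ^+ b * w).
  by rewrite exprD -mulrA (mulrA (h ^+ b)) (hXC b z) !mulrA.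
apply/frac_eq; exists (k + l)%N.
rewrite (_ : _ + (n + m) = (k + n) + (l + m))%N; last lia.
by rewrite M E F -M; congr (_ ^+ _ * _); lia.
Qed.

Lemma frac_ind (P : loc -> Prop) : (forall x n, P (frac x n)) -> forall u, P u.
Proof. by move=> H u; rewrite (fracE u). Qed.

Lemma loc_addA : associative loc_add.
Proof.
elim/frac_ind=> x n; elim/frac_ind=> y m; elim/frac_ind=> z p.
rewrite (loc_addE y m) (loc_addE x n y m) (loc_addE x n) (loc_addE _ _ z).
rewrite addnA; congr frac; rewrite !mulrDr !hXA addrA.
by congr (_ ^+ _ * _ + _ ^+ _ * _ + _ ^+ _ * _); lia.
Qed.

Lemma loc_addC : commutative loc_add.
Proof.
elim/frac_ind=> x n; elim/frac_ind=> y m.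
by rewrite (loc_addE x n) (loc_addE y m) addrC addnC.
Qed.

Lemma loc_add0 : left_id (frac 0 0) loc_add.
Proof.
elim/frac_ind=> x n; rewrite (loc_addE 0 0).
by rewrite mulr0 add0r expr0 mul1r add0n.
Qed.

Lemma frac0 n : frac 0 n = frac 0 0.
Proof. by apply/frac_eq; exists 0%N; rewrite !mulr0. Qed.

Lemma loc_addN : left_inverse (frac 0 0) loc_opp loc_add.
Proof.
elim/frac_ind=> x n; rewrite (loc_oppE x) (loc_addE _ n).
by rewrite mulrN addNr frac0.
Qed.

HB.instance Definition _ :=
  GRing.isZmodule.Build loc loc_addA loc_addC loc_add0 loc_addN.

Lemma loc_mulA : associative loc_mul.
Proof.
elim/frac_ind=> x n; elim/frac_ind=> y m; elim/frac_ind=> z p.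
rewrite (loc_mulE y m) (loc_mulE x n y) (loc_mulE x n) (loc_mulE _ _ z).
by rewrite mulrA addnA.
Qed.

Lemma loc_mul1l : left_id (frac 1 0) loc_mul.
Proof. by elim/frac_ind=> x n; rewrite (loc_mulE 1 0) mul1r. Qed.

Lemma loc_mul1r : right_id (frac 1 0) loc_mul.
Proof. by elim/frac_ind=> x n; rewrite (loc_mulE x n) mulr1 addn0. Qed.

Lemma loc_mulDl : left_distributive loc_mul loc_add.
Proof.
elim/frac_ind=> x n; elim/frac_ind=> y m; elim/frac_ind=> z p.
rewrite (loc_addE x n) (loc_mulE x n) (loc_mulE y m) (loc_mulE _ _ z) loc_addE.
rewrite mulrDl -!mulrA -(frac_raise p) mulrDr !hXA.
by congr frac; last lia; congr (_ ^+ _ * _ + _ ^+ _ * _); lia.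
Qed.

Lemma loc_mulDr : right_distributive loc_mul loc_add.
Proof.
elim/frac_ind=> x n; elim/frac_ind=> y m; elim/frac_ind=> z p.
rewrite (loc_addE y m) (loc_mulE x n y) (loc_mulE x n z) (loc_mulE x n) loc_addE.
rewrite -(frac_raise n) mulrDr !mulrA -!(hXC _ x) -!mulrA mulrDr !hXA.
by congr frac; last lia; congr (_ ^+ _ * _ + _ ^+ _ * _); lia.
Qed.

HB.instance Definition _ := GRing.Zmodule_isPzRing.Build loc
  loc_mulA loc_mul1l loc_mul1r loc_mulDl loc_mulDr.

Lemma fracD x y n : frac (x + y) n = frac x n + frac y n.
Proof.
by rewrite -[RHS]/(loc_add _ _) loc_addE -mulrDr frac_raise.
Qed.

Lemma fracM x n y m : frac (x * y) (n + m) = frac x n * frac y m.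
Proof. by rewrite -[RHS]/(loc_mul _ _) loc_mulE. Qed.

End CentralLocalization.

Arguments frac {A h} hC x n.
Arguments frac_reprP {A h} hC x n.

(* bar U [h-bar^-1] *)
Notation Uloc K := (loc_at (@hbar_barC _ K)).

Section Fock.
Variables (R : comNzRingType) (K : laurentType R).

Local Notation UK := (UK K).
Local Notation Ubar := (Ubar K).

Local Notation Uloc := (Uloc K).

Definition toUloc (u : UK) : Uloc := frac (@hbar_barC R K) (ubar_const u) 0.
Definition scalL (r : R) : Uloc := toUloc (scalU K r).
Definition genL (f : K) : Uloc := toUloc (genU f).

(* The tensor product of UK with R over the enveloping algebra of O + R h-bar
   is the quotient of UK = UK (x)_R R by the relations
   u o x (x) 1 = u (x) x.1 for x = f + r h-bar in O + R h-bar, where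
   x.1 = r. The class of 1 is the generator v_o. *)
Definition fock_gen : set UK :=
  [set w | exists u f r, mpow 0 f /\
             w = u * (genU f + scalU K r * hbarU K) - u * scalU K r].

Definition Fock : Type := {quot span fock_gen}.
HB.instance Definition _ := Choice.on Fock.
HB.instance Definition _ := EqQuotient.on Fock.
HB.instance Definition _ := GRing.Zmodule.on Fock.

Lemma Fock_eqP (u v : UK) :
  reflect (\pi_Fock u = \pi_Fock v) (u - v \in span fock_gen).
Proof. exact: quotP. Qed.

Lemma Fock_left u w : w \in span fock_gen -> u * w \in span fock_gen.
Proof.
move: w; apply: span_map => [|x y|_ [v [f [r [f0 ->]]]]]; rewrite ?mulr0 ?mulrBr //.
by apply: span_gen; exists (u * v), f, r; rewrite !mulrA.
Qed.

Lemma Um0_Fock w : w \in Um 0 -> w \in span fock_gen.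
Proof.
move: w; apply: span_sub => [|x y|_ [u [f [f0 ->]]]]; first exact: rpred0.
  exact: rpredB.
by apply: span_gen; exists u, f, 0; rewrite scalU0 mul0r addr0 mulr0 subr0.
Qed.

Lemma piFD (u v : UK) : \pi_Fock (u + v) = \pi_Fock u + \pi_Fock v.
Proof. by rewrite !piE. Qed.

Definition bar_act (x : Ubar) (w : Fock) : Fock :=
  \pi_Fock (lvl x (modulus 0 (repr w)) * repr w).

Lemma bar_actE x v P : (modulus 0 v <= P)%N ->
  bar_act x (\pi_Fock v) = \pi_Fock (lvl x P * v).
Proof.
move=> leP; rewrite /bar_act; set v' := repr _; set M := modulus 0 v'.
have vv' : v' - v \in span fock_gen by apply/Fock_eqP; rewrite reprK.
transitivity (\pi_Fock (lvl x (M + P)%N * v')).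
  apply/Fock_eqP; rewrite -mulrBl; apply/Um0_Fock/modulusP.
  by apply/Um_sym/lvl_le; rewrite leq_addr.
transitivity (\pi_Fock (lvl x (M + P)%N * v)).
  by apply/Fock_eqP; rewrite -mulrBr Fock_left.
apply/Fock_eqP; rewrite -mulrBl; apply/Um0_Fock/modulusP.
by apply: UmS (lvl_le x _); lia.
Qed.

Lemma bar_actDr x v w : bar_act x (v + w) = bar_act x v + bar_act x w.
Proof.
elim/quotW: v => v; elim/quotW: w => w; rewrite -piFD.
pose P := (modulus 0 v + modulus 0 w + modulus 0 (v + w))%N.
by rewrite !(@bar_actE _ _ P) ?mulrDr ?piFD //; rewrite /P ?leq_addl //; lia.
Qed.

Lemma bar_actDl x y v : bar_act (x + y) v = bar_act x v + bar_act y v.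
Proof.
elim/quotW: v => v; rewrite !(bar_actE _ (leqnn _)) -piFD -mulrDl.
apply/Fock_eqP; rewrite -mulrBl; apply/Um0_Fock/modulusP.
exact: ubar_addP (leqnn _).
Qed.

Lemma bar_act_const u v : bar_act (ubar_const u) (\pi_Fock v) = \pi_Fock (u * v).
Proof.
rewrite (bar_actE _ (leqnn _)).
by apply/Fock_eqP; rewrite -mulrBl; apply/Um0_Fock/modulusP/lvl_mk.
Qed.

Lemma bar_actA x y v : bar_act x (bar_act y v) = bar_act (x * y) v.
Proof.
elim/quotW: v => v; set P := modulus 0 v.
rewrite (bar_actE (x * y) (leqnn _)) (bar_actE y (leqnn _)) -/P.
have [Q0 HQ] := ubar_mulP x y P.
pose Q := (Q0 + P + modulus 0 (lvl y P * v))%N.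
rewrite (@bar_actE _ _ Q); last by rewrite /Q; lia.
transitivity (\pi_Fock (lvl x Q * (lvl y Q * v))).
  apply/Fock_eqP; rewrite -mulrBr -mulrBl Fock_left //.
  by apply/Um0_Fock/modulusP/Um_sym/lvl_le; rewrite /Q; lia.
rewrite mulrA; apply/Fock_eqP; rewrite -mulrBl; apply/Um0_Fock/modulusP/Um_sym/HQ.
by rewrite /Q; lia.
Qed.

Lemma bar_act1 v : bar_act 1 v = v.
Proof. by elim/quotW: v => v; rewrite bar_act_const mul1r. Qed.

Lemma bar_act_hbar n v : bar_act (hbar_bar K ^+ n) v = v.
Proof.
elim: n => [|n IH]; first by rewrite expr0 bar_act1.
rewrite exprS -bar_actA IH; elim/quotW: v {IH} => v; rewrite bar_act_const.
apply/Fock_eqP; rewrite hbarUC; apply: span_gen; exists v, 0, 1.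
split; first by move=> i _; rewrite coef0.
have -> : genU (0 : K) = 0.
  by apply: (@addrI _ (genU (0 : K))); rewrite -genUD !addr0.
by rewrite scalU1 add0r mul1r mulr1.
Qed.

(* The action of bar U [h-bar^-1], with h-bar acting as 1. *)
Definition loc_act (z : Uloc) (w : Fock) : Fock := bar_act (numer z) w.

Lemma loc_actE x n w : loc_act (frac _ x n) w = bar_act x w.
Proof.
have [k E] := frac_reprP (@hbar_barC R K) x n.
rewrite /loc_act -(bar_act_hbar (k + n) (bar_act _ w)) bar_actA E.
by rewrite -bar_actA bar_act_hbar.
Qed.

Lemma loc_actA y z w : loc_act y (loc_act z w) = loc_act (y * z) w.
Proof.
elim/frac_ind: y => x n; elim/frac_ind: z => y m.
by rewrite -fracM !loc_actE bar_actA.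
Qed.

Lemma loc_act1 : left_id 1 loc_act.
Proof. by move=> w; rewrite -[1]/(frac _ 1 0) loc_actE bar_act1. Qed.

Lemma loc_actDr : right_distributive loc_act +%R.
Proof. by move=> z v w; rewrite /loc_act bar_actDr. Qed.

Lemma loc_actDl v : {morph loc_act^~ v : y z / y + z}.
Proof.
elim/frac_ind=> x n; elim/frac_ind=> y m.
rewrite -[_ + _]/(loc_add _ _) loc_addE !loc_actE bar_actDl -!bar_actA.
by rewrite !bar_act_hbar.
Qed.

HB.instance Definition _ := GRing.Zmodule_isLmodule.Build Uloc Fock
  loc_actA loc_act1 loc_actDr loc_actDl.

End Fock.

HB.mixin Record Lmodule_isLie (k : pzRingType) L of GRing.Lmodule k L := {
  lie : L -> L -> L;
  lie_linearl : forall c x y z, lie (c *: x + y) z = c *: lie x z + lie y z;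
  lie_linearr : forall c x y z, lie z (c *: x + y) = c *: lie z x + lie z y;
  liexx : forall x, lie x x = 0;
  lie_jacobi : forall x y z, lie x (lie y z) + lie y (lie z x) + lie z (lie x y) = 0
}.

#[short(type="lieType")]
HB.structure Definition Lie (k : pzRingType) :=
  {L of GRing.Lmodule k L & Lmodule_isLie k L}.

Definition derivation (S : comNzRingType) (D : S -> S) : Prop :=
  (forall x y, D (x + y) = D x + D y) /\
  (forall x y, D (x * y) = D x * y + x * D y).

Section Derivation.
Variables (S : comNzRingType) (D : S -> S) (DD : derivation D).

Lemma der0 : D 0 = 0.
Proof. by apply: (@addrI _ (D 0)); rewrite -DD.1 !addr0. Qed.
Lemma derN x : D (- x) = - D x.
Proof. by apply/eqP; rewrite -addr_eq0 -DD.1 addNr der0. Qed.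
Lemma derB x y : D (x - y) = D x - D y.
Proof. by rewrite DD.1 derN. Qed.
Lemma der1 : D 1 = 0.
Proof.
by apply: (@addrI _ (D 1)); rewrite addr0 -{3}(mulr1 1) DD.2 mulr1 mul1r.
Qed.
Lemma der_sum I (r : seq I) (P : pred I) F :
  D (\sum_(i <- r | P i) F i) = \sum_(i <- r | P i) D (F i).
Proof. exact: (big_morph D DD.1 der0). Qed.
Lemma derMn x n : D (x *+ n) = D x *+ n.
Proof. by elim: n => [|n IH]; rewrite ?mulr0n ?der0 // !mulrS DD.1 IH. Qed.
Lemma derMz x (n : int) : D (x *~ n) = D x *~ n.
Proof. by case: n => n; rewrite ?NegzE ?mulrNz -?pmulrn ?derN derMn. Qed.

End Derivation.

Section DerivationOps.
Variables (S : comNzRingType).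
Implicit Types D E : S -> S.

Lemma derivation_zero : derivation (fun=> 0 : S).
Proof. by split=> x y; rewrite ?addr0 // mul0r mulr0 addr0. Qed.
Lemma derivation_add D E : derivation D -> derivation E ->
  derivation (fun x => D x + E x).
Proof.
move=> [DD DM] [ED EM]; split=> x y; first by rewrite DD ED addrACA.
by rewrite DM EM mulrDl mulrDr addrACA.
Qed.
Lemma derivation_opp D : derivation D -> derivation (fun x => - D x).
Proof.
by move=> [DD DM]; split=> x y; rewrite ?DD ?DM opprD // mulNr mulrN.
Qed.
Lemma derivation_comm D E : derivation D -> derivation E ->
  derivation (fun x => D (E x) - E (D x)).
Proof.
move=> DD ED; split=> x y.
  by rewrite ED.1 DD.1 DD.1 ED.1 opprD addrACA.
rewrite ED.2 DD.2 DD.1 ED.1 !DD.2 !ED.2; ring.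
Qed.
End DerivationOps.

Local Obligation Tactic := try done.

(* The Lie algebra of k-derivations of a commutative k-algebra [R]. *)
Section ThetaR.
Variables (k : comNzRingType) (R : comAlgType k).

Record thetaR : Type := ThetaR {
  thetaR_fun :> R -> R;
  thetaR_der : derivation thetaR_fun;
  thetaR_k : forall c : k, thetaR_fun c%:A = 0
}.

HB.instance Definition _ := gen_eqMixin thetaR.
HB.instance Definition _ := gen_choiceMixin thetaR.

Implicit Types d e : thetaR.

Lemma thetaR_ext d e : (forall r, d r = e r) -> d = e.
Proof.
case: d e => d dD dk [e eD ek] de.
have E : d = e by apply/funext.
by subst e; congr ThetaR; apply: Prop_irrelevance.
Qed.

Lemma thetaRZ d (c : k) r : d (c *: r) = c *: d r.
Proof.
by rewrite -mulr_algl (thetaR_der d).2 thetaR_k mul0r add0r mulr_algl.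
Qed.

Program Definition thetaR_zero : thetaR :=
  @ThetaR (fun=> 0) (derivation_zero R) _.
Program Definition thetaR_add d e : thetaR :=
  @ThetaR (fun r => d r + e r) (derivation_add (thetaR_der d) (thetaR_der e)) _.
Next Obligation. by move=> * /=; rewrite !thetaR_k addr0. Qed.
Program Definition thetaR_opp d : thetaR :=
  @ThetaR (fun r => - d r) (derivation_opp (thetaR_der d)) _.
Next Obligation. by move=> * /=; rewrite !thetaR_k oppr0. Qed.
Program Definition thetaR_scale (c : k) d : thetaR :=
  @ThetaR (fun r => c *: d r) _ _.
Next Obligation.
move=> c d; split=> x y; first by rewrite (thetaR_der d).1 scalerDr.
by rewrite (thetaR_der d).2 scalerDr scalerAl scalerAr.
Qed.
Next Obligation. by move=> * /=; rewrite !thetaR_k scaler0. Qed.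
Program Definition thetaR_lie d e : thetaR :=
  @ThetaR (fun r => d (e r) - e (d r))
    (derivation_comm (thetaR_der d) (thetaR_der e)) _.
Next Obligation.
by move=> d e c /=; rewrite !thetaR_k (der0 (thetaR_der d)) (der0 (thetaR_der e)) subr0.
Qed.

Fact thetaR_addA : associative thetaR_add.
Proof. by move=> d e f; apply: thetaR_ext => r /=; rewrite addrA. Qed.
Fact thetaR_addC : commutative thetaR_add.
Proof. by move=> d e; apply: thetaR_ext => r /=; rewrite addrC. Qed.
Fact thetaR_add0 : left_id thetaR_zero thetaR_add.
Proof. by move=> d; apply: thetaR_ext => r /=; rewrite add0r. Qed.
Fact thetaR_addN : left_inverse thetaR_zero thetaR_opp thetaR_add.
Proof. by move=> d; apply: thetaR_ext => r /=; rewrite addNr. Qed.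

HB.instance Definition _ :=
  GRing.isZmodule.Build thetaR thetaR_addA thetaR_addC thetaR_add0 thetaR_addN.

Fact thetaR_scaleA a b d : thetaR_scale a (thetaR_scale b d) = thetaR_scale (a * b) d.
Proof. by apply: thetaR_ext => r /=; rewrite scalerA. Qed.
Fact thetaR_scale1 : left_id 1 thetaR_scale.
Proof. by move=> d; apply: thetaR_ext => r /=; rewrite scale1r. Qed.
Fact thetaR_scaleDr : right_distributive thetaR_scale +%R.
Proof. by move=> c d e; apply: thetaR_ext => r /=; rewrite scalerDr. Qed.
Fact thetaR_scaleDl d : {morph thetaR_scale^~ d : a b / a + b}.
Proof. by move=> a b; apply: thetaR_ext => r /=; rewrite scalerDl. Qed.

HB.instance Definition _ := GRing.Zmodule_isLmodule.Build k thetaR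
  thetaR_scaleA thetaR_scale1 thetaR_scaleDr thetaR_scaleDl.

Fact thetaR_lie_linearl c x y z :
  thetaR_lie (c *: x + y) z = c *: thetaR_lie x z + thetaR_lie y z.
Proof.
apply: thetaR_ext => r /=.
by rewrite (thetaR_der z).1 thetaRZ opprD addrACA -scalerBr.
Qed.
Fact thetaR_lie_linearr c x y z :
  thetaR_lie z (c *: x + y) = c *: thetaR_lie z x + thetaR_lie z y.
Proof.
apply: thetaR_ext => r /=.
by rewrite (thetaR_der z).1 thetaRZ opprD addrACA -scalerBr.
Qed.
Fact thetaR_liexx x : thetaR_lie x x = 0.
Proof. by apply: thetaR_ext => r /=; rewrite subrr. Qed.
Fact thetaR_jacobi x y z :
  thetaR_lie x (thetaR_lie y z) + thetaR_lie y (thetaR_lie z x) +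
  thetaR_lie z (thetaR_lie x y) = 0.
Proof.
apply: thetaR_ext => r /=.
rewrite !(derB (thetaR_der x), derB (thetaR_der y), derB (thetaR_der z)); ring.
Qed.

HB.instance Definition _ := Lmodule_isLie.Build k thetaR
  thetaR_lie_linearl thetaR_lie_linearr thetaR_liexx thetaR_jacobi.

End ThetaR.

(* The Lie algebra of continuous k-derivations of [K] that preserve [R]. *)
Section ThetaKR.
Variables (k : comNzRingType) (R : comAlgType k) (K : laurentType R).

Record thetaKR : Type := ThetaKR {
  thetaKR_fun :> K -> K;
  thetaKR_der : derivation thetaKR_fun;
  thetaKR_k : forall c : k, thetaKR_fun (c%:A : R)%:A = 0;
  thetaKR_cont : continuous_mad thetaKR_fun;
  thetaKR_R : forall r : R, exists s : R, thetaKR_fun r%:A = s%:A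
}.

HB.instance Definition _ := gen_eqMixin thetaKR.
HB.instance Definition _ := gen_choiceMixin thetaKR.

Implicit Types D E : thetaKR.

Lemma thetaKR_ext D E : (forall f, D f = E f) -> D = E.
Proof.
case: D E => D D1 D2 D3 D4 [E E1 E2 E3 E4] de.
have DE : D = E by apply/funext.
by subst E; congr ThetaKR; apply: Prop_irrelevance.
Qed.

Lemma thetaKRZ D (c : k) f : D ((c%:A : R) *: f) = (c%:A : R) *: D f.
Proof.
by rewrite -[_ *: f]mulr_algl (thetaKR_der D).2 thetaKR_k mul0r add0r mulr_algl.
Qed.

Lemma mpowD N (f g : K) : mpow N f -> mpow N g -> mpow N (f + g).
Proof. by move=> fN gN i lti; rewrite coefD fN ?gN ?addr0. Qed.
Lemma mpowZ N r (f : K) : mpow N f -> mpow N (r *: f).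
Proof. by move=> fN i lti; rewrite coefZ fN ?mulr0. Qed.
Lemma mpowN N (f : K) : mpow N f -> mpow N (- f).
Proof. by move=> fN i lti; rewrite coefN fN ?oppr0. Qed.

Lemma continuous_add (F G : K -> K) : continuous_mad F -> continuous_mad G ->
  continuous_mad (fun f => F f + G f).
Proof.
move=> cF cG N; have [M HM] := cF N; have [P HP] := cG N.
exists (M + P)%N => f fMP; apply: mpowD; [apply: HM | apply: HP];
  by apply: mpowS fMP; lia.
Qed.
Lemma continuous_opp (F : K -> K) : continuous_mad F ->
  continuous_mad (fun f => - F f).
Proof.
by move=> cF N; have [M HM] := cF N; exists M => f fM; apply/mpowN/HM.
Qed.
Lemma continuous_comp (F G : K -> K) : continuous_mad F -> continuous_mad G ->
  continuous_mad (fun f => F (G f)).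
Proof.
move=> cF cG N; have [M HM] := cF N; have [P HP] := cG M.
by exists P => f fP; apply/HM/HP.
Qed.

Program Definition thetaKR_zero : thetaKR :=
  @ThetaKR (fun=> 0) (derivation_zero K) _ _ _.
Next Obligation. by move=> N; exists 0%N => f _ i _; rewrite coef0. Qed.
Next Obligation. by move=> r; exists 0; rewrite scale0r. Qed.
Program Definition thetaKR_add D E : thetaKR :=
  @ThetaKR (fun f => D f + E f)
    (derivation_add (thetaKR_der D) (thetaKR_der E)) _
    (continuous_add (thetaKR_cont D) (thetaKR_cont E)) _.
Next Obligation. by move=> * /=; rewrite !thetaKR_k addr0. Qed.
Next Obligation.
move=> D E r; have [s ->] := thetaKR_R D r; have [s' ->] := thetaKR_R E r.
by exists (s + s'); rewrite scalerDl.
Qed.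
Program Definition thetaKR_opp D : thetaKR :=
  @ThetaKR (fun f => - D f) (derivation_opp (thetaKR_der D)) _
    (continuous_opp (thetaKR_cont D)) _.
Next Obligation. by move=> * /=; rewrite !thetaKR_k oppr0. Qed.
Next Obligation.
by move=> D r; have [s ->] := thetaKR_R D r; exists (- s); rewrite scaleNr.
Qed.
Program Definition thetaKR_scale (c : k) D : thetaKR :=
  @ThetaKR (fun f => (c%:A : R) *: D f) _ _ _ _.
Next Obligation.
move=> c D; split=> x y; first by rewrite (thetaKR_der D).1 scalerDr.
by rewrite (thetaKR_der D).2 scalerDr scalerAl scalerAr.
Qed.
Next Obligation. by move=> * /=; rewrite !thetaKR_k scaler0. Qed.
Next Obligation.
move=> c D N; have [M HM] := thetaKR_cont D N.
by exists M => f fM; apply/mpowZ/HM.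
Qed.
Next Obligation.
move=> c D r; have [s ->] := thetaKR_R D r.
by exists ((c%:A : R) * s); rewrite scalerA.
Qed.
Program Definition thetaKR_lie D E : thetaKR :=
  @ThetaKR (fun f => D (E f) - E (D f))
    (derivation_comm (thetaKR_der D) (thetaKR_der E)) _
    (continuous_add (continuous_comp (thetaKR_cont D) (thetaKR_cont E))
       (continuous_opp (continuous_comp (thetaKR_cont E) (thetaKR_cont D)))) _.
Next Obligation.
move=> D E c /=.
by rewrite !thetaKR_k (der0 (thetaKR_der D)) (der0 (thetaKR_der E)) subr0.
Qed.
Next Obligation.
move=> D E r; have [s Er] := thetaKR_R E r; have [s' Dr] := thetaKR_R D r.
have [u Ds] := thetaKR_R D s; have [v Es] := thetaKR_R E s'.
by exists (u - v); rewrite Er Dr Ds Es scalerBl.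
Qed.

Fact thetaKR_addA : associative thetaKR_add.
Proof. by move=> d e f; apply: thetaKR_ext => r /=; rewrite addrA. Qed.
Fact thetaKR_addC : commutative thetaKR_add.
Proof. by move=> d e; apply: thetaKR_ext => r /=; rewrite addrC. Qed.
Fact thetaKR_add0 : left_id thetaKR_zero thetaKR_add.
Proof. by move=> d; apply: thetaKR_ext => r /=; rewrite add0r. Qed.
Fact thetaKR_addN : left_inverse thetaKR_zero thetaKR_opp thetaKR_add.
Proof. by move=> d; apply: thetaKR_ext => r /=; rewrite addNr. Qed.

HB.instance Definition _ := GRing.isZmodule.Build thetaKR
  thetaKR_addA thetaKR_addC thetaKR_add0 thetaKR_addN.

Fact thetaKR_scaleA a b d :
  thetaKR_scale a (thetaKR_scale b d) = thetaKR_scale (a * b) d.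
Proof.
by apply: thetaKR_ext => r /=; rewrite scalerA mulr_algl scalerA.
Qed.
Fact thetaKR_scale1 : left_id 1 thetaKR_scale.
Proof. by move=> d; apply: thetaKR_ext => r /=; rewrite !scale1r. Qed.
Fact thetaKR_scaleDr : right_distributive thetaKR_scale +%R.
Proof. by move=> c d e; apply: thetaKR_ext => r /=; rewrite scalerDr. Qed.
Fact thetaKR_scaleDl d : {morph thetaKR_scale^~ d : a b / a + b}.
Proof. by move=> a b; apply: thetaKR_ext => r /=; rewrite !scalerDl. Qed.

HB.instance Definition _ := GRing.Zmodule_isLmodule.Build k thetaKR
  thetaKR_scaleA thetaKR_scale1 thetaKR_scaleDr thetaKR_scaleDl.

Fact thetaKR_lie_linearl c x y z :
  thetaKR_lie (c *: x + y) z = c *: thetaKR_lie x z + thetaKR_lie y z.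
Proof.
apply: thetaKR_ext => r /=.
by rewrite (thetaKR_der z).1 thetaKRZ opprD addrACA -scalerBr.
Qed.
Fact thetaKR_lie_linearr c x y z :
  thetaKR_lie z (c *: x + y) = c *: thetaKR_lie z x + thetaKR_lie z y.
Proof.
apply: thetaKR_ext => r /=.
by rewrite (thetaKR_der z).1 thetaKRZ opprD addrACA -scalerBr.
Qed.
Fact thetaKR_liexx x : thetaKR_lie x x = 0.
Proof. by apply: thetaKR_ext => r /=; rewrite subrr. Qed.
Fact thetaKR_jacobi x y z :
  thetaKR_lie x (thetaKR_lie y z) + thetaKR_lie y (thetaKR_lie z x) +
  thetaKR_lie z (thetaKR_lie x y) = 0.
Proof.
apply: thetaKR_ext => r /=.
rewrite !(derB (thetaKR_der x), derB (thetaKR_der y), derB (thetaKR_der z)); ring.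
Qed.

HB.instance Definition _ := Lmodule_isLie.Build k thetaKR
  thetaKR_lie_linearl thetaKR_lie_linearr thetaKR_liexx thetaKR_jacobi.

Lemma thetaKR_coef0 D r : D r%:A = (coef (D r%:A) 0)%:A.
Proof. by have [s ->] := thetaKR_R D r; rewrite coefA eqxx. Qed.

(* The restriction of D to R; see [baseE]. *)
Program Definition base D : thetaR R := @ThetaR _ R (fun r => coef (D r%:A) 0) _ _.
Next Obligation.
move=> D; split=> r s; first by rewrite scalerDl (thetaKR_der D).1 coefD.
have -> : (r * s)%:A = r%:A * s%:A :> K by rewrite mulr_algl scalerA.
rewrite (thetaKR_der D).2 coefD; congr (_ + _); first by rewrite mulrC mulr_algl coefZ mulrC.
by rewrite mulr_algl coefZ.
Qed.
Next Obligation. by move=> D c /=; rewrite thetaKR_k coef0. Qed.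

Lemma baseE D r : D r%:A = (base D r)%:A.
Proof. exact: thetaKR_coef0. Qed.

End ThetaKR.

Section Coefficientwise.
Variables (k : comNzRingType) (R : comAlgType k) (K : laurentType R).
Variable d : thetaR R.
Let dD := thetaR_der d.
Local Notation UK := (UK K).
Local Notation Ubar := (Ubar K).

Definition hor (f : K) : K := series (fun i => d (coef f i)).

Lemma hor_bounded (f : K) n :
  (forall i, (i < n)%R -> coef f i = 0) ->
  forall i, (i < n)%R -> d (coef f i) = 0.
Proof. by move=> fn i lti; rewrite fn // (der0 dD). Qed.

Lemma coef_hor f i : coef (hor f) i = d (coef f i).
Proof.
rewrite seriesK //; have [n fn] := coef_bounded f.
by exists n; apply: hor_bounded.
Qed.

Lemma horD f g : hor (f + g) = hor f + hor g.
Proof. by apply: coef_ext => i; rewrite coefD !coef_hor coefD dD.1. Qed.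

Lemma horZ r f : hor (r *: f) = d r *: f + r *: hor f.
Proof. by apply: coef_ext => i; rewrite coefD !coefZ !coef_hor coefZ dD.2. Qed.

Lemma horM f g : hor (f * g) = hor f * g + f * hor g.
Proof.
have [m fm] := coef_bounded f; have [n gn] := coef_bounded g.
have fm' i : (i < m)%R -> coef (hor f) i = 0.
  by move=> lti; rewrite coef_hor (hor_bounded fm).
have gn' i : (i < n)%R -> coef (hor g) i = 0.
  by move=> lti; rewrite coef_hor (hor_bounded gn).
apply: coef_ext => i; rewrite coef_hor coefD.
have [lti|lei] := boolP (i < m + n)%R.
  rewrite (coefM_lt fm gn lti) (coefM_lt fm' gn lti) (coefM_lt fm gn' lti).
  by rewrite (der0 dD) addr0.
have [p ->] : exists p : nat, i = m + n + p%:Z by exists (absz (i - (m + n))%R); lia.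
rewrite (coefM _ _ _ _ fm gn) (coefM _ _ _ _ fm' gn) (coefM _ _ _ _ fm gn').
rewrite (der_sum dD) -big_split /=; apply: eq_bigr => j _.
by rewrite dD.2 !coef_hor.
Qed.

Lemma hor_dt f : hor (dt f) = dt (hor f).
Proof.
by apply: coef_ext => i; rewrite coef_hor !coef_dt coef_hor (derMz dD).
Qed.

Lemma hor_form f g : d (res_form f g) = res_form (hor f) g + res_form f (hor g).
Proof.
rewrite /res_form /Res -coef_hor horM hor_dt coefD addrC; congr (_ + _).
Qed.

Lemma hor_mpow N f : mpow N f -> mpow N (hor f).
Proof. by move=> fN i lti; rewrite coef_hor (hor_bounded fN). Qed.

(* The derivation of UK with r |-> d r, h-bar |-> 0 and f |-> hor f for f in
   K: as it kills h-bar and the e_i, it differentiates the coefficients of the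
   monomials in these. *)
Fixpoint dterm (x : hterm K) : hterm K :=
  match x with
  | HScal r => HScal K (d r)
  | HHbar => HScal K 0
  | HGen f => HGen (hor f)
  | HAdd x y => HAdd (dterm x) (dterm y)
  | HOpp x => HOpp (dterm x)
  | HMul x y => HAdd (HMul (dterm x) y) (HMul x (dterm y))
  end.

Definition deltaU (u : UK) : UK := \pi_UK (dterm (repr u)).

Let piU := (piU_add, piU_opp, piU_mul).
Let pS r : \pi_UK (HScal K r) = scalU K r. Proof. by []. Qed.
Let pG (f : K) : \pi_UK (HGen f) = genU f. Proof. by []. Qed.
Let pH : \pi_UK (HHbar K) = hbarU K. Proof. by []. Qed.

Lemma dterm_heq (x y : hterm K) : heq x y -> \pi_UK (dterm x) = \pi_UK (dterm y).
Proof.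
elim=> /= [//|{}x {}y _ -> //|{}x {}y z _ -> _ -> //|||||||||||||||||||].
- by move=> {}x x' {}y y' _ E _ F; rewrite !piU E F.
- by move=> {}x x' _ E; rewrite !piU E.
- move=> {}x x' {}y y' /UK_eq X E /UK_eq Y F.
  by rewrite !piU E F X Y.
- by move=> *; rewrite !piU addrA.
- by move=> *; rewrite !piU addrC.
- by move=> *; rewrite !piU pS (der0 dD) scalU0 add0r.
- by move=> *; rewrite !piU pS (der0 dD) addNr.
- by move=> *; rewrite !piU !mulrDl !mulrDr !mulrA !addrA.
- by move=> *; rewrite !piU !pS (der1 dD) scalU0 scalU1 mul0r mul1r add0r.
- by move=> *; rewrite !piU !pS (der1 dD) scalU0 scalU1 mulr0 mulr1 addr0.
- by move=> *; rewrite !piU !mulrDl addrACA.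
- by move=> *; rewrite !piU !mulrDr addrACA.
- by move=> *; rewrite !piU !pS dD.1 scalUD.
- by move=> *; rewrite !piU !pS dD.2 scalUD !scalUM.
- by move=> *; rewrite !piU !pS !scalUC addrC.
- by move=> *; rewrite !piU !pG horD genUD.
- by move=> *; rewrite !piU !pG !pS horZ genUD !genUZ.
- by move=> *; rewrite !piU !pS pH scalU0 mul0r mulr0 add0r addr0 hbarUC.
- move=> f g; rewrite !piU !pG !pS pH scalU0 mulr0 addr0 hor_form scalUD mulrDl.
  by rewrite -!genU_comm addrACA -opprD [in LHS](addrC (genU (hor g) * _)).
Qed.

Lemma deltaU_pi x : deltaU (\pi_UK x) = \pi_UK (dterm x).
Proof. by apply: dterm_heq; apply: repr_heq. Qed.

Lemma deltaU_scal r : deltaU (scalU K r) = scalU K (d r).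
Proof. exact: deltaU_pi. Qed.
Lemma deltaU_gen f : deltaU (genU f) = genU (hor f).
Proof. exact: deltaU_pi. Qed.
Lemma deltaU_hbar : deltaU (hbarU K) = 0.
Proof. exact: deltaU_pi. Qed.
Lemma deltaUD u v : deltaU (u + v) = deltaU u + deltaU v.
Proof.
elim/quotW: u => x; elim/quotW: v => y.
by rewrite -piU_add !deltaU_pi /= piU_add.
Qed.
Lemma deltaUM u v : deltaU (u * v) = deltaU u * v + u * deltaU v.
Proof.
elim/quotW: u => x; elim/quotW: v => y.
by rewrite -piU_mul !deltaU_pi /= !piU.
Qed.
Lemma deltaU0 : deltaU 0 = 0.
Proof. by apply: (@addrI _ (deltaU 0)); rewrite -deltaUD !addr0. Qed.
Lemma deltaUB u v : deltaU (u - v) = deltaU u - deltaU v.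
Proof.
rewrite deltaUD; congr (_ + _).
by apply/eqP; rewrite -addr_eq0 -deltaUD addNr deltaU0.
Qed.

Lemma deltaU_Um N : {homo deltaU : w / w \in Um N}.
Proof.
apply: span_map => [|x y|_ [u [f [fN ->]]]]; rewrite ?deltaU0 ?deltaUB //.
rewrite deltaUM deltaU_gen rpredD //; apply: span_gen.
  by exists (deltaU u), f.
by exists u, (hor f); split=> //; apply: hor_mpow.
Qed.

Lemma deltaU_coherent (x : Ubar) : coherent (fun N => deltaU (lvl x N)).
Proof. by move=> N; rewrite -deltaUB deltaU_Um // lvlS. Qed.

Definition delta_bar (x : Ubar) : Ubar := mk_ubar (@deltaU_coherent x).

Lemma delta_barD x y : delta_bar (x + y) = delta_bar x + delta_bar y.
Proof.
apply: ubar_ext => N; apply: Um_trans (lvl_mk _ _) _.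
apply/Um_sym/(Um_trans (lvl_mk _ _))/Um_sym.
apply: (@Um_trans _ _ _ (deltaU (lvl x N + lvl y N))).
  by rewrite -deltaUB deltaU_Um // lvl_mk.
by rewrite deltaUD; apply: Um_add; apply/Um_sym/lvl_mk.
Qed.

Lemma delta_barM x y : delta_bar (x * y) = delta_bar x * y + x * delta_bar y.
Proof.
apply: ubar_ext => N; have [P1 H1] := ubar_mulP x y N.
have [P2 H2] := ubar_mulP (delta_bar x) y N.
have [P3 H3] := ubar_mulP x (delta_bar y) N.
have [M HM] := Um_right (lvl y N) N.
pose P := (P1 + P2 + P3 + M + N)%N.
apply: Um_trans (lvl_mk _ _) _.
apply: (@Um_trans _ _ _ (deltaU (lvl x P * lvl y P))).
  by rewrite -deltaUB deltaU_Um // H1 // /P; lia.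
apply/Um_sym/(Um_trans (lvl_mk _ _)); rewrite deltaUM.
apply: Um_add.
  apply: Um_trans (H2 P _) _; first by rewrite /P; lia.
  apply: (@Um_trans _ _ _ (lvl (delta_bar x) P * lvl y N)).
    by rewrite -mulrBr Um_left // lvl_le // /P; lia.
  apply: (@Um_trans _ _ _ (deltaU (lvl x P) * lvl y N)).
    by rewrite -mulrBl HM //; apply: UmS (lvl_mk _ _); rewrite /P; lia.
  by rewrite -mulrBr Um_left //; apply/Um_sym/lvl_le; rewrite /P; lia.
apply: Um_trans (H3 P _) _; first by rewrite /P; lia.
by rewrite -mulrBr Um_left //; apply: UmS (lvl_mk _ _); rewrite /P; lia.
Qed.

Lemma delta_bar_const u : delta_bar (ubar_const u) = ubar_const (deltaU u).
Proof.
apply: ubar_ext => N; apply: Um_trans (lvl_mk _ _) _.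
apply/Um_sym/(Um_trans (lvl_mk _ _))/Um_sym.
by rewrite -deltaUB deltaU_Um // lvl_mk.
Qed.

Lemma delta_bar_hbarX n : delta_bar (hbar_bar K ^+ n) = 0.
Proof.
have h0 : delta_bar (hbar_bar K) = 0 by rewrite delta_bar_const deltaU_hbar.
elim: n => [|n IH].
  by rewrite expr0 -[1]/(ubar_const 1) delta_bar_const deltaU_scal (der1 dD).
by rewrite exprS delta_barM h0 IH mul0r mulr0 addr0.
Qed.

Definition delta_loc (z : Uloc K) : Uloc K := frac _ (delta_bar (numer z)) (denom z).

Lemma delta_locE x n :
  delta_loc (frac (@hbar_barC _ K) x n) = frac _ (delta_bar x) n.
Proof.
have [k' E] := frac_reprP (@hbar_barC _ K) x n.
have := congr1 delta_bar E; rewrite !delta_barM !delta_bar_hbarX !mul0r !add0r => F.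
by apply/frac_eq; exists k'.
Qed.

Definition delta_Fock (w : Fock K) : Fock K := \pi_(Fock K) (deltaU (repr w)).

Lemma delta_FockE u : delta_Fock (\pi_(Fock K) u) = \pi_(Fock K) (deltaU u).
Proof.
apply/Fock_eqP; rewrite -deltaUB.
have: repr (\pi_(Fock K) u) - u \in span (@fock_gen R K).
  by apply/Fock_eqP; rewrite reprK.
move: (_ - _); apply: span_map => [|x y|_ [v [f [r [f0 ->]]]]].
- exact: deltaU0.
- exact: deltaUB.
rewrite deltaUB !deltaUM !deltaUD deltaUM !deltaU_scal deltaU_gen deltaU_hbar.
rewrite mulr0 addr0 opprD addrACA rpredD //; apply: span_gen.
  by exists (deltaU v), f, r.
by exists v, (hor f), (d r); split=> //; apply: hor_mpow.
Qed.

End Coefficientwise.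

Section ThetaHat.
Variables (k : fieldType) (R : comAlgType k) (K : laurentType R).

(* D_vert = D - D_hor, where D_hor is [hor (base D)]. *)
Definition vert (D : thetaKR K) (f : K) : K := D f - hor (base D) f.

(* :e_a o e_b: *)
Definition normal_ord (a b : int) : UK K :=
  if (a <= b)%R then genU (eseries K a) * genU (eseries K b)
  else genU (eseries K b) * genU (eseries K a).

(* (D e_i, e_j) / (i j) :e_(-i) o e_(-j): *)
Definition quad_term (D : K -> K) (i j : int) : UK K :=
  if (i != 0) && (j != 0) then
    scalU K (((i * j)%:~R : k)^-1 *: res_form (D (eseries K i)) (eseries K j))
      * normal_ord (- i) (- j)
  else 0.

(* The sum over -B <= i, j <= B. *)
Definition quad_sum (D : K -> K) (B : nat) : UK K :=
  \sum_(a < B.*2.+1) \sum_(b < B.*2.+1) quad_term D (a%:Z - B%:Z) (b%:Z - B%:Z).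

Definition quad_sum_cvg (D : K -> K) (s : Ubar K) : Prop :=
  forall N, exists B0, forall B, (B0 <= B)%N -> quad_sum D B - lvl s N \in Um N.

(* The infinite sum; [quad_limP] says that it converges for D in
   theta_(K/R). *)
Definition quad_lim (D : K -> K) : Ubar K := xget 0 [set s | quad_sum_cvg D s].

(* The factor 1 / (2 h-bar) is split between the scalar and the exponent 1 of
   h-bar in [frac]. *)
Definition tau_hat (D : K -> K) : Uloc K :=
  frac _ (ubar_const (scalU K (2^-1 : k)%:A) * quad_lim D) 1.

(* The element of theta-hat given by D and r is represented by the pair
   (D, r). *)
Definition thetaHat : Type := (thetaKR K * R)%type.
HB.instance Definition _ := GRing.Lmodule.on thetaHat.
Implicit Types x y : thetaHat.

Definition hat_act x (z : Uloc K) : Uloc K :=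
  (tau_hat (vert x.1) + scalL K x.2) * z + delta_loc (base x.1) z.

Definition hat_act_Fock x (w : Fock K) : Fock K :=
  (tau_hat (vert x.1) + scalL K x.2) *: w + delta_Fock (base x.1) w.

(* The bracket of theta-hat is that of operators on bar U [h-bar^-1]; its
   component in [R] is the unique r that makes this so. *)
Definition hat_lie x y : thetaHat :=
  let D := lie x.1 y.1 in
  (D, xget 0 [set r | forall z, hat_act (D, r) z =
                        hat_act x (hat_act y z) - hat_act y (hat_act x z)]).

Section Convergence.

Lemma coef_e i j : coef (eseries K i) j = (j == i)%:R.
Proof. by rewrite seriesK //; exists i => l lti; rewrite (_ : l == i = false) //; lia. Qed.

Lemma e_bounded i l : (l < i)%R -> coef (eseries K i) l = 0.
Proof. by move=> lti; rewrite coef_e (_ : l == i = false) //; lia. Qed.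

Lemma e0 : eseries K 0 = 1.
Proof. by apply: coef_ext => i; rewrite coef_e coef1. Qed.

Lemma eM i j : eseries K i * eseries K j = eseries K (i + j).
Proof.
apply: coef_ext => l; have [lti|lei] := boolP (l < i + j)%R.
  by rewrite e_bounded // (coefM_lt (@e_bounded i) (@e_bounded j) lti).
have [p ->] : exists p : nat, l = i + j + p%:Z by exists (absz (l - (i + j))%R); lia.
rewrite (coefM _ _ _ _ (@e_bounded i) (@e_bounded j)) coef_e.
rewrite big_ord_recl big1 => [|q _]; last first.
  by rewrite coef_e (_ : _ == i = false) ?mul0r //=; rewrite /bump /=; lia.
by rewrite addr0 !coef_e addr0 eqxx mul1r /= subn0; congr (_ %:R); lia.
Qed.

Variables (D : K -> K) (DD : derivation D).

Lemma De i : D (eseries K i) = (eseries K (i - 1) * D (eseries K 1)) *~ i.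
Proof.
have Hn (n : nat) : D (eseries K n) = (eseries K (n%:Z - 1) * D (eseries K 1)) *~ n%:Z.
  elim: n => [|n IH]; first by rewrite e0 (der1 DD) mulr0z.
  rewrite (_ : n.+1%:Z = n%:Z + 1); last lia.
  rewrite -eM DD.2 IH mulrzDr mulr1z mulrzAl mulrAC eM subrK.
  by rewrite (_ : n%:Z + 1 - 1 = n%:Z) //; lia.
case: i => n; first exact: Hn.
rewrite NegzE; set e := eseries K; set m := n.+1.
have /(congr1 D) : e (- m%:Z) * e m%:Z = 1 by rewrite /e eM addNr e0.
rewrite DD.2 (der1 DD) (Hn m) => /(congr1 (fun f => f * e (- m%:Z))).
rewrite mul0r mulrDl -mulrA /e eM subrr e0 mulr1 => /eqP.
rewrite addr_eq0 => /eqP ->; rewrite mulrNz; congr (- _).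
rewrite mulrzAr mulrzAl; congr (_ *~ _); rewrite mulrA eM mulrAC eM.
by congr (eseries K _ * _); lia.
Qed.

Lemma form_small : exists m : int, forall i j, (m < i + j)%R ->
  res_form (D (eseries K i)) (eseries K j) = 0.
Proof.
have [m Dm] := coef_bounded (D (eseries K 1)); exists (1 - m) => i j ltij.
have H l : (l < i - 1 + m)%R -> coef (D (eseries K i)) l = 0.
  move=> ltl; rewrite De -scaler_int coefZ (coefM_lt (@e_bounded (i - 1)) Dm) //.
  by rewrite mulr0.
have H' l : (l < i - 1 + m - 1)%R -> coef (dt (D (eseries K i))) l = 0.
  by move=> ltl; rewrite coef_dt (dt_bounded H).
by apply: (coefM_lt (@e_bounded j) H'); lia.
Qed.

Lemma normal_ord_small N a b : (N%:Z <= a)%R || (N%:Z <= b)%R ->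
  normal_ord a b \in Um N.
Proof.
have G l u : (N%:Z <= l)%R -> u * genU (eseries K l) \in Um N.
  move=> leN; rewrite Um_left //; apply: span_gen; exists 1, (eseries K l).
  by rewrite mul1r; split=> // i lti; rewrite e_bounded //; lia.
by move=> H; rewrite /normal_ord; case: ifP => leab; apply: G; lia.
Qed.

Lemma sumZ_recr (V : zmodType) (F : int -> V) (B : nat) :
  \sum_(a < B.+1.*2.+1) F (a%:Z - B.+1%:Z) =
  F (- B.+1%:Z) + \sum_(a < B.*2.+1) F (a%:Z - B%:Z) + F B.+1%:Z.
Proof.
rewrite doubleS big_ord_recr big_ord_recl /= sub0r; congr (_ + _ + F _); last lia.
by apply: eq_bigr => a _; congr F; rewrite /bump /=; lia.
Qed.

Lemma quad_sum_lim : exists s, quad_sum_cvg D s.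
Proof.
have [m Hm] := form_small.
have small N i j : (N + absz m < absz i)%N || (N + absz m < absz j)%N ->
    quad_term D i j \in Um N.
  move=> H; rewrite /quad_term; case: ifP => // _; last by rewrite rpred0.
  have [lt|le] := boolP (m < i + j)%R.
    by rewrite (Hm _ _ lt) scaler0 scalU0 mul0r rpred0.
  by rewrite Um_left // normal_ord_small //; lia.
have step N B : (N + absz m <= B)%N -> quad_sum D B.+1 - quad_sum D B \in Um N.
  move=> leB.
  have row i : (\sum_(b < B.+1.*2.+1) quad_term D i (b%:Z - B.+1%:Z)) -
      \sum_(b < B.*2.+1) quad_term D i (b%:Z - B%:Z) \in Um N.
    rewrite sumZ_recr; set u := quad_term D i (- _); set S := \sum_(_ < _) _.
    by rewrite [u + S + _]addrAC addrK rpredD // small //; lia.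
  have big i : (absz i = B.+1)%N ->
      \sum_(b < B.+1.*2.+1) quad_term D i (b%:Z - B.+1%:Z) \in Um N.
    by move=> iB; apply: rpred_sum => b _; apply: small; lia.
  rewrite /quad_sum (sumZ_recr (fun i =>
    \sum_(b < B.+1.*2.+1) quad_term D i (b%:Z - B.+1%:Z))).
  rewrite [_ + _ + (\sum_(_ < _) _)]addrAC -(addrA (_ + _)) rpredD //.
    by rewrite rpredD ?big //; lia.
  by rewrite -sumrB; apply: rpred_sum => a _.
have stable N B B' : (N + absz m <= B)%N -> (B <= B')%N ->
    quad_sum D B' - quad_sum D B \in Um N.
  move=> NB; elim: B' => [|B' IH]; first by rewrite leqn0 => /eqP->; rewrite subrr rpred0.
  rewrite leq_eqVlt => /orP[/eqP->|]; first by rewrite subrr rpred0.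
  rewrite ltnS => BB'; apply: Um_trans (IH BB'); apply: step; lia.
have coh : coherent (fun N => quad_sum D (N + absz m)).
  by move=> N; apply: stable; lia.
exists (mk_ubar coh) => N; exists (N + absz m)%N => B leB.
by apply: Um_trans (stable _ _ _ (leqnn _) leB) _; apply/Um_sym/lvl_mk.
Qed.

End Convergence.

Lemma vert_derivation D : derivation (vert D).
Proof.
split=> f g; rewrite /vert.
  by rewrite (thetaKR_der D).1 horD opprD addrACA.
rewrite (thetaKR_der D).2 horM; ring.
Qed.

Lemma quad_limP (D : thetaKR K) : quad_sum_cvg (vert D) (quad_lim (vert D)).
Proof. exact: (xgetPex 0 (quad_sum_lim (vert_derivation D))). Qed.


End ThetaHat.

Section Flat.
Variables (R : comNzRingType).

(* The formal sum of the a (x) m, for (a, m) in s, vanishes in P (x)_R M: it is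
   killed by all bilinear maps. *)
Definition tensor_eq0 (P M : lmodType R) (s : seq (P * M)) : Prop :=
  forall (Q : lmodType R) (b : {bilinear P -> M -> Q}),
    \sum_(u <- s) b u.1 u.2 = 0.

Definition flat_module (P : lmodType R) : Prop :=
  forall (M N : lmodType R) (f : {linear M -> N}), injective f ->
  forall s : seq (P * M),
    tensor_eq0 [seq (u.1, f u.2) | u <- s] -> tensor_eq0 s.

End Flat.

Section FockType.
Variables (R : comNzRingType) (K : laurentType R) (A : subalgClosed K).

Definition subalg_type : Type := {f : K | f \in A}.
HB.instance Definition _ := Choice.on subalg_type.
HB.instance Definition _ := SubChoice.on subalg_type.
HB.instance Definition _ := [SubChoice_isSubLmodule of subalg_type by <:].

Definition finite_type : Prop :=
  exists2 s : seq K, {subset s <= A} &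
    forall B : subalgClosed K, {subset s <= B} -> {subset A <= B}.

Definition perp : set K := [set f | forall a, a \in A -> res_form f a = 0].

Definition sum_AO : set K := [set f | exists a o, [/\ a \in A, mpow 0 o & f = a + o]].

Record fock_type : Prop := FockType {
  FT1 : flat_module subalg_type /\ finite_type;
  FT2 : (forall f : K, f \in A /\ mpow 0 f <-> exists r : R, f = r%:A) /\
        (* the classes of the b_i form a basis of K / (A + O) *)
        (exists n (b : 'I_n -> K), forall f,
           exists! r : {ffun 'I_n -> R}, sum_AO (f - \sum_i r i *: b i));
  FT3 : forall a a', a \in A -> a' \in A -> res_form a a' = 0;
  FT4 : forall D : K -> K, derivation D -> (forall r : R, D r%:A = 0) ->
        continuous_mad D -> (forall a, a \in A -> D a \in A) ->
        forall f, perp f -> D f \in A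
}.

(* A o bar U [h-bar^-1] and A o F(K, O). *)
Definition AU : {pred Uloc K} :=
  span [set z | exists a u, a \in A /\ z = genL a * u].
Definition AF_gen : set (Fock K) :=
  [set w | exists a v, a \in A /\ w = genL a *: v].

Definition coinv : Type := {quot span AF_gen}.
HB.instance Definition _ := Choice.on coinv.
HB.instance Definition _ := EqQuotient.on coinv.
HB.instance Definition _ := GRing.Zmodule.on coinv.

Lemma coinv_eqP (v w : Fock K) :
  reflect (\pi_coinv v = \pi_coinv w) (v - w \in span AF_gen).
Proof. exact: quotP. Qed.

Lemma scalLC r (z : Uloc K) : scalL K r * z = z * scalL K r.
Proof.
elim/frac_ind: z => x n; rewrite /scalL /toUloc -!fracM addn0 add0n; congr frac.
apply: ubar_ext => N.
have [P1 H1] := ubar_mulP (ubar_const (scalU K r)) x N.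
have [P2 H2] := ubar_mulP x (ubar_const (scalU K r)) N.
have [M HM] := Um_right (lvl x N) N; pose P := (P1 + P2 + M + N)%N.
apply: Um_trans (H1 P _) _; first by rewrite /P; lia.
apply/Um_sym/(Um_trans (H2 P _)); first by rewrite /P; lia.
apply: (@Um_trans _ _ _ (scalU K r * lvl x N)).
  rewrite scalUC; apply: (@Um_trans _ _ _ (lvl x P * scalU K r)).
    by rewrite -mulrBr Um_left //; apply: UmS (lvl_mk _ _); rewrite /P; lia.
  by rewrite -mulrBl -scalUC Um_left // lvl_le // /P; lia.
apply/Um_sym; apply: (@Um_trans _ _ _ (lvl (ubar_const (scalU K r)) P * lvl x N)).
  by rewrite -mulrBr Um_left // lvl_le // /P; lia.
by rewrite -mulrBl HM //; apply: UmS (lvl_mk _ _); rewrite /P; lia.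
Qed.

Definition coinv_scale (r : R) (w : coinv) : coinv :=
  \pi_coinv (scalL K r *: repr w).

Lemma coinv_scaleE r v : coinv_scale r (\pi_coinv v) = \pi_coinv (scalL K r *: v).
Proof.
apply/coinv_eqP; rewrite -scalerBr.
have: repr (\pi_coinv v) - v \in span AF_gen by apply/coinv_eqP; rewrite reprK.
move: (_ - _); apply: span_map => [|x y|_ [a [w [aA ->]]]].
- exact: scaler0.
- exact: scalerBr.
by apply: span_gen; exists a, (scalL K r *: w); rewrite !scalerA scalLC.
Qed.

Lemma coinv_piD (v w : Fock K) : \pi_coinv (v + w) = \pi_coinv v + \pi_coinv w.
Proof. by rewrite !piE. Qed.

Lemma toUlocD u v : toUloc (u + v) = toUloc u + toUloc v :> Uloc K.
Proof. by rewrite /toUloc ubar_constD fracD. Qed.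
Lemma toUlocM u v : toUloc (u * v) = toUloc u * toUloc v :> Uloc K.
Proof. by rewrite /toUloc ubar_constM -fracM. Qed.

Fact coinv_scaleA r s w : coinv_scale r (coinv_scale s w) = coinv_scale (r * s) w.
Proof.
elim/quotW: w => w; rewrite (coinv_scaleE s w) (coinv_scaleE r) (coinv_scaleE _ w).
by rewrite scalerA /scalL -toUlocM scalUM.
Qed.
Fact coinv_scale1 : left_id 1 coinv_scale.
Proof.
elim/quotW=> w; rewrite coinv_scaleE; apply/coinv_eqP.
by rewrite (_ : scalL K 1 = 1) ?scale1r ?subrr ?rpred0.
Qed.
Fact coinv_scaleDr : right_distributive coinv_scale +%R.
Proof.
move=> r; elim/quotW=> v; elim/quotW=> w.
by rewrite -coinv_piD !coinv_scaleE scalerDr coinv_piD.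
Qed.
Fact coinv_scaleDl w : {morph coinv_scale^~ w : r s / r + s}.
Proof.
move=> r s; elim/quotW: w => w.
by rewrite !coinv_scaleE -coinv_piD -scalerDl /scalL scalUD toUlocD.
Qed.

HB.instance Definition _ := GRing.Zmodule_isLmodule.Build R coinv
  coinv_scaleA coinv_scale1 coinv_scaleDr coinv_scaleDl.

End FockType.

Section ThetaKAR.
Variables (k : fieldType) (R : comAlgType k) (K : laurentType R).
Variable A : subalgClosed K.

Definition thetaKAR : set (thetaKR K) := [set D | forall a, a \in A -> D a \in A].

(* The preimage of theta_(K,A,R) in theta-hat. *)
Definition thetaHatA : set (thetaHat K) := [set x | thetaKAR x.1].

(* The derivations of [R] that lift to theta_(K,A,R), i.e. the image of
   theta_(K,A,R) in theta_R; FT1-FT4 do not force it to be all of theta_R. *)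
Definition thetaRA : set (thetaR R) := [set d | exists2 D, thetaKAR D & d = base D].

Definition hat_act_coinv (x : thetaHat K) (w : coinv A) : coinv A :=
  \pi_(coinv A) (hat_act_Fock x (repr w)).

End ThetaKAR.

Section CentralExtension.
Variables (k : fieldType) (R : comAlgType k).

(* [E] is a central extension by [R] of the Lie algebra [T] of derivations of
   [R]. *)
Definition central_extension (T : set (thetaR R)) (E : lieType k)
    (i : {linear R -> E}) (p : {linear E -> thetaR R}) : Prop :=
  [/\ injective i,
      forall x y, p (lie x y) = lie (p x) (p y),
      range p = T,
      forall x, p x = 0 <-> exists r, x = i r &
      forall x r, lie x (i r) = i (p x r)].

(* [rho] is a k-linear representation of [E] on the R-module [V] in which [R]
   acts by scalar multiplication. *)
Definition representation (E : lieType k) (i : {linear R -> E}) (V : lmodType R)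
    (rho : E -> V -> V) : Prop :=
  [/\ forall x v w, rho x (v + w) = rho x v + rho x w,
      forall x (c : k) v, rho x ((c%:A : R) *: v) = (c%:A : R) *: rho x v,
      forall (c : k) x y v, rho (c *: x + y) v = (c%:A : R) *: rho x v + rho y v,
      forall x y v, rho (lie x y) v = rho x (rho y v) - rho y (rho x v) &
      forall r v, rho (i r) v = r *: v].

End CentralExtension.

(* Main.v *)
Require Import Defs.
From HB Require Import structures.
From mathcomp Require Import all_boot all_order all_algebra.
From mathcomp Require Import generic_quotient boolp classical_sets reals complex.
From mathcomp Require Import zify ring.
Import Defs.

Set Implicit Arguments.
Unset Strict Implicit.
Unset Printing Implicit Defensive.

Import GRing.Theory.
Local Open Scope classical_set_scope.
Local Open Scope ring_scope.
Local Open Scope quotient_scope.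

(** The commutator of [tau_hat E] with a field [f] is the field [E f], up to a
    constant (lemma [tau_hat_comm]): the sum that defines [tau_hat] is quadratic
    in the fields, and the residue form pairs [e_i] with [e_(-i)]. Together with
    the horizontal derivation this gives x (f o z) = x(f) o z + f o x(z) for all
    [x] in theta-hat, up to constants in x(f). As [A] contains the constants, an
    [x] that preserves [A] preserves A o U and A o F, and acts on the
    coinvariants.

    That theta-hat is closed under brackets is the Virasoro relation. The failure
    of [tau_hat] to respect a bracket commutes with all fields, by the Jacobi
    identity, and it is a limit of quadratic expressions in the fields. Euler's
    identity recovers a quadratic expression from its commutators with the fields,
    up to a constant; so the failure is a constant ([quad_central]), and a
    constant of [R], because constants are not lost in the quotients
    U / U o m^N ([scal_hbar_Um]).

    The action on coinvariants factors through an extension of Lie algebras of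
    derivations by [R] as soon as the following two facts are known.

    [R] acts faithfully ([coinv_faithful]). The Fock type condition splits [K]
    into the constant-free part of [A], a free module and O. Since [A] and O are
    isotropic, there is a two-point function on [K] with antisymmetrization the
    residue form, vanishing when its first argument is in [A] or its second in O.
    By Wick's theorem it extends to a functional on the Heisenberg algebra that
    vanishes on A o U and on U o O, hence descends to the coinvariants, and takes
    the vacuum to 1.

    A derivation that preserves [A] and kills [R] acts as a scalar
    ([vertical_scalar]). It maps the orthogonal of [A] to [A], so its operator
    commutes with the action of this orthogonal on the coinvariants. The
    orthogonal of [A] and O together span [K] ([perp_sum]), since functionals on
    K / O are represented by elements of O; hence the vacuum generates the
    coinvariants under the orthogonal of [A] ([perp_cyclic]), and it suffices to
    find the image of the vacuum. Modulo A o F this image is a vector of degree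
    two in a basis [b i] of the free complement. The coordinate functions of the
    [b i] are represented by elements of O orthogonal to [A], which kill the
    vacuum and therefore its image; by faithfulness the symmetric part of the
    coefficients of that image vanishes, and what remains is a multiple of the
    vacuum.

    The extension itself consists of the pairs of a derivation of [R] and an
    operator on the coinvariants induced by a common element of theta-hat. *)

(** * The residue form *)

Section LaurentForm.
Variables (k : fieldType) (R : comAlgType k) (K : laurentType R).
Implicit Types (f g : K) (i j l : int).
Local Notation e := (eseries K).

Lemma coef_sum I (r : seq I) (P : pred I) (F : I -> K) l :
  coef (\sum_(i <- r | P i) F i) l = \sum_(i <- r | P i) coef (F i) l.
Proof. by apply: (big_morph (fun f => coef f l)) => [f g|]; rewrite ?coefD ?coef0. Qed.

Lemma coefMz f n l : coef (f *~ n) l = coef f l *~ n.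
Proof. by rewrite -scaler_int coefZ mulrzl. Qed.

Lemma coef_eM i g l : coef (e i * g) l = coef g (l - i).
Proof.
have [n gn] := coef_bounded g.
have [lti|lei] := boolP (l < i + n)%R.
  by rewrite (coefM_lt (@e_bounded _ _ K i) gn lti) gn //; lia.
have [p ->] : exists p : nat, l = i + n + p%:Z by exists (absz (l - (i + n))%R); lia.
rewrite (coefM _ _ _ _ (@e_bounded _ _ K i) gn) big_ord_recl big1 => [|q _]; last first.
  by rewrite coef_e (_ : _ == i = false) ?mul0r //=; rewrite /bump /=; lia.
by rewrite addr0 coef_e addr0 eqxx mul1r /= subn0; congr coef; lia.
Qed.

Lemma dtD f g : dt (f + g) = dt f + dt g.
Proof. by apply: coef_ext => i; rewrite coefD !coef_dt coefD mulrzDl. Qed.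

Lemma dtZ (r : R) f : dt (r *: f) = r *: dt f.
Proof. by apply: coef_ext => i; rewrite coefZ !coef_dt coefZ mulrzAr. Qed.

Lemma res_formDl f f' g : res_form (f + f') g = res_form f g + res_form f' g.
Proof. by rewrite /res_form /Res dtD mulrDr coefD. Qed.
Lemma res_formDr f g g' : res_form f (g + g') = res_form f g + res_form f g'.
Proof. by rewrite /res_form /Res mulrDl coefD. Qed.
Lemma res_formZl (r : R) f g : res_form (r *: f) g = r * res_form f g.
Proof. by rewrite /res_form /Res dtZ -scalerAr coefZ. Qed.
Lemma res_formZr (r : R) f g : res_form f (r *: g) = r * res_form f g.
Proof. by rewrite /res_form /Res -scalerAl coefZ. Qed.
Lemma res_form0l g : res_form 0 g = 0.
Proof. by rewrite -(scale0r (0 : K)) res_formZl mul0r. Qed.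
Lemma res_form0r f : res_form f 0 = 0.
Proof. by rewrite -(scale0r (0 : K)) res_formZr mul0r. Qed.
Lemma res_formNl f g : res_form (- f) g = - res_form f g.
Proof. by rewrite -scaleN1r res_formZl mulN1r. Qed.
Lemma res_formNr f g : res_form f (- g) = - res_form f g.
Proof. by rewrite -scaleN1r res_formZr mulN1r. Qed.

(** Integration by parts: the residue of an exact form vanishes. *)
Lemma res_form_anti f g : res_form f g = - res_form g f.
Proof.
have sumE (a b : K) (m n : int) (p : nat) : m + n + p%:Z = 0 ->
    (forall i, (i < m)%R -> coef a i = 0) -> (forall i, (i < n)%R -> coef b i = 0) ->
    res_form a b = \sum_(j < p.+1) coef b (n + j%:Z) * coef a (m + (p - j)%:Z)
                                  *~ (m + (p - j)%:Z).
  move=> mnp am bn; rewrite /res_form /Res (_ : - 1 = n + (m - 1) + p%:Z); last lia.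
  have da i : (i < m - 1)%R -> coef (dt a) i = 0.
    by move=> lti; rewrite coef_dt (dt_bounded am).
  rewrite (coefM _ _ _ _ bn da); apply: eq_bigr => j _; rewrite coef_dt mulrzAr.
  by congr (_ * (coef _ _) *~ _); lia.
have [m fm] := coef_bounded f; have [n gn] := coef_bounded g.
pose m' := m - (absz (m + n))%:Z; pose p := absz (m' + n)%R.
have fm' i : (i < m')%R -> coef f i = 0 by move=> lti; apply: fm; lia.
have E : m' + n + p%:Z = 0 by rewrite /p /m'; lia.
rewrite (sumE _ _ _ _ _ E fm' gn) (sumE g f n m' p) //; last lia.
rewrite (reindex_inj rev_ord_inj) /= -sumrN; apply: eq_bigr => j _.
rewrite subSS subKn -1?ltnS // mulrC -mulrNz.
by congr (_ * _ *~ _); have := ltn_ord j; lia.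
Qed.

Lemma res_form_el i f : res_form (e i) f = coef f (- i) *~ i.
Proof.
rewrite /res_form /Res (_ : dt (e i) = e (i - 1) *~ i).
  by rewrite mulrzAr mulrC coefMz coef_eM; congr (coef _ _ *~ _); lia.
apply: coef_ext => l; rewrite coef_dt coefMz !coef_e.
have -> : (l + 1 == i) = (l == i - 1) by apply/eqP/eqP; lia.
by case: eqP => [->|_]; rewrite ?mul0rz // subrK.
Qed.

Lemma res_form_er f j : res_form f (e j) = coef f (- j) *~ (- j).
Proof. by rewrite res_form_anti res_form_el mulrNz. Qed.

Lemma res_form_cst f (r : R) : res_form f (r *: 1) = 0.
Proof. by rewrite res_formZr -e0 res_form_er mulr0z mulr0. Qed.

Lemma res_form_cstl (r : R) f : res_form (r *: 1) f = 0.
Proof. by rewrite res_form_anti res_form_cst oppr0. Qed.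

Lemma mpow0_isotropic f g : mpow 0 f -> mpow 0 g -> res_form f g = 0.
Proof.
move=> f0 g0; apply: (@coefM_lt _ _ _ _ 0 0) => // i lti; rewrite coef_dt.
have [->|ne] := eqVneq i (- 1); first by rewrite addNr mulr0z.
by rewrite f0 ?mul0rz //; lia.
Qed.

End LaurentForm.

(** * Convergence in the completed enveloping algebra *)

Section EnvelopingCalculus.
Variables (R : comNzRingType) (K : laurentType R).
Implicit Types (f g : K) (r : R) (u v : UK K) (x y : Ubar K).

Lemma genU0 : genU (0 : K) = 0.
Proof. by apply: (@addrI _ (genU (0 : K))); rewrite -genUD !addr0. Qed.
Lemma genUN f : genU (- f) = - genU f.
Proof. by apply/eqP; rewrite -addr_eq0 -genUD addNr genU0. Qed.
Lemma genUB f g : genU (f - g) = genU f - genU g.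
Proof. by rewrite genUD genUN. Qed.
Lemma genU_sum I (s : seq I) (P : pred I) (F : I -> K) :
  genU (\sum_(i <- s | P i) F i) = \sum_(i <- s | P i) genU (F i).
Proof. by apply: (big_morph (@genU R K)) => [f g|]; rewrite ?genUD ?genU0. Qed.
Lemma scalUN r : scalU K (- r) = - scalU K r.
Proof. by apply/eqP; rewrite -addr_eq0 -scalUD addNr. Qed.
Lemma genUC f g : genU f * genU g = genU g * genU f + scalU K (res_form f g) * hbarU K.
Proof. by rewrite -genU_comm addrC subrK. Qed.

(** The element h-bar is factored out, so that quadratic elements divided by it
    act on fields by derivations. *)
Lemma genU2_comm f g h :
  genU f * genU g * genU h - genU h * (genU f * genU g) =
  hbarU K * genU (res_form f h *: g + res_form g h *: f).
Proof.
rewrite -mulrA (genUC g) mulrDr mulrA (genUC f) mulrDl -addrA.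
rewrite addrA addrC [genU h * (_ * _)]mulrA -!addrA addKr.
rewrite genUD !genUZ mulrDr; congr (_ + _).
  by rewrite -mulrA scalUC -mulrA scalUC.
by rewrite hbarUC mulrA -scalUC.
Qed.

Lemma Um_genU N f : mpow N f -> genU f \in Um N.
Proof. by move=> fN; apply: span_gen; exists 1, f; rewrite mul1r. Qed.

(** [u] is a representative of [x] modulo U o m^N. *)
Definition apx N x u := lvl x N - u \in Um N.

Lemma apx_refl N x : apx N x (lvl x N).
Proof. by rewrite /apx subrr rpred0. Qed.
Lemma apx_const N u : apx N (ubar_const u) u.
Proof. exact: ubar_constP. Qed.
Lemma apx_eq N x u v : apx N x u -> u - v \in Um N -> apx N x v.
Proof. exact: Um_trans. Qed.
Lemma apx_sub N x u v : apx N x u -> apx N x v -> u - v \in Um N.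
Proof. by move=> /Um_sym; apply: Um_trans. Qed.
Lemma apxS M N x u : (N <= M)%N -> apx M x u -> apx N x u.
Proof. by move=> NM H; apply: Um_trans (Um_sym (lvl_le x NM)) (UmS NM H). Qed.
Lemma apxD N x y u v : apx N x u -> apx N y v -> apx N (x + y) (u + v).
Proof. by move=> xu yv; apply: Um_trans (lvl_mk _ _) (Um_add xu yv). Qed.
Lemma apxN N x u : apx N x u -> apx N (- x) (- u).
Proof. by move=> xu; apply: Um_trans (lvl_mk _ _) (Um_opp xu). Qed.
Lemma apxB N x y u v : apx N x u -> apx N y v -> apx N (x - y) (u - v).
Proof. by move=> xu /apxN; apply: apxD. Qed.

Lemma apx_ext x y : (forall N, exists2 u, apx N x u & apx N y u) -> x = y.
Proof.
by move=> H; apply: ubar_ext => N; have [u xu yu] := H N; apply: Um_trans xu (Um_sym yu).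
Qed.

(** Convergence to [x] in lim_N U / U o m^N. *)
Definition cvgU (s : nat -> UK K) x := forall N, exists B0, forall B, (B0 <= B)%N ->
  apx N x (s B).

Lemma cvg_lvl x : cvgU (lvl x) x.
Proof. by move=> N; exists N => B NB; apply/Um_sym/lvl_le. Qed.
Lemma cvg_const u : cvgU (fun=> u) (ubar_const u).
Proof. by move=> N; exists 0%N => B _; apply: apx_const. Qed.

Lemma cvg_unique s x y : cvgU s x -> cvgU s y -> x = y.
Proof.
move=> sx sy; apply: apx_ext => N; have [B H] := sx N; have [B' H'] := sy N.
by exists (s (B + B')%N); [apply: H | apply: H']; lia.
Qed.

Lemma cvg_close s t x : cvgU s x ->
  (forall N, exists B0, forall B, (B0 <= B)%N -> s B - t B \in Um N) -> cvgU t x.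
Proof.
move=> sx st N; have [B H] := sx N; have [B' H'] := st N.
by exists (B + B')%N => C le; apply: apx_eq (H _ _) (H' _ _); lia.
Qed.

Lemma cvgB s t x y : cvgU s x -> cvgU t y -> cvgU (fun B => s B - t B) (x - y).
Proof.
move=> sx ty N; have [B H] := sx N; have [B' H'] := ty N.
by exists (B + B')%N => C le; apply: apxB; [apply: H | apply: H']; lia.
Qed.

Lemma cvgD s t x y : cvgU s x -> cvgU t y -> cvgU (fun B => s B + t B) (x + y).
Proof.
move=> sx ty N; have [B H] := sx N; have [B' H'] := ty N.
by exists (B + B')%N => C le; apply: apxD; [apply: H | apply: H']; lia.
Qed.

(** Right multiplication by [lvl y N] is only continuous, so [s] has to be known
    to a higher precision than the product. *)
Lemma cvgM s t x y : cvgU s x -> cvgU t y -> cvgU (fun B => s B * t B) (x * y).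
Proof.
move=> sx ty N; have [B H] := sx (modulus N (lvl y N)); have [B' H'] := ty N.
exists (B + B')%N => C le; apply: Um_trans (lvl_mk _ _) _.
apply: (@Um_trans _ _ _ (s C * lvl y N)).
  by rewrite -mulrBl; apply: modulusP; apply: H; lia.
by rewrite -mulrBr Um_left //; apply: H'; lia.
Qed.

Lemma fracN x n : - frac (@hbar_barC R K) x n = frac _ (- x) n.
Proof. exact: loc_oppE. Qed.
Lemma fracB x y n : frac (@hbar_barC R K) (x - y) n = frac _ x n - frac _ y n.
Proof. by rewrite fracD fracN. Qed.

Lemma ubar_constN u : ubar_const (- u) = - ubar_const u.
Proof. by apply: apx_ext => N; exists (- u); [|apply: apxN]; apply: apx_const. Qed.

Lemma toUlocN u : toUloc (- u) = - toUloc u.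
Proof. by rewrite /toUloc ubar_constN fracN. Qed.
Lemma genLD f g : genL (f + g) = genL f + genL g.
Proof. by rewrite /genL genUD toUlocD. Qed.
Lemma genLZ r f : genL (r *: f) = scalL K r * genL f.
Proof. by rewrite /genL genUZ toUlocM. Qed.
Lemma genL0 : genL (0 : K) = 0.
Proof. by apply: (@addrI _ (genL (0 : K))); rewrite -genLD !addr0. Qed.
Lemma genLN f : genL (- f) = - genL f.
Proof. by apply/eqP; rewrite -addr_eq0 -genLD addNr genL0. Qed.
Lemma genLB f g : genL (f - g) = genL f - genL g.
Proof. by rewrite genLD genLN. Qed.
Lemma scalLD r s : scalL K (r + s) = scalL K r + scalL K s.
Proof. by rewrite /scalL scalUD toUlocD. Qed.

Lemma ubar_scalC r x : ubar_const (scalU K r) * x = x * ubar_const (scalU K r).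
Proof.
apply: (@cvg_unique (fun B => scalU K r * lvl x B)).
  exact: cvgM (cvg_const _) (cvg_lvl x).
apply: cvg_close (cvgM (cvg_lvl x) (cvg_const (scalU K r))) _ => N.
by exists 0%N => B _; rewrite scalUC subrr rpred0.
Qed.

End EnvelopingCalculus.

(** * The commutator of a Sugawara operator with a field *)

Section Commutator.
Variables (k : numFieldType) (R : comAlgType k) (K : laurentType R).
Local Notation e := (eseries K).
Implicit Types (f g : K) (i j l : int).

Lemma intr_neq0 (n : int) : n != 0 -> (n%:~R : k) != 0.
Proof. by rewrite intr_eq0. Qed.

(** Elements with a vanishing constant term. As [(1, f) = 0] for all [f], the
    element [1] of [K] is central and does not appear in [tau_hat], whose
    commutators see derivations only up to this projection. *)
Definition noconst f : K := f - coef f 0 *: 1.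

Lemma coef_noconst f l : coef (noconst f) l = if l == 0 then 0 else coef f l.
Proof.
rewrite coefB coefA; case: eqP => [->|_]; first by rewrite mulr1n subrr.
by rewrite subr0.
Qed.

Definition trunc (B : nat) f : K :=
  \sum_(a < B.*2.+1) coef f (a%:Z - B%:Z) *: e (a%:Z - B%:Z).

Lemma coef_trunc B f l : coef (trunc B f) l = if (absz l <= B)%N then coef f l else 0.
Proof.
rewrite coef_sum; case: ifP => H.
  have lt : (absz (l + B%:Z)%R < B.*2.+1)%N by lia.
  rewrite (bigD1 (Ordinal lt)) //= big1 => [|a /eqP ne]; last first.
    rewrite coefZ coef_e; case: eqP => [E|]; last by rewrite mulr0.
    by case: ne; apply/val_inj => /=; lia.
  rewrite (_ : (absz (l + B%:Z)%R)%:Z - B%:Z = l); last lia.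
  by rewrite coefZ coef_e eqxx mulr1 addr0.
apply: big1 => a _; rewrite coefZ coef_e; case: eqP => [E|]; last by rewrite mulr0.
by have := ltn_ord a; lia.
Qed.

Lemma trunc_close B M f n : (forall i, (i < n)%R -> coef f i = 0) ->
  (absz n + M <= B)%N -> mpow M (trunc B f - f).
Proof.
move=> fn le i lti; rewrite coefB coef_trunc; case: ifP => H; first exact: subrr.
by rewrite fn ?subrr //; lia.
Qed.

Lemma ubar_scal_half (x : Ubar K) :
  ubar_const (scalU K (2^-1 : k)%:A) * (x *+ 2) = x.
Proof.
rewrite mulr2n mulrDr -mulrDl -ubar_constD -scalUD -scalerDl.
have -> : 2^-1 + 2^-1 = 1 :> k by field.
by rewrite scale1r scalU1 mul1r.
Qed.

Definition Rlinear (E : K -> K) := forall (r : R) f, E (r *: f) = r *: E f.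

Section Vertical.
Variable E : K -> K.
Hypotheses (dE : derivation E) (lE : Rlinear E) (cE : continuous_mad E).

Lemma coef_Ee i l : coef (E (e i)) l = coef (E (e 1)) (l - i + 1) *~ i.
Proof. by rewrite (De dE) coefMz coef_eM; congr (coef _ _ *~ _); lia. Qed.

(** The coefficients form a Hankel matrix: they depend on [i + j] only, because
    [E] is determined by its value on [t]. *)
Lemma quad_termE i j : quad_term E i j =
  if (i != 0) && (j != 0)
  then - (scalU K (coef (E (e 1)) (1 - i - j)) * normal_ord K (- i) (- j)) else 0.
Proof.
rewrite /quad_term; case: ifP => // /andP[i0 j0].
rewrite res_form_er (coef_Ee i) -[_ *~ i *~ _]mulrzA -scaler_int scalerA.
have -> : (((i * j)%:~R : k)^-1 * (i * - j)%:~R) = -1.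
  by rewrite mulrN mulrNz mulrN mulVf // intr_neq0 // mulf_neq0.
rewrite scaleN1r scalUN mulNr; congr (- (scalU K (coef _ _) * _)); lia.
Qed.

Lemma normal_ord_comm a b f :
  normal_ord K a b * genU f - genU f * normal_ord K a b =
  hbarU K * genU (res_form (e a) f *: e b + res_form (e b) f *: e a).
Proof.
by rewrite /normal_ord; case: ifP => _; rewrite genU2_comm // addrC.
Qed.

Lemma quad_term_comm i j f :
  quad_term E i j * genU f - genU f * quad_term E i j =
  hbarU K * genU (if (i != 0) && (j != 0) then
    (coef f i * coef (E (e i)) (- j)) *: e (- j) +
    (coef f j * coef (E (e j)) (- i)) *: e (- i) else 0).
Proof.
rewrite quad_termE; case: ifP => _; last by rewrite genU0 mul0r !mulr0 subrr.
set s := scalU K _; rewrite mulNr mulrN -opprD -[s * _ * genU f]mulrA.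
rewrite [genU f * (_ * _)]mulrA -scalUC -[s * _ * _ in X in _ - X]mulrA -mulrBr.
rewrite normal_ord_comm scalUC -mulrA -scalUC -genUZ -mulrN -genUN; congr (_ * genU _).
rewrite scalerDr !scalerA opprD -!scaleNr !res_form_el (coef_Ee i) (coef_Ee j) !opprK.
have -> : - j - i + 1 = 1 - i - j by lia.
have -> : - i - j + 1 = 1 - i - j by lia.
by congr (_ *: _ + _ *: _); rewrite mulrNz mulrN opprK !mulrzAr mulrC.
Qed.

Lemma sum_sym (V : zmodType) n (F : 'I_n -> 'I_n -> V) :
  \sum_a \sum_b (F a b + F b a) = (\sum_b \sum_a F a b) *+ 2.
Proof.
rewrite mulr2n -big_split /=; under eq_bigr do rewrite big_split /=.
by rewrite big_split /= [X in X + _ = _]exchange_big /= -big_split /=.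
Qed.

Lemma lin_sum I (s : seq I) (P : pred I) (c : I -> R) (F : I -> K) :
  E (\sum_(i <- s | P i) c i *: F i) = \sum_(i <- s | P i) c i *: E (F i).
Proof. by rewrite (der_sum dE); apply: eq_bigr => i _; rewrite lE. Qed.

Lemma quad_sum_comm B f :
  quad_sum E B * genU f - genU f * quad_sum E B =
  (hbarU K * genU (trunc B (noconst (E (trunc B f))))) *+ 2.
Proof.
rewrite /quad_sum mulr_suml mulr_sumr -sumrB.
pose z (a : 'I_B.*2.+1) := a%:Z - B%:Z.
pose F a b := if (z a != 0) && (z b != 0) then
    (coef f (z a) * coef (E (e (z a))) (- z b)) *: e (- z b) else 0.
transitivity (\sum_a \sum_b (hbarU K * genU (F a b) + hbarU K * genU (F b a))).
  apply: eq_bigr => a _; rewrite mulr_suml mulr_sumr -sumrB; apply: eq_bigr => b _.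
  rewrite quad_term_comm -mulrDr -genUD /F andbC; case: ifP => // _.
  by rewrite addr0.
rewrite (@sum_sym _ _ (fun a b => hbarU K * genU (F a b))); congr (_ *+ _).
under eq_bigr do rewrite -mulr_sumr -genU_sum.
rewrite -mulr_sumr -genU_sum; congr (_ * genU _).
rewrite [RHS]/trunc (reindex_inj rev_ord_inj) /=; apply: eq_bigr => b _.
have zb : z (rev_ord b) = - (b%:Z - B%:Z).
  by rewrite /z /=; have := ltn_ord b; rewrite subSS; lia.
rewrite coef_noconst {}/F {}zb oppr_eq0 opprK; case: eqP => [_|_] /=.
  by rewrite scale0r big1 // => a _; rewrite andbF.
rewrite /trunc lin_sum coef_sum scaler_suml; apply: eq_bigr => a _.
rewrite andbT coefZ /z; case: eqP => // ->.
by rewrite e0 (der1 dE) coef0 mulr0 scale0r.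
Qed.

(** The outer truncation is harmless because [E f] is bounded below, the inner
    one because [E] is continuous. *)
Lemma trunc_noconst_close N f : exists B0, forall B, (B0 <= B)%N ->
  mpow N (trunc B (noconst (E (trunc B f))) - noconst (E f)).
Proof.
have [M HM] := cE N; have [n fn] := coef_bounded f.
have [q Eq] := coef_bounded (E f).
exists (absz n + M + absz q + N)%N => B leB i lti.
have /HM HE : mpow M (trunc B f - f) by apply: trunc_close fn _; lia.
rewrite coefB coef_trunc !coef_noconst; case: ifP => [_|H].
  case: eqP => _; rewrite ?subrr // -coefB -(derB dE); exact: HE.
by rewrite (Eq i) ?if_same ?subrr //; lia.
Qed.

Lemma quad_lim_cvg : cvgU (quad_sum E) (quad_lim E).
Proof.
move=> N; have [B H] := xgetPex 0 (quad_sum_lim dE) N.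
by exists B => C le; apply/Um_sym/H.
Qed.

(** [h-bar o tau_hat E]. *)
Definition tau_num : Ubar K := ubar_const (scalU K (2^-1 : k)%:A) * quad_lim E.

Lemma tau_hatE : tau_hat E = frac _ tau_num 1.
Proof. by []. Qed.

Lemma quad_lim_comm f :
  quad_lim E * ubar_const (genU f) - ubar_const (genU f) * quad_lim E =
  (hbar_bar K * ubar_const (genU (noconst (E f)))) *+ 2.
Proof.
have c := cvg_const (genU f).
apply: cvg_unique (cvgB (cvgM quad_lim_cvg c) (cvgM c quad_lim_cvg)) _.
rewrite -ubar_constM mulr2n -ubar_constD -mulr2n; apply: cvg_close (cvg_const _) _ => N.
have [B0 H] := trunc_noconst_close N f; exists B0 => B le.
rewrite quad_sum_comm -mulrnBl -mulrBr mulr2n -genUB.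
by apply: rpredD; apply/Um_left/Um_genU; rewrite -opprB; apply/mpowN/H.
Qed.

(** This is why [tau_hat] lifts [E]. In the double sum both factors of a term
    contribute the same, which the factor one half compensates. *)
Lemma tau_num_comm f :
  tau_num * ubar_const (genU f) - ubar_const (genU f) * tau_num =
  hbar_bar K * ubar_const (genU (noconst (E f))).
Proof.
by rewrite /tau_num mulrA -ubar_scalC -!mulrA -mulrBr quad_lim_comm ubar_scal_half.
Qed.

Lemma tau_hat_comm f :
  tau_hat E * genL f - genL f * tau_hat E = genL (noconst (E f)).
Proof.
rewrite tau_hatE /genL /toUloc -!fracM addn0 add0n -fracB tau_num_comm.
exact: (frac_raise (@hbar_barC R K) 1 _ 0).
Qed.

End Vertical.
End Commutator.

(** * Derivations of theta-hat acting on fields, on the Fock space and on coinvariants *)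

Section Operators.
Variables (k : numFieldType) (R : comAlgType k) (K : laurentType R).
Implicit Types (f g : K) (r : R) (D : thetaKR K) (d : thetaR R) (z : Uloc K).

Lemma thetaKR_Z D r f : D (r *: f) = base D r *: f + r *: D f.
Proof. by rewrite -[r *: f]mulr_algl (thetaKR_der D).2 baseE !mulr_algl. Qed.

Lemma vert_linear D : Rlinear (vert D).
Proof.
by move=> r f; rewrite /vert thetaKR_Z horZ opprD addrACA subrr add0r -scalerBr.
Qed.

Lemma vert_continuous D : continuous_mad (vert D).
Proof.
apply: continuous_add (thetaKR_cont D) _; apply: continuous_opp => N.
by exists N => f; apply: hor_mpow.
Qed.

Arguments vert_linear D : clear implicits.
Arguments vert_continuous D : clear implicits.

Lemma vert_cst D r : vert D (r *: 1) = 0.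
Proof. by rewrite vert_linear (der1 (vert_derivation D)) scaler0. Qed.

Lemma vertE D f : D f = vert D f + hor (base D) f.
Proof. by rewrite subrK. Qed.

Lemma delta_locD d z z' : delta_loc d (z + z') = delta_loc d z + delta_loc d z'.
Proof.
elim/frac_ind: z => x n; elim/frac_ind: z' => y m.
rewrite -[_ + _]/(loc_add _ _) loc_addE !delta_locE.
rewrite -[RHS]/(loc_add _ _) loc_addE delta_barD !delta_barM !delta_bar_hbarX.
by rewrite !mul0r !add0r.
Qed.

Lemma delta_locM d z z' :
  delta_loc d (z * z') = delta_loc d z * z' + z * delta_loc d z'.
Proof.
elim/frac_ind: z => x n; elim/frac_ind: z' => y m.
by rewrite -fracM !delta_locE delta_barM fracD !fracM.
Qed.

Lemma delta_loc_gen d f : delta_loc d (genL f) = genL (hor d f).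
Proof. by rewrite /genL /toUloc delta_locE delta_bar_const deltaU_gen. Qed.
Lemma delta_loc_scal d r : delta_loc d (scalL K r) = scalL K (d r).
Proof. by rewrite /scalL /toUloc delta_locE delta_bar_const deltaU_scal. Qed.

(** The derivation of [K] through which [x] acts on the fields: it differs from
    [x.1] by constants, because [tau_hat] does. *)
Definition hat_der (x : thetaHat K) f : K := x.1 f - coef (vert x.1 f) 0 *: 1.

Lemma hat_derE x f : hat_der x f = noconst (vert x.1 f) + hor (base x.1) f.
Proof. by rewrite /hat_der /noconst addrAC -vertE. Qed.

Lemma hat_actD x z z' : hat_act x (z + z') = hat_act x z + hat_act x z'.
Proof. by rewrite /hat_act mulrDr delta_locD addrACA. Qed.
Lemma hat_act0 x : hat_act x 0 = 0 :> Uloc K.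
Proof. by apply: (@addrI _ (hat_act x 0)); rewrite -hat_actD !addr0. Qed.
Lemma hat_actN x z : hat_act x (- z) = - hat_act x z.
Proof. by apply/eqP; rewrite -addr_eq0 -hat_actD addNr hat_act0. Qed.
Lemma hat_actB x z z' : hat_act x (z - z') = hat_act x z - hat_act x z'.
Proof. by rewrite hat_actD hat_actN. Qed.

Lemma tau_vert_gen (x : thetaHat K) f :
  (tau_hat (vert x.1) + scalL K x.2) * genL f =
  genL (noconst (vert x.1 f)) + genL f * (tau_hat (vert x.1) + scalL K x.2).
Proof.
rewrite -(tau_hat_comm (vert_derivation _) (vert_linear _) (vert_continuous _)).
by rewrite mulrDl mulrDr addrA subrK scalLC.
Qed.

(** The Leibniz rule from which the preservation of A o U follows: the
    commutator with [tau_hat] differentiates [f] vertically and [delta_loc]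
    differentiates it horizontally. *)
Lemma hat_act_gen x f z :
  hat_act x (genL f * z) = genL (hat_der x f) * z + genL f * hat_act x z.
Proof.
rewrite /hat_act delta_locM delta_loc_gen mulrA tau_vert_gen hat_derE genLD.
move: (_ + scalL _ _) => T.
by rewrite mulrDl [(genL _ + _) * z]mulrDl mulrDr -mulrA addrACA.
Qed.

Section Fock.
Implicit Types v w : Fock K.

Lemma bar_act_delta d (x : Ubar K) w :
  delta_Fock d (bar_act x w) = bar_act (delta_bar d x) w + bar_act x (delta_Fock d w).
Proof.
elim/quotW: w => w; pose P := (modulus 0 w + modulus 0 (deltaU d w))%N.
rewrite (delta_FockE d w) (@bar_actE _ _ x w P); last by rewrite /P; lia.
rewrite (@bar_actE _ _ x (deltaU d w) P); last exact: leq_addl.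
rewrite delta_FockE deltaUM piFD (@bar_actE _ _ (delta_bar d x) w P); last exact: leq_addr.
congr (_ + _); apply/Fock_eqP; rewrite -mulrBl; apply/Um0_Fock/modulusP.
by apply: (UmS (M := P)); [apply: leq_addr | apply/Um_sym/lvl_mk].
Qed.

Lemma delta_FockZ d z w :
  delta_Fock d (z *: w) = delta_loc d z *: w + z *: delta_Fock d w.
Proof.
elim/frac_ind: z => x n.
rewrite delta_locE -![frac _ _ _ *: _]/(loc_act _ _) !loc_actE; exact: bar_act_delta.
Qed.

Lemma delta_FockD d v w : delta_Fock d (v + w) = delta_Fock d v + delta_Fock d w.
Proof.
elim/quotW: v => v; elim/quotW: w => w.
by rewrite -piFD !delta_FockE deltaUD piFD.
Qed.

Lemma hat_act_FockD x v w :
  hat_act_Fock x (v + w) = hat_act_Fock x v + hat_act_Fock x w.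
Proof. by rewrite /hat_act_Fock scalerDr delta_FockD addrACA. Qed.
Lemma hat_act_Fock0 x : hat_act_Fock x 0 = 0 :> Fock K.
Proof. by apply: (@addrI _ (hat_act_Fock x 0)); rewrite -hat_act_FockD !addr0. Qed.
Lemma hat_act_FockN x w : hat_act_Fock x (- w) = - hat_act_Fock x w.
Proof. by apply/eqP; rewrite -addr_eq0 -hat_act_FockD addNr hat_act_Fock0. Qed.
Lemma hat_act_FockB x v w :
  hat_act_Fock x (v - w) = hat_act_Fock x v - hat_act_Fock x w.
Proof. by rewrite hat_act_FockD hat_act_FockN. Qed.

Lemma hat_act_FockZ x z w :
  hat_act_Fock x (z *: w) = hat_act x z *: w + z *: delta_Fock (base x.1) w.
Proof.
by rewrite /hat_act_Fock delta_FockZ [hat_act _ _ *: _]scalerDl !scalerA addrA.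
Qed.

Lemma hat_act_Fock_gen x f w :
  hat_act_Fock x (genL f *: w) = genL (hat_der x f) *: w + genL f *: hat_act_Fock x w.
Proof.
rewrite /hat_act_Fock delta_FockZ delta_loc_gen scalerA tau_vert_gen hat_derE genLD.
move: (_ + scalL _ _) => T.
by rewrite scalerDl [(genL _ + _) *: w]scalerDl scalerDr -scalerA addrACA.
Qed.

(** Multiplying a vector by a scalar of the base ring is not linear for the
    action: the horizontal part differentiates the scalar. *)
Lemma hat_act_Fock_scal x r w :
  hat_act_Fock x (scalL K r *: w) =
  scalL K (base x.1 r) *: w + scalL K r *: hat_act_Fock x w.
Proof.
rewrite /hat_act_Fock delta_FockZ delta_loc_scal scalerDr !scalerA scalLC.
by rewrite addrCA.
Qed.

Lemma piF0 : \pi_(Fock K) 0 = 0.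
Proof. by apply: (@addrI _ (\pi_(Fock K) 0)); rewrite -piFD !addr0. Qed.

(** The vacuum [v_o]. *)
Definition vac : Fock K := \pi_(Fock K) 1.

Lemma toUloc_act (u v : UK K) : toUloc u *: \pi_(Fock K) v = \pi_(Fock K) (u * v).
Proof. by rewrite -[_ *: _]/(loc_act _ _) loc_actE bar_act_const. Qed.

Lemma vac_gen w : exists u : UK K, w = toUloc u *: vac.
Proof. by elim/quotW: w => u; exists u; rewrite toUloc_act mulr1. Qed.

Lemma delta_vac d : delta_Fock d vac = 0.
Proof.
by rewrite /vac delta_FockE -scalU1 deltaU_scal (der1 (thetaR_der d)) scalU0 piF0.
Qed.

Lemma gen_vac f : mpow 0 f -> genL f *: vac = 0.
Proof.
move=> f0; rewrite toUloc_act mulr1 -piF0; apply/Fock_eqP; rewrite subr0.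
by apply/Um0_Fock/Um_genU.
Qed.

End Fock.

Section Coinvariants.
Variable A : subalgClosed K.
Implicit Types (x y : thetaHat K) (v w : Fock K).

Lemma subalgB a b : a \in A -> b \in A -> a - b \in A.
Proof. by move=> aA bA; rewrite -scaleN1r rpredD // rpredZ. Qed.

(** [A] is preserved by [x.1] and contains the constants. *)
Lemma hat_der_A x a : thetaHatA A x -> a \in A -> hat_der x a \in A.
Proof. by move=> xA aA; apply: subalgB; [apply: xA | rewrite rpredZ // rpred1]. Qed.

Lemma hat_act_AU x z : thetaHatA A x -> z \in AU A -> hat_act x z \in AU A.
Proof.
move=> xA; move: z; apply: span_map => [|z z'|_ [a [u [aA ->]]]].
- exact: hat_act0.
- exact: hat_actB.
rewrite hat_act_gen; apply: rpredD; apply: span_gen.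
  by exists (hat_der x a), u; split=> //; apply: hat_der_A.
by exists a, (hat_act x u).
Qed.

Lemma hat_act_AF x w : thetaHatA A x ->
  w \in span (AF_gen A) -> hat_act_Fock x w \in span (AF_gen A).
Proof.
move=> xA; move: w; apply: span_map => [|v w|_ [a [w [aA ->]]]].
- exact: hat_act_Fock0.
- exact: hat_act_FockB.
rewrite hat_act_Fock_gen; apply: rpredD; apply: span_gen.
  by exists (hat_der x a), w; split=> //; apply: hat_der_A.
by exists a, (hat_act_Fock x w).
Qed.

Lemma hat_act_coinvE x w : thetaHatA A x ->
  hat_act_coinv x (\pi_(coinv A) w) = \pi_(coinv A) (hat_act_Fock x w).
Proof.
move=> xA; apply/coinv_eqP; rewrite -hat_act_FockB; apply: hat_act_AF => //.
by apply/coinv_eqP; rewrite reprK.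
Qed.

End Coinvariants.
End Operators.

(** * Quasi-free functionals on the Heisenberg algebra *)

Section Wick.
Variables (R : comNzRingType) (K : laurentType R).
Variables (w : K -> K -> R) (P : K -> Prop).
Hypotheses (wDl : forall f f' g, w (f + f') g = w f g + w f' g)
           (wZl : forall r f g, w (r *: f) g = r * w f g)
           (wDr : forall f g g', w f (g + g') = w f g + w f g')
           (wZr : forall r f g, w f (r *: g) = r * w f g)
           (w_skew : forall f g, w f g - w g f = res_form f g)
           (wP : forall a g, P a -> w a g = 0).

Implicit Types (f g h : K) (s : seq K) (p q : seq K -> R).

(** Functionals on words in [K] model functionals on the symmetric algebra of [K];
    this is the derivative in the direction [f]. *)
Definition contract f p : seq K -> R := fun s => p (f :: s).

(** The product of the functional [p] with the linear form w(-, f): each letter of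
    the word is paired with [f] in turn. *)
Fixpoint raise f p s : R :=
  if s is g :: s' then w g f * p s' + raise f (contract g p) s' else 0.

(** Wick's representation of a field: the contraction kills the vacuum, the
    product with a linear form builds new states from it. *)
Definition field f p : seq K -> R := fun s => p (f :: s) + raise f p s.

(** The functionals on words that come from the symmetric algebra of [K / P]. *)
Record state p : Prop := State {
  stateD : forall s f g s',
    p (s ++ (f + g) :: s') = p (s ++ f :: s') + p (s ++ g :: s');
  stateZ : forall s r f s', p (s ++ (r *: f) :: s') = r * p (s ++ f :: s');
  stateC : forall s f g s', p (s ++ f :: g :: s') = p (s ++ g :: f :: s');
  stateP : forall s a s', P a -> p (s ++ a :: s') = 0
}.

Lemma raiseD f p q s : raise f (fun t => p t + q t) s = raise f p s + raise f q s.
Proof.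
elim: s p q => [|g s IH] p q /=; first by rewrite addr0.
by rewrite mulrDr addrACA -IH.
Qed.

Lemma raiseZ f r p s : raise f (fun t => r * p t) s = r * raise f p s.
Proof.
elim: s p => [|g s IH] p /=; first by rewrite mulr0.
by rewrite mulrDr -IH mulrCA.
Qed.

Lemma raise0 f s : raise f (fun=> 0) s = 0.
Proof. by elim: s => //= g s IH; rewrite mulr0 add0r. Qed.

Lemma raiseDf f g p s : raise (f + g) p s = raise f p s + raise g p s.
Proof.
elim: s p => [|h s IH] p /=; first by rewrite addr0.
by rewrite IH wDr mulrDl addrACA.
Qed.

Lemma raiseZf r f p s : raise (r *: f) p s = r * raise f p s.
Proof.
elim: s p => [|h s IH] p /=; first by rewrite mulr0.
by rewrite IH wZr mulrDr mulrA.
Qed.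

(** A contraction is a derivation for the product with a linear form, which
    reduces the claim to shorter words. *)
Lemma raiseC f g p s : raise f (raise g p) s = raise g (raise f p) s.
Proof.
elim: s p => //= h s IH p.
have X a b : raise a (contract h (raise b p)) s =
    w h b * raise a p s + raise a (raise b (contract h p)) s.
  by rewrite -raiseZ -raiseD.
by rewrite !X IH addrCA.
Qed.

Lemma contract_state f p : state p -> state (contract f p).
Proof.
by case=> D Z C Q; split=> s; [apply: (D (f :: s)) | apply: (Z (f :: s)) |
  apply: (C (f :: s)) | apply: (Q (f :: s))].
Qed.

(** This is where [w] has to vanish on [P] in its first argument: the product
    with w(-, h) remains a functional on [K / P]. *)
Lemma raise_state h p : state p -> state (raise h p).
Proof.
move=> Sp; split=> s; elim: s p Sp => [|g s IH] p Sp.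
- move=> f f' s' /=.
  have -> : contract (f + f') p = fun t => contract f p t + contract f' p t.
    by apply/funext => t; apply: (stateD Sp [::]).
  by rewrite wDl mulrDl raiseD addrACA.
- move=> f f' s' /=; rewrite (IH _ (contract_state g Sp)) (stateD Sp s) mulrDr.
  by rewrite addrACA.
- move=> r f s' /=.
  have -> : contract (r *: f) p = fun t => r * contract f p t.
    by apply/funext => t; apply: (stateZ Sp [::]).
  by rewrite wZl raiseZ mulrDr mulrA.
- move=> r f s' /=; rewrite (IH _ (contract_state g Sp)) (stateZ Sp s) mulrDr.
  by rewrite mulrCA.
- move=> f f' s' /=; rewrite addrCA; congr (_ + (_ + raise h _ s')).
  by apply/funext => t; apply: (stateC Sp [::]).
- by move=> f f' s' /=; rewrite (IH _ (contract_state g Sp)) (stateC Sp s).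
- move=> a s' Pa /=.
  have -> : contract a p = fun=> 0 by apply/funext => t; apply: (stateP Sp [::]).
  by rewrite wP // mul0r add0r raise0.
- by move=> a s' Pa /=; rewrite (stateP Sp s) // mulr0 add0r (IH _ (contract_state g Sp)).
Qed.

Lemma stateDs p q : state p -> state q -> state (fun t => p t + q t).
Proof.
move=> Sp Sq; split=> *.
- by rewrite (stateD Sp) (stateD Sq) addrACA.
- by rewrite (stateZ Sp) (stateZ Sq) mulrDr.
- by rewrite (stateC Sp) (stateC Sq).
- by rewrite (stateP Sp) // (stateP Sq) // addr0.
Qed.

Lemma stateZs r p : state p -> state (fun t => r * p t).
Proof.
move=> Sp; split=> *.
- by rewrite (stateD Sp) mulrDr.
- by rewrite (stateZ Sp) mulrCA.
- by rewrite (stateC Sp).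
- by rewrite (stateP Sp) // mulr0.
Qed.

Lemma field_state f p : state p -> state (field f p).
Proof. by move=> Sp; apply: stateDs (contract_state f Sp) (raise_state f Sp). Qed.

(** Contractions commute, and so do products with linear forms; only the two mixed
    terms survive, and they contribute [w f g] and [- w g f]. *)
Lemma field_comm f g p s : state p ->
  field f (field g p) s - field g (field f p) s = res_form f g * p s.
Proof.
move=> Sp; rewrite /field /= !raiseD (raiseC g f) -!/(contract _ _).
have -> : p (g :: f :: s) = p (f :: g :: s) by apply: (stateC Sp [::]).
rewrite -w_skew; ring.
Qed.

Fixpoint heval (x : hterm K) p : seq K -> R :=
  match x with
  | HScal r => fun s => r * p s
  | HHbar => p
  | HGen f => field f p
  | HAdd x y => fun s => heval x p s + heval y p s
  | HOpp x => fun s => - heval x p s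
  | HMul x y => heval x (heval y p)
  end.

Lemma heval_state x p : state p -> state (heval x p).
Proof.
elim: x p => //=.
- by move=> r p; apply: stateZs.
- by move=> f p; apply: field_state.
- by move=> x IHx y IHy p Sp; apply: stateDs; [apply: IHx | apply: IHy].
- move=> x IHx p Sp.
  rewrite (_ : (fun s => _) = (fun s => -1 * heval x p s)); first exact/stateZs/IHx.
  by apply/funext => s; rewrite mulN1r.
- by move=> x IHx y IHy p Sp; apply/IHx/IHy.
Qed.

Lemma hevalD x p q s : heval x (fun t => p t + q t) s = heval x p s + heval x q s.
Proof.
elim: x p q s => //=.
- by move=> r p q s; rewrite mulrDr.
- by move=> f p q s; rewrite /field raiseD addrACA.
- by move=> x IHx y IHy p q s; rewrite IHx IHy addrACA.
- by move=> x IHx p q s; rewrite IHx opprD.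
- move=> x IHx y IHy p q s; rewrite -IHx.
  by congr heval; apply/funext => t; apply: IHy.
Qed.

Lemma hevalZ x r p s : heval x (fun t => r * p t) s = r * heval x p s.
Proof.
elim: x p s => //=.
- by move=> r' p s; rewrite mulrCA.
- by move=> f p s; rewrite /field raiseZ mulrDr.
- by move=> x IHx y IHy p s; rewrite IHx IHy mulrDr.
- by move=> x IHx p s; rewrite IHx mulrN.
- move=> x IHx y IHy p s; rewrite -IHx.
  by congr heval; apply/funext => t; apply: IHy.
Qed.

(** The relations hold only on states, where words are multilinear and symmetric.
    That fields preserve states makes the induction go through for products. *)
Lemma heval_heq x y : heq x y -> forall p, state p -> heval x p = heval y p.
Proof.
elim=> /= [//|||||||||||||||||||||].
- by move=> {}x {}y _ IH p Sp; rewrite IH.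
- by move=> {}x {}y z _ IH _ IH' p Sp; rewrite IH // IH'.
- by move=> {}x x' {}y y' _ IH _ IH' p Sp; rewrite IH // IH'.
- by move=> {}x x' _ IH p Sp; rewrite IH.
- by move=> {}x x' {}y y' _ IH _ IH' p Sp; rewrite IH' // IH //; apply: heval_state.
- by move=> *; apply/funext => s; rewrite addrA.
- by move=> *; apply/funext => s; rewrite addrC.
- by move=> *; apply/funext => s; rewrite mul0r add0r.
- by move=> *; apply/funext => s; rewrite mul0r addNr.
- by [].
- by move=> *; apply/funext => s; rewrite mul1r.
- by move=> {}x p Sp; congr heval; apply/funext => s; rewrite mul1r.
- by [].
- by move=> {}x {}y z p Sp; apply/funext => s; rewrite hevalD.
- by move=> *; apply/funext => s; rewrite mulrDl.
- by move=> *; apply/funext => s; rewrite mulrA.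
- by move=> r {}x p Sp; apply/funext => s; rewrite hevalZ.
- move=> f g p Sp; apply/funext => s; rewrite /field raiseDf addrACA.
  by rewrite -(stateD Sp [::]).
- move=> r f p Sp; apply/funext => s; rewrite /field raiseZf mulrDr.
  by rewrite -(stateZ Sp [::]).
- by [].
- by move=> f g p Sp; apply/funext => s; rewrite field_comm.
Qed.

Definition vacuum s : R := (nilp s)%:R.

Lemma vacuum_state : state vacuum.
Proof.
have nz s f s' : vacuum (s ++ f :: s') = 0 by case: s.
by split=> *; rewrite !nz ?addr0 ?mulr0.
Qed.

Definition expect (u : UK K) : R := heval (repr u) vacuum [::].

Lemma expect_pi x : expect (\pi_(UK K) x) = heval x vacuum [::].
Proof. by rewrite /expect (heval_heq (repr_heq x) vacuum_state). Qed.

Lemma expectB u v : expect (u - v) = expect u - expect v.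
Proof.
elim/quotW: u => x; elim/quotW: v => y.
by rewrite -piU_opp -piU_add !expect_pi.
Qed.
Lemma expect_scal r u : expect (scalU K r * u) = r * expect u.
Proof. by elim/quotW: u => x; rewrite -piU_mul !expect_pi. Qed.
Lemma expect_hbar u : expect (hbarU K * u) = expect u.
Proof. by elim/quotW: u => x; rewrite -piU_mul !expect_pi. Qed.
Lemma expect1 : expect 1 = 1.
Proof. by rewrite -scalU1 expect_pi /= mul1r. Qed.

Lemma expect_left a u : P a -> expect (genU a * u) = 0.
Proof.
elim/quotW: u => x Pa; rewrite -piU_mul expect_pi /= /field addr0.
exact: (stateP (heval_state x vacuum_state) [::]).
Qed.

Lemma expect_right u g : (forall f, w f g = 0) -> expect (u * genU g) = 0.
Proof.
elim/quotW: u => x wg; rewrite -piU_mul expect_pi /=.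
have Z p s : raise g p s = 0 by elim: s p => //= f s IH p; rewrite wg mul0r add0r.
have -> : field g vacuum = (fun t => 0 * vacuum t).
  by apply/funext => s; rewrite /field Z addr0 mul0r.
by rewrite hevalZ mul0r.
Qed.

End Wick.

(** A functional on the coinvariants under [P] of the module that is generated by
    a vacuum killed by [Q], with h-bar acting as 1; it takes the vacuum to 1. *)
Record vacuum_functional (R : comNzRingType) (K : laurentType R) (P Q : K -> Prop)
    (lam : UK K -> R) : Prop := VacuumFunctional {
  lamB : forall u v, lam (u - v) = lam u - lam v;
  lam_scal : forall r u, lam (scalU K r * u) = r * lam u;
  lam_hbar : forall u, lam (hbarU K * u) = lam u;
  lam1 : lam 1 = 1;
  lam_left : forall a u, P a -> lam (genU a * u) = 0;
  lam_right : forall u g, Q g -> lam (u * genU g) = 0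
}.

Lemma quasi_free_functional (R : comNzRingType) (K : laurentType R)
    (w : K -> K -> R) (P Q : K -> Prop) :
  (forall f f' g, w (f + f') g = w f g + w f' g) ->
  (forall r f g, w (r *: f) g = r * w f g) ->
  (forall f g g', w f (g + g') = w f g + w f g') ->
  (forall r f g, w f (r *: g) = r * w f g) ->
  (forall f g, w f g - w g f = res_form f g) ->
  (forall a g, P a -> w a g = 0) -> (forall f g, Q g -> w f g = 0) ->
  exists lam : UK K -> R, vacuum_functional P Q lam.
Proof.
move=> wDl wZl wDr wZr ws wP wQ; exists (expect w); split.
- exact: expectB wDl wZl wDr wZr ws wP.
- exact: expect_scal wDl wZl wDr wZr ws wP.
- exact: expect_hbar wDl wZl wDr wZr ws wP.
- exact: expect1 wDl wZl wDr wZr ws wP.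
- exact: expect_left wDl wZl wDr wZr ws wP.
- by move=> u g Qg; apply: (expect_right wDl wZl wDr wZr ws wP) => f; apply: wQ.
Qed.

Section VacuumFunctional.
Variables (R : comNzRingType) (K : laurentType R) (P Q : K -> Prop).
Variable (lam : UK K -> R).
Hypothesis (L : vacuum_functional P Q lam).

Lemma lam0 : lam 0 = 0.
Proof. by rewrite -(subrr 0) (lamB L) subrr. Qed.

Lemma lamD u v : lam (u + v) = lam u + lam v.
Proof. by rewrite -{1}[v]opprK (lamB L) -[- v]sub0r (lamB L) lam0 sub0r opprK. Qed.

Lemma lam_scal_hbar r n : lam (scalU K r * hbarU K ^+ n) = r.
Proof.
rewrite (lam_scal L); elim: n => [|n IH]; first by rewrite expr0 (lam1 L) mulr1.
by rewrite exprS (lam_hbar L).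
Qed.

Lemma lam_Um u : (forall g, mpow 0 g -> Q g) -> u \in Um 0 -> lam u = 0.
Proof.
move=> OQ; move: u; apply: span_sub => [|x y Ex Ey|_ [u [g [g0 ->]]]].
- exact: lam0.
- by rewrite (lamB L) Ex Ey subrr.
by apply: (lam_right L); apply: OQ.
Qed.

End VacuumFunctional.

(** * Functionals attached to a splitting of K *)

Section Polarization.
Variables (k : numFieldType) (R : comAlgType k) (K : laurentType R).
Implicit Types (f g : K).

Section TwoPoint.
Variables (a h o : K -> K).
Hypotheses (aD : forall f g, a (f + g) = a f + a g) (aZ : Rlinear a)
           (hD : forall f g, h (f + g) = h f + h g) (hZ : Rlinear h)
           (aho : forall f, f = a f + h f + o f)
           (a_iso : forall f g, res_form (a f) (a g) = 0)
           (o_iso : forall f g, res_form (o f) (o g) = 0).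

(** The values on products of two fields of a functional that vanishes when the
    first factor is in the image of [a] or the second in that of [o]. This
    determines all terms except the one on the image of [h], where half of the
    form is one choice of a function with the right antisymmetrization. *)
Definition two_point f g : R :=
  res_form f (a g) + res_form (o f) (h g) +
  (2^-1 : k)%:A * res_form (h f) (h g).

Lemma oE f : o f = f - a f - h f.
Proof. by rewrite {2}(aho f) -addrA -opprD addrC addKr. Qed.

Lemma oD f g : o (f + g) = o f + o g.
Proof. by rewrite !oE aD hD; ring. Qed.

Lemma oZ : Rlinear o.
Proof. by move=> r f; rewrite !oE aZ hZ -!scalerBr. Qed.

Lemma two_pointDl f f' g : two_point (f + f') g = two_point f g + two_point f' g.
Proof. rewrite /two_point hD oD !res_formDl; ring. Qed.
Lemma two_pointZl r f g : two_point (r *: f) g = r * two_point f g.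
Proof. rewrite /two_point hZ oZ !res_formZl; ring. Qed.
Lemma two_pointDr f g g' : two_point f (g + g') = two_point f g + two_point f g'.
Proof. rewrite /two_point hD aD !res_formDr; ring. Qed.
Lemma two_pointZr r f g : two_point f (r *: g) = r * two_point f g.
Proof. rewrite /two_point hZ aZ !res_formZr; ring. Qed.

Lemma half_double (r : R) : (2^-1 : k)%:A * r + (2^-1 : k)%:A * r = r.
Proof.
rewrite -mulrDl -scalerDl; have -> : 2^-1 + 2^-1 = 1 :> k by field.
by rewrite scale1r mul1r.
Qed.

(** Isotropy of the images of [a] and [o] leaves the mixed terms and the one on the
    image of [h], each counted once. *)
Lemma two_point_skew f g : two_point f g - two_point g f = res_form f g.
Proof.
have E f' g' : res_form f' (a g') = res_form (h f') (a g') + res_form (o f') (a g').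
  by rewrite {1}(aho f') !res_formDl a_iso add0r.
rewrite /two_point (E f g) (E g f) (res_form_anti (h g) (a f)).
rewrite (res_form_anti (o g) (a f)) (res_form_anti (o g) (h f)) (res_form_anti (h g)).
rewrite [in RHS](aho f) [in RHS](aho g) !res_formDl !res_formDr a_iso o_iso.
rewrite -[X in _ = _ + (_ + X + _) + _]half_double; ring.
Qed.

Lemma splitting_functional (P : K -> Prop) :
  (forall x g, P x -> two_point x g = 0) ->
  exists lam : UK K -> R, vacuum_functional P (fun y => a y = 0 /\ h y = 0) lam.
Proof.
move=> P0; apply: (quasi_free_functional (w := two_point)) => //.
- exact: two_pointDl.
- exact: two_pointZl.
- exact: two_pointDr.
- exact: two_pointZr.
- exact: two_point_skew.
- by move=> f g [ag hg]; rewrite /two_point ag hg !res_form0r; ring.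
Qed.

End TwoPoint.

Definition polar f : K := series (fun i => if (i < 0)%R then coef f i else 0).

Lemma coef_polar f i : coef (polar f) i = if (i < 0)%R then coef f i else 0.
Proof.
rewrite seriesK //; have [n fn] := coef_bounded f.
by exists n => j /fn ->; rewrite if_same.
Qed.

Lemma res_form_suml I (s : seq I) (Q : pred I) (F : I -> K) g :
  res_form (\sum_(i <- s | Q i) F i) g = \sum_(i <- s | Q i) res_form (F i) g.
Proof.
by apply: (big_morph (fun f => res_form f g)) => [f f'|]; rewrite ?res_formDl ?res_form0l.
Qed.

Lemma res_form_polar f g : res_form (polar f) (polar g) = 0.
Proof.
have [n fn] := coef_bounded f.
have <- : trunc (absz n) (polar f) = polar f.
  apply: coef_ext => i; rewrite coef_trunc !coef_polar; case: ifP => // H.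
  by case: ifP => // lt0; rewrite fn //; lia.
rewrite /trunc res_form_suml big1 // => i _; rewrite res_formZl res_form_el !coef_polar.
case: ifP => [lt0|]; last by rewrite mul0r.
by rewrite (_ : (- _ < 0)%R = false) ?mul0rz ?mulr0 //; lia.
Qed.

Lemma polarD f g : polar (f + g) = polar f + polar g.
Proof.
by apply: coef_ext => i; rewrite coefD !coef_polar coefD; case: ifP; rewrite ?addr0.
Qed.
Lemma polarZ : Rlinear polar.
Proof.
by move=> r f; apply: coef_ext => i; rewrite coefZ !coef_polar coefZ; case: ifP; rewrite ?mulr0.
Qed.
Lemma polar_mpow0 f : mpow 0 f -> polar f = 0.
Proof.
by move=> f0; apply: coef_ext => i; rewrite coef_polar coef0; case: ifP => // /f0.
Qed.

(** Scalars are not lost in the quotients U / U o m^N: the vacuum state of the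
    polarization of [K] into polar parts and [mpow 0] detects them. *)
Lemma scal_hbar_Um (r : R) n N : scalU K r * hbarU K ^+ n \in Um N -> r = 0.
Proof.
pose o f := f - polar f.
have o0 f : mpow 0 (o f).
  by move=> i lt0; rewrite coefB coef_polar lt0 subrr.
have aho f : f = polar f + (0 : K) + o f by rewrite addr0 addrC subrK.
have h0 (f g : K) : 0 = 0 + 0 :> K by rewrite addr0.
have hZ : Rlinear (fun=> 0 : K) by move=> s f; rewrite scaler0.
have [||lam L] := splitting_functional polarD polarZ h0 hZ aho res_form_polar _
  (P := fun=> False); [|by []|].
  by move=> f g; apply: mpow0_isotropic.
move=> /(UmS (leq0n N)) /(lam_Um L) H; rewrite -(lam_scal_hbar L r n) H //.
by move=> g g0; split=> //; apply: polar_mpow0.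
Qed.

End Polarization.

(** * Quadratic elements and the Euler identity *)

Section Commutators.
Variable S : pzRingType.
Implicit Types x y z : S.

Lemma commBl x y z : (x - y) * z - z * (x - y) = (x * z - z * x) - (y * z - z * y).
Proof.
by rewrite mulrBl mulrBr !opprB addrACA [RHS]addrACA [X in _ = _ + X]addrC.
Qed.
Lemma commBr x y z : z * (x - y) - (x - y) * z = (z * x - x * z) - (z * y - y * z).
Proof.
by rewrite mulrBl mulrBr !opprB addrACA [RHS]addrACA [X in _ = _ + X]addrC.
Qed.

End Commutators.

Section Quadratic.
Variables (k : numFieldType) (R : comAlgType k) (K : laurentType R).
Local Notation e := (eseries K).
Implicit Types (q : UK K) (a b c l : int) (r : R).

(** The partial sums of [tau_hat] have this shape, and their brackets have it after
    division by h-bar. Multiples of h-bar arise when factors are reordered. The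
    central element [e_0] is left out, so that commutators determine an expression
    up to constants. *)
Definition quad_gen : set (UK K) :=
  [set q | (exists r a b, [/\ a != 0, b != 0 &
              q = scalU K r * (genU (e a) * genU (e b))]) \/
           (exists r, q = scalU K r * hbarU K)].

Local Notation quad := (span quad_gen).

Lemma quad_ee r a b : a != 0 -> b != 0 ->
  scalU K r * (genU (e a) * genU (e b)) \in quad.
Proof. by move=> a0 b0; apply: span_gen; left; exists r, a, b. Qed.

Lemma quad_hbar r : scalU K r * hbarU K \in quad.
Proof. by apply: span_gen; right; exists r. Qed.

Lemma res_form_ee a b : res_form (e a) (e b) = (b == - a)%:R *~ a.
Proof. by rewrite res_form_el coef_e eq_sym. Qed.

Lemma quad_scal r q : q \in quad -> scalU K r * q \in quad.
Proof.
move: q; apply: span_map => [|x y|_ [[s [a [b [a0 b0 ->]]]]|[s ->]]].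
- exact: mulr0.
- exact: mulrBr.
- by rewrite mulrA -scalUM quad_ee.
- by rewrite mulrA -scalUM quad_hbar.
Qed.

Lemma hbar_scal r (u : UK K) : hbarU K * (scalU K r * u) = scalU K r * (hbarU K * u).
Proof. by rewrite !mulrA -(scalUC r (hbarU K)). Qed.

Lemma comm_ee_e a b c : a != 0 -> b != 0 ->
  genU (e a) * genU (e b) * genU (e c) - genU (e c) * (genU (e a) * genU (e b)) =
  hbarU K * (scalU K (res_form (e a) (e c)) * genU (e b) +
             scalU K (res_form (e b) (e c)) * genU (e a)).
Proof. by rewrite genU2_comm genUD !genUZ. Qed.

(** As for Poisson brackets of quadratic functions: two of the four factors are
    contracted to a constant. *)
Lemma quad_comm q q' : q \in quad -> q' \in quad ->
  exists2 p, p \in quad & q * q' - q' * q = hbarU K * p.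
Proof.
move=> qQ; move: q'; apply: span_sub => [|x y [p pQ Ep] [p' pQ' Ep']|q' gq'].
- by exists 0; rewrite ?rpred0 // !mulr0 mul0r subrr.
- exists (p - p'); first exact: rpredB.
  by rewrite commBr Ep Ep' mulrBr.
move: q qQ; apply: span_sub => [|x y [p pQ Ep] [p' pQ' Ep']|q gq].
- by exists 0; rewrite ?rpred0 // !mulr0 mul0r subrr.
- exists (p - p'); first exact: rpredB.
  by rewrite commBl Ep Ep' mulrBr.
have central r u : scalU K r * hbarU K * u = u * (scalU K r * hbarU K).
  by rewrite -mulrA hbarUC mulrA scalUC -mulrA scalUC.
case: gq' => [[s [c [d [c0 d0 ->]]]]|[s ->]]; last first.
  by exists 0; rewrite ?rpred0 // central subrr mulr0.
case: gq => [[r [a [b [a0 b0 ->]]]]|[r ->]]; last first.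
  by exists 0; rewrite ?rpred0 // central subrr mulr0.
set u := genU (e a) * genU (e b).
pose t x y := scalU K (res_form (e x) (e y)).
exists (scalU K (r * s) * (t a c * (genU (e b) * genU (e d)) + t b c * (genU (e a) * genU (e d)) +
   (t a d * (genU (e c) * genU (e b)) + t b d * (genU (e c) * genU (e a))))).
  by apply: quad_scal; rewrite !rpredD // quad_ee.
have sM x y p p' : scalU K x * p * (scalU K y * p') = scalU K (x * y) * (p * p').
  by rewrite scalUM -!mulrA (mulrA p) -scalUC -mulrA.
rewrite !sM (mulrC s) -mulrBr.
have -> : u * (genU (e c) * genU (e d)) - genU (e c) * genU (e d) * u =
   (u * genU (e c) - genU (e c) * u) * genU (e d) +
   genU (e c) * (u * genU (e d) - genU (e d) * u).
  by rewrite mulrBl mulrBr !mulrA addrA subrK.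
rewrite /u !comm_ee_e // [RHS]mulrA -(scalUC (r * s) (hbarU K)) -[RHS]mulrA; congr (_ * _).
rewrite -[hbarU K * _ * _]mulrA [genU (e c) * _]mulrA -hbarUC -[hbarU K * _ * _]mulrA.
rewrite -mulrDr; congr (_ * (_ + _)); first by rewrite mulrDl -!mulrA.
by rewrite mulrDr !(mulrA (genU (e c))) -!scalUC -!mulrA.
Qed.

Lemma quad_gen_comm q (f : K) : q \in quad ->
  exists g, q * genU f - genU f * q = hbarU K * genU g.
Proof.
move: q; apply: span_sub => [|x y [g Eg] [g' Eg']|_ [[s [a [b [_ _ ->]]]]|[s ->]]].
- by exists 0; rewrite genU0 mul0r !mulr0 subrr.
- by exists (g - g'); rewrite commBl Eg Eg' genUB mulrBr.
- exists (s *: (res_form (e a) f *: e b + res_form (e b) f *: e a)).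
  rewrite genUZ [RHS]mulrA -(scalUC s (hbarU K)) -[RHS]mulrA -genU2_comm mulrBr.
  by rewrite (mulrA (genU f) (scalU K s)) -(scalUC s (genU f)) !mulrA.
- by exists 0; rewrite genU0 mulr0 -mulrA hbarUC mulrA scalUC -mulrA scalUC subrr.
Qed.

Definition dual_weight l : R := ((- l)%:~R^-1 : k)%:A.

Definition euler_term q l : UK K :=
  if l != 0 then scalU K (dual_weight l) *
    (genU (e (- l)) * (q * genU (e l) - genU (e l) * q)) else 0.

(** The second-order form of Euler's identity: the e_(-l) are dual to the e_l
    up to the factors [l], so that this operator multiplies a quadratic
    expression by [2 h-bar], up to a constant. *)
Definition euler B q : UK K := \sum_(i < B.*2.+1) euler_term q (i%:Z - B%:Z).

Lemma euler_termB q q' l : euler_term (q - q') l = euler_term q l - euler_term q' l.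
Proof.
rewrite /euler_term; case: ifP => _; last by rewrite subrr.
rewrite -!mulrBr; congr (_ * (_ * _)).
by rewrite commBl.
Qed.

Lemma eulerB B q q' : euler B (q - q') = euler B q - euler B q'.
Proof. by rewrite -sumrB; apply: eq_bigr => i _; apply: euler_termB. Qed.

(** The expansion of [e_a] in the basis dual to the [e_l] for the residue form. *)
Lemma dual_sum a B : a != 0 -> (absz a <= B)%N ->
  \sum_(i < B.*2.+1) (if i%:Z - B%:Z != 0 then
     scalU K (dual_weight (i%:Z - B%:Z) * res_form (e a) (e (i%:Z - B%:Z))) *
       genU (e (- (i%:Z - B%:Z))) else 0) = genU (e a).
Proof.
move=> a0 le; have lt : (absz (B%:Z - a)%R < B.*2.+1)%N by lia.
rewrite (bigD1 (Ordinal lt)) //= big1 => [|i /eqP ne].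
  rewrite (_ : (absz (B%:Z - a)%R)%:Z - B%:Z = - a); last lia.
  rewrite oppr_eq0 a0 addr0 opprK res_form_ee eqxx /dual_weight opprK.
  rewrite -scalerAl mul1r -scaler_int scalerA mulVf ?intr_neq0 // scale1r.
  by rewrite scalU1 mul1r.
case: ifP => // _; rewrite res_form_ee (_ : (i%:Z - B%:Z == - a) = false).
  by rewrite mul0rz mulr0 scalU0 mul0r.
by apply/eqP => E; case: ne; apply/val_inj => /=; lia.
Qed.

(** By the Leibniz rule and [dual_sum], each of the factors [e_a] and [e_b] is
    replaced by itself once; the two products differ by their order only. *)
Lemma euler_quad q : q \in quad -> exists B0, forall B, (B0 <= B)%N ->
  exists r, euler B q = hbarU K * (q *+ 2) + scalU K r * hbarU K ^+ 2.
Proof.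
move: q; apply: span_sub => [|x y [B0 H] [B0' H']|_ [[s [a [b [a0 b0 ->]]]]|[s ->]]].
- exists 0%N => B _; exists 0; rewrite mul0rn mulr0 mul0r addr0 /euler big1 // => i _.
  by rewrite /euler_term mul0r mulr0 subrr !mulr0 if_same.
- exists (B0 + B0')%N => B le; have [|r Er] := H B; first lia.
  have [|r' Er'] := H' B; first lia.
  exists (r - r'); rewrite eulerB Er Er' mulrnBl mulrBr scalUD scalUN mulrBl.
  by rewrite opprD addrACA.
- exists (absz a + absz b)%N => B le; exists (s * res_form (e b) (e a)).
  transitivity (hbarU K * (scalU K s * (genU (e a) * genU (e b) + genU (e b) * genU (e a)))).
    pose F x l := if l != 0 then
      scalU K (dual_weight l * res_form (e x) (e l)) * genU (e (- l)) else 0.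
    have -> : genU (e a) * genU (e b) + genU (e b) * genU (e a) =
        \sum_(i < B.*2.+1) (F a (i%:Z - B%:Z) * genU (e b) + F b (i%:Z - B%:Z) * genU (e a)).
      by rewrite big_split /= -!mulr_suml !dual_sum //; lia.
    rewrite !mulr_sumr; apply: eq_bigr => i _; move: (_ - _) => l.
    rewrite /F /euler_term; case: ifP => _; last by rewrite !mul0r addr0 !mulr0.
    have -> : scalU K s * (genU (e a) * genU (e b)) * genU (e l) -
        genU (e l) * (scalU K s * (genU (e a) * genU (e b))) =
        hbarU K * (scalU K s * (scalU K (res_form (e a) (e l)) * genU (e b) +
             scalU K (res_form (e b) (e l)) * genU (e a))).
      rewrite [RHS]mulrA -(scalUC s (hbarU K)) -[RHS]mulrA -comm_ee_e // mulrBr.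
      by rewrite (mulrA (genU (e l)) (scalU K s)) -(scalUC s (genU (e l))) !mulrA.
    rewrite !scalUM -!mulrA; set x := genU (e (- l)); set y := _ + _.
    set m := scalU K (dual_weight l).
    rewrite (mulrA x) -(hbarUC x) -mulrA (mulrA m) -(hbarUC m) -mulrA; congr (_ * _).
    rewrite (mulrA x) -(scalUC s x) -mulrA (mulrA m) -(scalUC s m) -mulrA.
    congr (_ * _); rewrite /y mulrDr !(mulrA x) -!(scalUC _ x) mulrDr -!mulrA.
    by [].
  rewrite (genUC (e b) (e a)) addrA -mulr2n mulrDr mulrnAr mulrDr.
  by congr (_ + _); rewrite scalUM !mulrA -(scalUC s) -!mulrA hbarUC !mulrA.
- exists 0%N => B _; exists (- (s *+ 2)).
  have central u : scalU K s * hbarU K * u = u * (scalU K s * hbarU K).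
    by rewrite -mulrA hbarUC mulrA scalUC -mulrA scalUC.
  rewrite /euler big1 => [|i _]; last first.
    by rewrite /euler_term central subrr !mulr0 if_same.
  rewrite scalUN mulNr; apply/esym/eqP; rewrite subr_eq0; apply/eqP.
  have E : hbarU K * (scalU K s * hbarU K) = scalU K s * hbarU K ^+ 2.
    by rewrite mulrA -(scalUC s (hbarU K)) -mulrA.
  by rewrite !mulr2n scalUD mulrDl mulrDr E.
Qed.

(** For these [l], the element [e_l] is orthogonal to m^N. *)
Lemma Um_right_e N l u : (- N%:Z < l)%R -> u \in Um N -> u * genU (e l) \in Um N.
Proof.
move=> lt; move: u; apply: span_map => [|x y|_ [v [f [fN ->]]]].
- exact: mul0r.
- exact: mulrBl.
rewrite -mulrA genUC res_form_er fN; last lia.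
by rewrite mul0rz scalU0 mul0r addr0 mulrA; apply: span_gen; exists (v * genU (e l)), f.
Qed.

(** An element of quadratic shape that commutes with all [e_l] is a constant:
    Euler's identity recovers it from its commutators. *)
Lemma quad_central (X : Ubar K) :
  (forall l, X * ubar_const (genU (e l)) = ubar_const (genU (e l)) * X) ->
  (forall N, exists2 q, q \in quad & apx N X (hbarU K * q)) ->
  exists r, hbar_bar K * X = ubar_const (scalU K r * hbarU K ^+ 3).
Proof.
move=> XC Xq.
have level N : exists r, apx N (hbar_bar K * X) (scalU K r * hbarU K ^+ 3).
  have [q qQ Xhq] := Xq N.
  have term l : exists s, hbarU K * euler_term q l - scalU K s * hbarU K ^+ 3 \in Um N.
    rewrite /euler_term; case: ifP => [l0|_]; last first.
      by exists 0; rewrite mulr0 mul0r subr0 rpred0.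
    set w := dual_weight l.
    have [lt|ge] := boolP (- N%:Z < l)%R.
      (* Multiplication by [e_l] on both sides preserves U o m^N, so the commutator
         of [q] with [e_l] is as trivial as that of [X]. *)
      exists 0; rewrite mul0r subr0 mulrA hbarUC -mulrA Um_left //.
      rewrite mulrA hbarUC -mulrA Um_left //.
      have close B : (N <= B)%N -> lvl X B - hbarU K * q \in Um N.
        by move=> le; apply: apx_sub Xhq; apply: apxS (apx_refl B X).
      have apl : apx N (ubar_const (genU (e l)) * X) (genU (e l) * (hbarU K * q)).
        have [B0 H] := cvgM (cvg_const (genU (e l))) (cvg_lvl X) N.
        apply: apx_eq (H (B0 + N)%N _) _; first lia.
        by rewrite -mulrBr Um_left // close //; lia.
      have apr : apx N (X * ubar_const (genU (e l))) (hbarU K * q * genU (e l)).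
        have [B0 H] := cvgM (cvg_lvl X) (cvg_const (genU (e l))) N.
        apply: apx_eq (H (B0 + N)%N _) _; first lia.
        by rewrite -mulrBl; apply: Um_right_e => //; apply: close; lia.
      rewrite XC in apr; have := apx_sub apr apl.
      have -> : genU (e l) * (hbarU K * q) = hbarU K * (genU (e l) * q).
        by rewrite mulrA -hbarUC -mulrA.
      by rewrite -mulrA -mulrBr.
    (* Now [e_(-l)] is in m^N: moving it to the right past the commutator, which is
       linear in the fields, leaves a constant. *)
    have [g Eg] := quad_gen_comm (e l) qQ; rewrite Eg.
    exists (w * res_form (e (- l)) g).
    have -> : genU (e (- l)) * (hbarU K * genU g) =
        hbarU K * (genU g * genU (e (- l)) + scalU K (res_form (e (- l)) g) * hbarU K).
      by rewrite -genUC mulrA -hbarUC mulrA.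
    have E x y : hbarU K * (scalU K w * (hbarU K * (x + scalU K y * hbarU K))) -
        scalU K (w * y) * hbarU K ^+ 3 = hbarU K * (scalU K w * (hbarU K * x)).
      rewrite !mulrDr -addrA [X in _ + X](_ : _ = 0) ?addr0 //.
      apply/eqP; rewrite subr_eq0; apply/eqP.
      by rewrite scalUM !hbar_scal -mulrA !exprS expr0 mulr1.
    rewrite E Um_left // Um_left // Um_left // Um_left //; apply: Um_genU => i lti.
    by apply: e_bounded; lia.
  have [B0 HB] := euler_quad qQ; have [r Er] := HB B0 (leqnn _).
  have [s Hs] : exists s, hbarU K * euler B0 q - scalU K s * hbarU K ^+ 3 \in Um N.
    rewrite /euler; apply: (big_ind (fun u =>
      exists s, hbarU K * u - scalU K s * hbarU K ^+ 3 \in Um N)) => [|u v [s Hu] [t Hv]|i _].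
    - by exists 0; rewrite mulr0 mul0r subr0 rpred0.
    - by exists (s + t); rewrite scalUD mulrDl mulrDr; apply: Um_add.
    - exact: term.
  exists ((2^-1 : k)%:A * (s - r)).
  have apY : apx N (hbar_bar K * X) (hbarU K * (hbarU K * q)).
    have [C H] := cvgM (cvg_const (hbarU K)) (cvg_lvl X) N.
    apply: apx_eq (H (C + N)%N _) _; first lia.
    rewrite -mulrBr Um_left //; apply: apx_sub Xhq.
    by apply: apxS (apx_refl (C + N) X); lia.
  apply: apx_eq apY _; set Y := _ * (_ * q).
  have -> : Y - scalU K ((2^-1 : k)%:A * (s - r)) * hbarU K ^+ 3 =
      scalU K (2^-1 : k)%:A * (hbarU K * euler B0 q - scalU K s * hbarU K ^+ 3).
    have Y2 : (scalU K (2^-1 : k)%:A * Y) *+ 2 = Y.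
      rewrite mulr2n -mulrDl -scalUD -[X in _ = X]mul1r -scalU1.
      by congr (scalU K _ * _); have := half_double (1 : R); rewrite mulr1.
    rewrite Er [hbarU K * (_ + _)]mulrDr hbar_scal -exprS -addrA -mulrBl -scalUN.
    rewrite -scalUD !mulrnAr [RHS]mulrDr mulrnAr -/Y Y2; congr (_ + _).
    by rewrite [RHS]mulrA -scalUM -mulNr -scalUN -mulrN opprB.
  exact: Um_left.
(* The constants found for different [N] agree, because they agree modulo U o O. *)
have [r0 H0] := level 0%N; exists r0.
apply: apx_ext => N; exists (scalU K r0 * hbarU K ^+ 3); last exact: apx_const.
have [r H] := level N; suff -> : r0 = r by [].
have := apx_sub H0 (apxS (leq0n N) H).
rewrite -mulrBl -scalUN -scalUD => /scal_hbar_Um /eqP.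
by rewrite subr_eq0 => /eqP.
Qed.

End Quadratic.

(** * The bracket of Sugawara operators *)

Section Cocycle.
Variables (k : numFieldType) (R : comAlgType k) (K : laurentType R).
Local Notation e := (eseries K).
Local Notation quad := (span (@quad_gen k R K)).
Implicit Types (f g : K) (D E : thetaKR K) (d : thetaR R) (x y : thetaHat K).

Lemma quad_sum_quad (F : K -> K) B : derivation F -> quad_sum F B \in quad.
Proof.
move=> dF; apply: rpred_sum => i _; apply: rpred_sum => j _.
rewrite /quad_term; case: ifP => [/andP[i0 j0]|_]; last exact: rpred0.
by rewrite /normal_ord; case: ifP => _; apply: quad_ee; rewrite oppr_eq0.
Qed.

Lemma tau_num_quad (F : K -> K) : derivation F ->
  exists2 s, forall B, s B \in quad & cvgU s (tau_num F).
Proof.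
move=> dF; exists (fun B => scalU K (2^-1 : k)%:A * quad_sum F B) => [B|].
  exact/quad_scal/quad_sum_quad.
exact: cvgM (cvg_const _) (quad_lim_cvg dF).
Qed.

Lemma hor_e d l : hor d (e l) = 0.
Proof.
apply: coef_ext => i; rewrite coef_hor coef_e coef0; case: eqP => _.
  exact: der1 (thetaR_der d).
exact: der0 (thetaR_der d).
Qed.

Lemma deltaU_quad d q : q \in quad -> deltaU d q \in quad.
Proof.
move: q; apply: span_map => [|x y|_ [[r [a [b [a0 b0 ->]]]]|[r ->]]].
- exact: deltaU0.
- exact: deltaUB.
- rewrite !deltaUM !deltaU_gen !hor_e deltaU_scal genU0 mul0r mulr0 addr0 mulr0 addr0.
  exact: quad_ee.
- by rewrite deltaUM deltaU_scal deltaU_hbar mulr0 addr0; apply: quad_hbar.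
Qed.

Lemma cvg_delta d s (z : Ubar K) : cvgU s z ->
  cvgU (fun B => deltaU d (s B)) (delta_bar d z).
Proof.
move=> sz N; have [B0 H] := sz N; exists B0 => B le.
by apply: Um_trans (lvl_mk _ _) _; rewrite -deltaUB deltaU_Um //; apply: H.
Qed.

Lemma delta_barB d (z z' : Ubar K) : delta_bar d (z - z') = delta_bar d z - delta_bar d z'.
Proof.
rewrite delta_barD; congr (_ + _); apply/eqP; rewrite -addr_eq0 -delta_barD addNr.
apply/eqP; apply: (@addrI _ (delta_bar d 0)); by rewrite -delta_barD !addr0.
Qed.

Lemma delta_bar_comm d d' (z : Ubar K) :
  delta_bar d (delta_bar d' z) - delta_bar d' (delta_bar d z) = delta_bar (lie d d') z.
Proof.
have UC u : deltaU d (deltaU d' u) - deltaU d' (deltaU d u) = deltaU (lie d d') u :> UK K.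
  elim/UK_ind: u => [r||f|u v Eu Ev|u Eu|u v Eu Ev].
  - by rewrite !deltaU_scal scalUD scalUN.
  - by rewrite !deltaU_hbar !deltaU0 subrr.
  - rewrite !deltaU_gen -genUB; congr genU; apply: coef_ext => i.
    by rewrite coefB !coef_hor.
  - by rewrite !deltaUD -Eu -Ev opprD addrACA.
  - rewrite -[- u]add0r !deltaUB !deltaU0 -Eu !sub0r opprD opprK addrC.
    by [].
  - have Z (a b c f a' f' : UK K) :
        a + b + (c + f) - (a' + c + (b + f')) = (a - a') + (f - f').
      rewrite (addrC c f) (addrACA a) (addrC b f') (addrACA a').
      by rewrite (addrC c b) opprD [LHS]addrACA subrr addr0 opprD addrACA.
    by rewrite !(deltaUM, deltaUD) -Eu -Ev mulrBl mulrBr Z.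
have C d1 d2 := cvg_delta d1 (cvg_delta d2 (cvg_lvl z)).
apply: cvg_unique (cvgB (C d d') (C d' d)) _.
apply: cvg_close (cvg_delta (lie d d') (cvg_lvl z)) _ => N; exists 0%N => B _.
by rewrite -UC subrr rpred0.
Qed.

Lemma base_lie D E : base (lie D E) = lie (base D) (base E).
Proof.
apply: thetaR_ext => r; apply: (@coefA_inj R K).
by rewrite -baseE /= scalerBl -!baseE.
Qed.

Lemma hor_lie d d' f : hor (lie d d') f = hor d (hor d' f) - hor d' (hor d f).
Proof. by apply: coef_ext => i; rewrite coefB !coef_hor. Qed.

Lemma noconstB f g : noconst (f - g) = noconst f - noconst g.
Proof. by rewrite /noconst coefB scalerBl !opprD addrACA. Qed.
Lemma noconstD f g : noconst (f + g) = noconst f + noconst g.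
Proof. by rewrite /noconst coefD scalerDl !opprD addrACA. Qed.

Lemma noconst_hor d f : noconst (hor d f) = hor d (noconst f).
Proof.
apply: coef_ext => i; rewrite coef_hor !coef_noconst coef_hor.
by case: eqP => // _; rewrite (der0 (thetaR_der d)).
Qed.

Lemma vert_noconst D f : vert D (noconst f) = vert D f.
Proof. by rewrite /noconst (derB (vert_derivation D)) vert_cst subr0. Qed.

Lemma vert_lie D E f : vert (lie D E) f =
  (vert D (vert E f) - vert E (vert D f)) +
  (hor (base D) (vert E f) - vert E (hor (base D) f)) -
  (hor (base E) (vert D f) - vert D (hor (base E) f)).
Proof.
rewrite {1}/vert base_lie hor_lie (_ : lie D E f = D (E f) - E (D f)) //.
have S (F G : thetaKR K) : F (G f) = vert F (vert G f) + hor (base F) (vert G f) +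
    (vert F (hor (base G) f) + hor (base F) (hor (base G) f)) :> K.
  by rewrite {1}(vertE G f) (thetaKR_der F).1 -!vertE.
rewrite (S D E) (S E D); ring.
Qed.

(** Horizontal derivations commute with taking the nonconstant part and vertical
    ones kill constants, so the derivations through which theta-hat acts on the
    fields compose like the original ones. *)
Lemma noconst_vert_lie D E f : noconst (vert (lie D E) f) =
  (noconst (vert D (noconst (vert E f))) - noconst (vert E (noconst (vert D f)))) +
  (hor (base D) (noconst (vert E f)) - noconst (vert E (hor (base D) f))) -
  (hor (base E) (noconst (vert D f)) - noconst (vert D (hor (base E) f))).
Proof.
rewrite vert_lie noconstB noconstD (noconstB (vert D (vert E f))).
rewrite (noconstB (hor _ (vert E f))) (noconstB (hor _ (vert D f))).
by rewrite !vert_noconst -!noconst_hor.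
Qed.

Local Notation tn D := (tau_num (vert D)).
Local Notation c f := (ubar_const (genU f)).

Lemma X_comm D f : tn D * c f - c f * tn D = hbar_bar K * c (noconst (vert D f)).
Proof. exact: tau_num_comm (vert_derivation D) (vert_linear D) (vert_continuous D) f. Qed.

(** [h-bar^2] times the failure of [tau_hat] to respect brackets. *)
Definition curvature D E : Ubar K :=
  tn D * tn E - tn E * tn D +
  hbar_bar K * (delta_bar (base D) (tn E) - delta_bar (base E) (tn D) - tn (lie D E)).

Lemma ubar_genB f g : c (f - g) = c f - c g.
Proof. by rewrite genUB -ubar_constN -ubar_constD. Qed.
Lemma ubar_genD f g : c (f + g) = c f + c g.
Proof. by rewrite genUD ubar_constD. Qed.

Lemma delta_bar_comm_gen d (z : Ubar K) f g :
  z * c f - c f * z = hbar_bar K * c g ->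
  delta_bar d z * c f - c f * delta_bar d z =
  hbar_bar K * c (hor d g) - (z * c (hor d f) - c (hor d f) * z).
Proof.
move=> /(congr1 (delta_bar d)).
rewrite delta_barB !delta_barM !delta_bar_const !deltaU_gen deltaU_hbar.
rewrite -[ubar_const 0]/(0 : Ubar K) mul0r add0r => <-.
by rewrite [c (hor d f) * z + _]addrC opprD [X in _ = X - _]addrACA addrK.
Qed.

Lemma delta_X_comm d D f :
  delta_bar d (tn D) * c f - c f * delta_bar d (tn D) =
  hbar_bar K * c (hor d (noconst (vert D f)) - noconst (vert D (hor d f))).
Proof. by rewrite (delta_bar_comm_gen d (X_comm D f)) X_comm [in RHS]ubar_genB mulrBr. Qed.

Lemma comm_jacobi (S : pzRingType) (x y z : S) :
  (x * y - y * x) * z - z * (x * y - y * x) =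
  (x * (y * z - z * y) - (y * z - z * y) * x) -
  (y * (x * z - z * x) - (x * z - z * x) * y).
Proof.
have Z (V : zmodType) (a b p q u v : V) :
    a - b - (p - q) = a - u - (v - q) - (b - v - (u - p)).
  rewrite !opprB [RHS]addrACA (addrA _ u) subrK (addrA _ v) subrK.
  by rewrite -!addrA; congr (a + _); rewrite [LHS]addrCA [RHS]addrCA [- b - p]addrC.
by rewrite !mulrBl !mulrBr !mulrA; apply: Z.
Qed.

Lemma commDl (S : pzRingType) (x y z : S) :
  (x + y) * z - z * (x + y) = (x * z - z * x) + (y * z - z * y).
Proof. by rewrite mulrDl mulrDr opprD addrACA. Qed.

Lemma curvature_comm_abstract (S : pzRingType) (h x y dy dx u z a1 a2 a3 a4 a5 a6 : S) :
  (forall v, h * v = v * h) ->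
  y * z - z * y = h * a1 -> x * z - z * x = h * a2 ->
  x * a1 - a1 * x = h * a3 -> y * a2 - a2 * y = h * a4 ->
  dy * z - z * dy = h * a5 -> dx * z - z * dx = h * a6 ->
  u * z - z * u = h * (a3 - a4 + (a5 - a6)) ->
  (x * y - y * x + h * (dy - dx - u)) * z - z * (x * y - y * x + h * (dy - dx - u)) = 0.
Proof.
move=> hC yz xz xa ya dyz dxz uz.
have C1 v w : v * (h * w) - h * w * v = h * (v * w - w * v).
  by rewrite mulrBr !mulrA -(hC v).
have C2 v w : h * v * w - w * (h * v) = h * (v * w - w * v).
  by rewrite mulrBr !mulrA -(hC w).
rewrite commDl comm_jacobi yz xz !C1 xa ya C2 !commBl dyz dxz uz -!mulrBr -mulrDr.
by rewrite -mulrDr [a3 - a4 + (_ - _)]addrA subrr !mulr0.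
Qed.

(** By the Jacobi identity, the commutator with [f] is the failure of the
    derivations of the fields to respect the bracket, which is zero. *)
Lemma curvature_comm D E f : curvature D E * c f = c f * curvature D E.
Proof.
apply/eqP; rewrite -subr_eq0; apply/eqP.
apply: (curvature_comm_abstract (@hbar_barC _ K) (X_comm E f) (X_comm D f)
  (X_comm D _) (X_comm E _) (delta_X_comm _ E f) (delta_X_comm _ D f)).
have split4 (p q v w : K) : c (p - q + v - w) = c p - c q + (c v - c w).
  by rewrite -addrA ubar_genD !ubar_genB.
by rewrite (X_comm (lie D E) f) noconst_vert_lie split4.
Qed.

(** The Virasoro relation: the curvature is a limit of quadratic elements and
    commutes with all fields, so it is a constant. *)
Lemma curvature_scalar D E : exists r,
  hbar_bar K * curvature D E = ubar_const (scalU K r * hbarU K ^+ 3).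
Proof.
apply: quad_central => [l|N]; first exact: curvature_comm.
have [s sQ sX] := tau_num_quad (vert_derivation D).
have [t tQ tX] := tau_num_quad (vert_derivation E).
have [u uQ uX] := tau_num_quad (vert_derivation (lie D E)).
have C := cvgD (cvgB (cvgM sX tX) (cvgM tX sX)) (cvgM (cvg_const (hbarU K))
  (cvgB (cvgB (cvg_delta (base D) tX) (cvg_delta (base E) sX)) uX)).
have [B H] := C N; have [p pQ Ep] := quad_comm (sQ B) (tQ B).
exists (p + (deltaU (base D) (t B) - deltaU (base E) (s B) - u B)).
  by rewrite rpredD // !rpredB ?deltaU_quad.
by rewrite mulrDr -Ep; apply: H.
Qed.

Lemma delta_loc_comm d d' (z : Uloc K) :
  delta_loc d (delta_loc d' z) - delta_loc d' (delta_loc d z) = delta_loc (lie d d') z.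
Proof.
elim/frac_ind: z => x n.
rewrite (delta_locE d x) (delta_locE d' x) (delta_locE (lie d d') x).
by rewrite (delta_locE d) (delta_locE d') -fracB delta_bar_comm.
Qed.

Local Notation tau D := (tau_hat (vert D)).

Lemma scalLN (r : R) : scalL K (- r) = - scalL K r.
Proof. by rewrite /scalL scalUN toUlocN. Qed.

Lemma frac_raise1 (x : Ubar K) n :
  frac (@hbar_barC _ K) x n = frac _ (hbar_bar K * x) n.+1.
Proof. by rewrite -(frac_raise _ 1). Qed.

Lemma frac_bracket (x y p q u : Ubar K) : let F n z := frac (@hbar_barC _ K) z n in
  F 1%N x * F 1%N y - F 1%N y * F 1%N x + (F 1%N p - F 1%N q) =
  F 1%N u + F 2%N (x * y - y * x + hbar_bar K * (p - q - u)).
Proof.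
move=> F; rewrite -(fracM _ x 1 y 1) -(fracM _ y 1 x 1) -!(fracB _ _ 2) -(fracB p q 1).
rewrite /F (frac_raise1 (p - q)) (frac_raise1 u) -!fracD; congr frac.
by rewrite [hbar_bar K * (_ - u)]mulrBr [RHS]addrC -[RHS]addrA subrK.
Qed.

Lemma ubar_hbarX n : hbar_bar K ^+ n = ubar_const (hbarU K ^+ n).
Proof. by elim: n => [|n IH]; rewrite ?exprS ?IH -?ubar_constM. Qed.

Lemma tau_hat_bracket D E : exists r,
  tau D * tau E - tau E * tau D + (delta_loc (base D) (tau E) - delta_loc (base E) (tau D)) =
  tau (lie D E) + scalL K r.
Proof.
have [r Er] := curvature_scalar D E; exists r.
have -> : scalL K r = frac (@hbar_barC _ K) (curvature D E) 2.
  rewrite frac_raise1 Er /scalL /toUloc -(frac_raise _ 3); congr frac.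
  by rewrite ubar_hbarX -ubar_constM scalUC.
have bE d (F : thetaKR K) : delta_loc d (tau F) = frac _ (delta_bar d (tn F)) 1.
  exact: delta_locE.
rewrite (bE (base D)) (bE (base E)); exact: frac_bracket.
Qed.

(** Brackets of first-order operators [v |-> u * v + d v], up to central
    terms [s] and [t] of the multipliers. *)
Lemma operator_bracket (S : pzRingType) (d e : S -> S) (x y s t z : S) :
  (forall u v, d (u + v) = d u + d v) -> (forall u v, e (u + v) = e u + e v) ->
  (forall u v, d (u * v) = d u * v + u * d v) ->
  (forall u v, e (u * v) = e u * v + u * e v) ->
  (forall v, s * v = v * s) -> (forall v, t * v = v * t) ->
  (x + s) * ((y + t) * z + e z) + d ((y + t) * z + e z) -
  ((y + t) * ((x + s) * z + d z) + e ((x + s) * z + d z)) =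
  (x * y - y * x + (d y - e x) + (d t - e s)) * z + (d (e z) - e (d z)).
Proof.
move=> dD eD dM eM sC tC.
have Z (V : zmodType) (a b p q u a' p' u' : V) :
    a + b + (p + q + u) - (a' + q + (p' + b + u')) = a - a' + (p - p') + (u - u').
  rewrite [X in X - _](AC (2*3) (1*3*5*(2*4))) [X in _ - X](AC (2*3) (1*3*5*(4*2))) /=.
  rewrite opprD [LHS]addrACA subrr addr0 opprD [LHS]addrACA; congr (_ + _).
  by rewrite opprD [LHS]addrACA.
have shift : (x + s) * (y + t) - (y + t) * (x + s) = x * y - y * x.
  rewrite !mulrDl !mulrDr (sC y) (tC x) (sC t).
  rewrite [x * y + _ + _](AC (2*2) (1*(2*3*4))) [X in _ - X](AC (2*2) (1*(3*2*4))) /=.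
  by rewrite opprD [LHS]addrACA subrr addr0.
rewrite [d (_ + e z)]dD [e (_ + d z)]eD dM eM ![(_ + _) * (_ + _ z)]mulrDr Z.
rewrite !(mulrA _ _ z) -!mulrBl shift -mulrDl dD eD; congr (_ * z + _).
by rewrite -[RHS]addrA; congr (_ + _); rewrite opprD [LHS]addrACA.
Qed.

(** The bracket of two operators of [hat_act] is again such an operator, for a
    scalar that collects the curvature and the derivatives of the two scalars. *)
Lemma hat_bracket_exists x y : exists r, forall z,
  hat_act (lie x.1 y.1, r) z = hat_act x (hat_act y z) - hat_act y (hat_act x z).
Proof.
case: x y => D s [E t]; have [r Er] := tau_hat_bracket D E.
exists (r + (base D t - base E s)) => z.
have H := operator_bracket (tau D) (tau E) z
  (delta_locD (base D)) (delta_locD (base E)) (delta_locM (base D)) (delta_locM (base E))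
  (scalLC s) (scalLC t).
apply: etrans (esym H); apply: (f_equal2 +%R (f_equal2 *%R _ (erefl z)) _).
  by rewrite Er !delta_loc_scal (scalLD _ r) (scalLD _ (base D t)) scalLN addrA.
by rewrite delta_loc_comm -base_lie.
Qed.

Lemma hat_lieP x y z :
  hat_act (hat_lie x y) z = hat_act x (hat_act y z) - hat_act y (hat_act x z).
Proof. by move: z; apply: (xgetPex 0 (hat_bracket_exists x y)). Qed.

End Cocycle.

(** * The Fock representation *)

Section FockCommutation.
Variables (k : numFieldType) (R : comAlgType k) (K : laurentType R).
Local Notation e := (eseries K).
Implicit Types (f g : K) (x y : thetaHat K) (v w : Fock K) (r : R).

Lemma hat_act_vac x z : hat_act_Fock x (z *: vac K) = hat_act x z *: vac K.
Proof. by rewrite hat_act_FockZ delta_vac scaler0 addr0. Qed.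

Lemma hat_lie_Fock x y w :
  hat_act_Fock (hat_lie x y) w =
  hat_act_Fock x (hat_act_Fock y w) - hat_act_Fock y (hat_act_Fock x w).
Proof. by have [u ->] := vac_gen w; rewrite !hat_act_vac hat_lieP scalerBl. Qed.

Lemma Fock_hbar w : toUloc (hbarU K) *: w = w.
Proof.
rewrite -[_ *: _]/(loc_act _ _) loc_actE.
by rewrite -[X in _ = X](bar_act_hbar 1) expr1.
Qed.

Lemma Fock_comm f g w : genL f *: (genL g *: w) =
  genL g *: (genL f *: w) + scalL K (res_form f g) *: w.
Proof.
rewrite -[X in _ + _ *: X]Fock_hbar !scalerA -!toUlocM -scalerDl -toUlocD.
by rewrite genUC.
Qed.

Lemma Fock_scalC r f w : genL f *: (scalL K r *: w) = scalL K r *: (genL f *: w).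
Proof. by rewrite !scalerA scalLC. Qed.

(** Only finitely many terms of the normally ordered sum act nontrivially on the
    vacuum. *)
Lemma tau_vac (F : K -> K) : derivation F ->
  exists2 q, q \in span (@quad_gen k R K) & tau_hat F *: vac K = toUloc q *: vac K.
Proof.
move=> dF; have [s sQ cs] := tau_num_quad dF.
have [B H] := cs (modulus 0 (1 : UK K)); exists (s B) => //.
rewrite toUloc_act -[LHS]/(loc_act _ _) tau_hatE loc_actE (bar_actE _ (leqnn _)).
by apply/Fock_eqP; rewrite -mulrBl; apply/Um0_Fock/modulusP/H.
Qed.

(** The form identifies [mpow 0] modulo constants with the dual of K / O, because
    (e_i, e_(-i)) = i is invertible for nonzero i. *)
Lemma residue_representable (mu : K -> R) :
  (forall f g, mu (f + g) = mu f + mu g) -> (forall r f, mu (r *: f) = r * mu f) ->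
  (forall f, mpow 0 f -> mu f = 0) ->
  exists2 o, mpow 0 o & forall f, res_form o f = mu f.
Proof.
move=> muD muZ mu0.
pose o : K := series (fun i => if (0 < i)%R then ((i%:~R : k)^-1)%:A * mu (e (- i)) else 0).
have co i : coef o i = if (0 < i)%R then ((i%:~R : k)^-1)%:A * mu (e (- i)) else 0.
  by rewrite seriesK //; exists 0 => j lt0; rewrite (_ : (0 < j)%R = false) //; lia.
have o0 : mpow 0 o by move=> i lt0; rewrite co (_ : (0 < i)%R = false) //; lia.
exists o => // f.
have [n fn] := coef_bounded f.
pose p := trunc (absz n) (polar f).
have pf : mpow 0 (f - p).
  move=> i lt0; rewrite coefB coef_trunc coef_polar lt0; case: ifP => H; first exact: subrr.
  by rewrite fn ?subrr //; lia.
have -> : mu f = mu p.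
  by rewrite -[f in LHS](subrK p) muD mu0 ?add0r.
rewrite -[f](subrK p) res_formDr mpow0_isotropic // add0r.
rewrite res_form_anti res_form_suml -sumrN /p /trunc.
have mu00 : mu 0 = 0 by rewrite -(scale0r (0 : K)) muZ mul0r.
rewrite (big_morph mu muD mu00); apply: eq_bigr => i _; set l := _ - _.
rewrite res_formZl muZ -mulrN -res_form_anti res_form_er coef_polar co.
case: ifP => [lt0|]; last by rewrite !mul0r.
rewrite (_ : (0 < - l)%R); last lia.
rewrite opprK -scaler_int -scalerAl mul1r scalerA -mulr_algl.
by rewrite mulfV ?scale1r ?mul1r // intr_neq0 //; lia.
Qed.

End FockCommutation.

(** * Splitting K by a subalgebra of Fock type; faithfulness of R *)

Section FockType.
Variables (k : numFieldType) (R : comAlgType k) (K : laurentType R).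
Variable A : subalgClosed K.
Hypothesis hA : fock_type A.
Implicit Types (f g : K) (v w : Fock K) (r : R).

Lemma Acst r : r%:A \in A.
Proof. by rewrite rpredZ // rpred1. Qed.

(** The direct sum decomposition of [K] into the constant-free part of [A], the
    free module on the [b i] and [mpow 0], through its first two projections. *)
Record splitting n (b : 'I_n -> K) (a : K -> K) (c : K -> 'I_n -> R) : Prop := Splitting {
  splitD : forall f g, a (f + g) = a f + a g /\ forall i, c (f + g) i = c f i + c g i;
  splitZ : forall r f, a (r *: f) = r *: a f /\ forall i, c (r *: f) i = r * c f i;
  split_A : forall f, a f \in A;
  split_O : forall f, mpow 0 (f - a f - \sum_i c f i *: b i);
  split_onA : forall x, x \in A -> a x = noconst x /\ forall i, c x i = 0;
  split_onO : forall g, mpow 0 g -> a g = 0 /\ forall i, c g i = 0;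
  split_b : forall i j, c (b j) i = (i == j)%:R
}.

(** The components along [A] and O are unique up to the intersection of [A] and O,
    which consists of the constants; asking for a vanishing constant term of the
    [A]-component removes this ambiguity. *)
Lemma fock_projections : exists n (b : 'I_n -> K) (a : K -> K) (c : K -> {ffun 'I_n -> R}),
  (forall f, [/\ a f \in A, coef (a f) 0 = 0 & mpow 0 (f - a f - \sum_i c f i *: b i)]) /\
  (forall f a' (c' : {ffun 'I_n -> R}), a' \in A -> coef a' 0 = 0 ->
     mpow 0 (f - a' - \sum_i c' i *: b i) -> a f = a' /\ c f = c').
Proof.
have [AO [n [b fb]]] := FT2 hA.
have /choice [c cP] : forall f, exists c : {ffun 'I_n -> R},
    sum_AO A (f - \sum_i c i *: b i) /\
    forall c' : {ffun 'I_n -> R}, sum_AO A (f - \sum_i c' i *: b i) -> c = c'.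
  by move=> f; have [c [cA cU]] := fb f; exists c.
have /choice [a aP] : forall f, exists a,
    [/\ a \in A, coef a 0 = 0 & mpow 0 (f - a - \sum_i c f i *: b i)].
  move=> f; have [[a [o [aA oO E]]] _] := cP f.
  exists (a - coef a 0 *: 1); split.
  - by apply: subalgB => //; apply: Acst.
  - by rewrite coefB coefA eqxx subrr.
  have -> : f - (a - coef a 0 *: 1) - \sum_i c f i *: b i = o + coef a 0 *: 1.
    by rewrite addrAC E; ring.
  apply: mpowD => //.
  by apply: mpowZ => i lt0; rewrite coef1 (_ : (i == 0) = false) //; lia.
exists n, b, a, c; split=> // f a' c' a'A a'0 a'O.
have cc : c f = c'.
  apply: (cP f).2; exists a', (f - a' - \sum_i c' i *: b i); split=> //.
  by ring.
split=> //; have [aA a0 aO] := aP f.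
have /AO [r Er] : a' - a f \in A /\ mpow 0 (a' - a f).
  split; first exact: subalgB.
  have -> : a' - a f = (f - a f - \sum_i c f i *: b i) - (f - a' - \sum_i c' i *: b i).
    by rewrite cc; ring.
  by apply: mpowD => //; apply: mpowN.
have := congr1 (fun g => coef g 0) Er; rewrite coefB a'0 a0 subrr coefA eqxx mulr1n => r0.
by apply/esym/eqP; rewrite -subr_eq0 Er -r0 scale0r.
Qed.

(** Uniqueness of the components makes them linear and determines their values on
    [A], on O and on the [b i]. *)
Lemma fock_splitting : exists n (b : 'I_n -> K) (a : K -> K) (c : K -> 'I_n -> R),
  splitting b a c.
Proof.
have [n [b [a [c [S U]]]]] := fock_projections.
have sD (r s : {ffun 'I_n -> R}) :
    \sum_i [ffun i => r i + s i] i *: b i = \sum_i r i *: b i + \sum_i s i *: b i.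
  by rewrite -big_split; apply: eq_bigr => i _; rewrite ffunE scalerDl.
have sZ t (s : {ffun 'I_n -> R}) :
    \sum_i [ffun i => t * s i] i *: b i = t *: \sum_i s i *: b i.
  by rewrite scaler_sumr; apply: eq_bigr => i _; rewrite ffunE scalerA.
have s0 : \sum_i [ffun=> 0 : R] i *: b i = 0.
  by rewrite big1 // => i _; rewrite ffunE scale0r.
exists n, b, a, (fun f i => c f i); split.
- move=> f g; have [af f0 fO] := S f; have [ag g0 gO] := S g.
  have [|||-> ->] := U (f + g) (a f + a g) [ffun i => c f i + c g i].
  + exact: rpredD.
  + by rewrite coefD f0 g0 addr0.
  + have Z (x x' y y' z z' : K) : x + x' - (y + y') - (z + z') = x - y - z + (x' - y' - z').
      by ring.
    by rewrite sD Z; apply: mpowD.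
  by split=> // i; rewrite ffunE.
- move=> r f; have [af f0 fO] := S f.
  have [|||-> ->] := U (r *: f) (r *: a f) [ffun i => r * c f i].
  + exact: rpredZ.
  + by rewrite coefZ f0 mulr0.
  + by rewrite sZ -!scalerBr; apply: mpowZ.
  by split=> // i; rewrite ffunE.
- by move=> f; have [] := S f.
- by move=> f; have [] := S f.
- move=> x xA; have [|||-> ->] := U x (noconst x) [ffun=> 0].
  + by apply: subalgB => //; apply: Acst.
  + by rewrite coef_noconst eqxx.
  + have -> : x - noconst x - \sum_i [ffun=> 0 : R] i *: b i = coef x 0 *: 1.
      by rewrite s0 /noconst; ring.
    by apply: mpowZ => i lt0; rewrite coef1 (_ : (i == 0) = false) //; lia.
  by split=> // i; rewrite ffunE.
- move=> g gO; have [|||-> ->] := U g 0 [ffun=> 0].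
  + exact: rpred0.
  + by rewrite coef0.
  + by rewrite s0 !subr0.
  by split=> // i; rewrite ffunE.
- move=> i j; have [|||_ ->] := U (b j) 0 [ffun i => (i == j)%:R].
  + exact: rpred0.
  + by rewrite coef0.
  + rewrite (bigD1 j) //= big1 => [|l /negbTE lj]; last by rewrite ffunE lj scale0r.
    by rewrite ffunE eqxx scale1r subr0 addr0 subrr => l _; rewrite coef0.
  by rewrite ffunE.
Qed.

(** The splitting provides the two-point function, because [A] and [mpow 0] are
    isotropic. *)
Lemma coinv_functional : exists lam : UK K -> R,
  vacuum_functional (fun x => x \in A) (mpow 0) lam.
Proof.
have [n [b [a [c S]]]] := fock_splitting.
pose h f := \sum_i c f i *: b i.
have h0 f : (forall i, c f i = 0) -> h f = 0.
  by move=> cf; rewrite /h big1 // => i _; rewrite cf scale0r.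
have hD f g : h (f + g) = h f + h g.
  by rewrite -big_split; apply: eq_bigr => i _; rewrite (splitD S f g).2 scalerDl.
have hZ : Rlinear h.
  by move=> r f; rewrite scaler_sumr; apply: eq_bigr => i _; rewrite (splitZ S r f).2 scalerA.
pose o f := f - a f - h f.
have aho f : f = a f + h f + o f by rewrite /o; ring.
have [|||lam L] := @splitting_functional k R K a h o (fun f g => (splitD S f g).1)
   (fun r f => (splitZ S r f).1) hD hZ aho _ _ (fun x => x \in A).
- by move=> f g; apply: (FT3 hA); apply: split_A S _.
- by move=> f g; apply: mpow0_isotropic; apply: split_O S _.
- move=> x g xA; have [ax /h0 hx] := split_onA S xA; have ag := split_A S g.
  have ox : o x = coef x 0 *: 1 by rewrite /o ax hx /noconst; ring.
  by rewrite /two_point ox hx (FT3 hA) // res_form0l res_form_cstl mulr0 !addr0.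
exists lam; case: L => LB Ls Lh L1 Ll Lr; split=> // u g gO; apply: Lr.
by have [ag /h0 hg] := split_onO S gO.
Qed.

(** The functional [coinv_functional] descends to the coinvariants and reads [r]
    off the multiple [r] of the vacuum. So [R] acts faithfully there. *)
Lemma coinv_faithful r : scalL K r *: vac K \in span (AF_gen A) -> r = 0.
Proof.
have [lam L] := coinv_functional.
have kill u : u \in span (@fock_gen R K) -> lam u = 0.
  move: u; apply: span_sub => [|x y Ex Ey|_ [u [f [s [fO ->]]]]].
  - exact: lam0 L.
  - by rewrite (lamB L) Ex Ey subrr.
  rewrite (lamB L) mulrDr (lamD L) (lam_right L) // add0r mulrA -hbarUC (lam_hbar L) subrr.
  by [].
pose lamF (w : Fock K) := lam (repr w).
have lamFE u : lamF (\pi_(Fock K) u) = lam u.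
  apply/eqP; rewrite -subr_eq0 -(lamB L) kill //.
  by apply/Fock_eqP; rewrite reprK.
have lamF0 w : w \in span (AF_gen A) -> lamF w = 0.
  move: w; apply: span_sub => [|x y Ex Ey|_ [x [w [xA ->]]]].
  - by rewrite -piF0 lamFE (lam0 L).
  - elim/quotW: x Ex => x; elim/quotW: y Ey => y.
    have -> : \pi_(Fock K) x - \pi_(Fock K) y = \pi_(Fock K) (x - y).
      by apply/eqP; rewrite subr_eq -piFD subrK.
    by rewrite !lamFE (lamB L) => -> ->; rewrite subrr.
  - by elim/quotW: w => u; rewrite toUloc_act lamFE (lam_left L).
by move=> /lamF0; rewrite toUloc_act lamFE (lam_scal L) (lam1 L) mulr1.
Qed.

End FockType.

(** * Derivations along the fibres act on coinvariants as scalars *)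

Section VerticalScalar.
Variables (k : numFieldType) (R : comAlgType k) (K : laurentType R).
Variable A : subalgClosed K.
Hypothesis hA : fock_type A.
Local Notation e := (eseries K).
Local Notation AF := (span (AF_gen A)).
Implicit Types (f g : K) (v w : Fock K) (r : R).

Lemma AF_gen_in a v : a \in A -> genL a *: v \in AF.
Proof. by move=> aA; apply: span_gen; exists a, v. Qed.

Lemma AF_perp f w : perp A f -> w \in AF -> genL f *: w \in AF.
Proof.
move=> fA; move: w; apply: span_map => [|v w|_ [a [w [aA ->]]]].
- exact: scaler0.
- exact: scalerBr.
by rewrite Fock_comm fA // -[scalL K 0]/(0 : Uloc K) scale0r addr0; apply: AF_gen_in.
Qed.

Lemma AF_scal r w : w \in AF -> scalL K r *: w \in AF.
Proof.
move: w; apply: span_map => [|v w|_ [a [w [aA ->]]]].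
- exact: scaler0.
- exact: scalerBr.
by rewrite -Fock_scalC; apply: AF_gen_in.
Qed.

(** Every functional on A / R extends to K / O, and is therefore represented by
    an element of [mpow 0]. *)
Lemma perp_sum f : exists g o, [/\ perp A g, mpow 0 o & f = g + o].
Proof.
have [n [b [a [c S]]]] := fock_splitting hA.
have [|||o oO oE] := @residue_representable k R K (fun g => res_form f (a g)).
- by move=> g g'; rewrite (splitD S g g').1 res_formDr.
- by move=> r g; rewrite (splitZ S r g).1 res_formZr.
- by move=> g gO; rewrite (split_onO S gO).1 res_form0r.
exists (f - o), o; split; rewrite ?subrK // => x xA.
rewrite res_formDl res_formNl oE (split_onA S xA).1 /noconst res_formDr res_formNr.
by rewrite res_form_cst subr0 subrr.
Qed.

Fixpoint word (s : seq K) : Fock K :=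
  if s is f :: s' then genL f *: word s' else vac K.

Definition degree_le m : set (Fock K) :=
  [set w | exists r s, (size s <= m)%N /\ w = scalL K r *: word s].
Local Notation F m := (span (degree_le m)).

Lemma F_le m m' : (m <= m')%N -> {subset F m <= F m'}.
Proof.
move=> le; apply: span_sub => [|v w|_ [r [s [ls ->]]]]; [exact: rpred0|exact: rpredB|].
by apply: span_gen; exists r, s; split=> //; apply: leq_trans ls le.
Qed.

Lemma F_word m s : (size s <= m)%N -> word s \in F m.
Proof.
move=> ls; apply: span_gen; exists 1, s; split=> //.
by rewrite (_ : scalL K 1 = 1) ?scale1r.
Qed.

Lemma F_scal r m w : w \in F m -> scalL K r *: w \in F m.
Proof.
move: w; apply: span_map => [|v w|_ [t [s [ls ->]]]].
- exact: scaler0.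
- exact: scalerBr.
apply: span_gen; exists (r * t), s; split=> //.
by rewrite scalerA -toUlocM -scalUM.
Qed.

Lemma F_gen f m w : w \in F m -> genL f *: w \in F m.+1.
Proof.
apply: (span_sub (P := fun w => genL f *: w \in F m.+1)) => {w} [|v w fv fw|_ [t [s [ls ->]]]].
- by rewrite scaler0 rpred0.
- by rewrite scalerBr rpredB.
by rewrite Fock_scalC; apply: F_scal; apply: (@F_word _ (f :: s)).
Qed.

(** Elements of O kill the vacuum, so that only commutators remain when one is moved
    to the right through a word. *)
Lemma F_regular o s : mpow 0 o -> genL o *: word s \in F (size s).
Proof.
move=> oO; elim: s => [|f s IH] /=; first by rewrite gen_vac // rpred0.
rewrite Fock_comm rpredD ?F_gen // F_scal // F_word //.
Qed.

Lemma F_all w : exists m, w \in F m.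
Proof.
have [u ->] := vac_gen w.
suff H (v : Fock K) m : v \in F m -> exists m', toUloc u *: v \in F m'.
  by apply: (H _ 0%N); apply: (@F_word _ [::]).
elim/UK_ind: u v m => [r||f|u1 u2 I1 I2|u I|u1 u2 I1 I2] v m vF.
- by exists m; apply: F_scal.
- by exists m; rewrite Fock_hbar.
- by exists m.+1; apply: F_gen.
- have [m1 H1] := I1 _ _ vF; have [m2 H2] := I2 _ _ vF; exists (m1 + m2)%N.
  rewrite toUlocD scalerDl rpredD //; [apply: F_le H1 | apply: F_le H2]; lia.
- by have [m' H] := I _ _ vF; exists m'; rewrite toUlocN scaleNr rpredN.
- have [m2 H2] := I2 _ _ vF; have [m1 H1] := I1 _ _ H2.
  by exists m1; rewrite toUlocM -scalerA.
Qed.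

(** The Fock space is generated by the vacuum under the orthogonal of [A]: in a word,
    write the first letter as an element of the orthogonal plus one of O, and apply
    induction on the degree, which elements of O do not raise. *)
Lemma perp_cyclic (P : Fock K -> Prop) :
  P 0 -> (forall v w, P v -> P w -> P (v - w)) -> (forall r w, P w -> P (scalL K r *: w)) ->
  (forall f w, perp A f -> P w -> P (genL f *: w)) -> P (vac K) -> forall w, P w.
Proof.
move=> P0 PB PZ Pf Pv w; have [m] := F_all w.
have PD u v : P u -> P v -> P (u + v).
  by move=> Pu Pw; rewrite -[v]opprK; apply: (PB) => //; rewrite -[- v]sub0r; apply: (PB).
elim: m w => [|m IH]; apply: span_sub => [//|//|_ [r [s [ls ->]]]]; apply: PZ.
  by case: s ls.
case: s ls => [|f s] ls; first exact: Pv.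
have [g [o [gA oO ->]]] := perp_sum f; rewrite /= genLD scalerDl; apply: PD.
  by apply: Pf => //; apply: IH; apply: F_word.
by apply: IH; apply: F_le (F_regular s oO).
Qed.

Lemma Fock_sum (I : finType) (z : I -> R) (h : I -> K) w :
  genL (\sum_i z i *: h i) *: w = \sum_i scalL K (z i) *: (genL (h i) *: w).
Proof.
have D : {morph (fun f => genL f *: w) : f g / f + g} by move=> f g; rewrite genLD scalerDl.
rewrite (big_morph _ D (id1 := 0)) ?genL0 ?scale0r //.
by apply: eq_bigr => i _; rewrite genLZ scalerA.
Qed.

Section QuadraticVectors.
Variables (n : nat) (b : 'I_n -> K) (a : K -> K) (c : K -> 'I_n -> R).
Hypothesis S : splitting A b a c.
Local Notation pi := (\pi_(coinv A)).
Local Notation o0 := (vac K).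

Definition quad_vec (z : 'I_n -> 'I_n -> R) : Fock K :=
  \sum_i \sum_j scalL K (z i j) *: (genL (b i) *: (genL (b j) *: o0)).

Lemma pi_scal r w : pi (scalL K r *: w) = r *: pi w.
Proof. by rewrite -[RHS]/(coinv_scale r (pi w)) coinv_scaleE. Qed.

Lemma pi_AF w : w \in AF -> pi w = 0.
Proof.
move=> wA; have -> : (0 : coinv A) = pi 0.
  by apply: (@addrI _ (pi 0)); rewrite -coinv_piD !addr0.
by apply/coinv_eqP; rewrite subr0.
Qed.

Lemma pi_gen x w : x \in A -> pi (genL x *: w) = 0.
Proof. by move=> xA; apply/pi_AF/AF_gen_in. Qed.

Lemma gen_split f : genL f *: o0 =
  genL (a f) *: o0 + genL (\sum_i c f i *: b i) *: o0.
Proof.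
set h := \sum_i _; rewrite -scalerDl -genLD; apply/eqP; rewrite -subr_eq0 -scalerBl -genLB.
by rewrite opprD addrA gen_vac //; apply: split_O S f.
Qed.

(** Modulo the action of [A], the vectors of degree 2 reduce to the quadratic
    vectors in the [b i]. *)
Lemma pi_pair f g : exists z r,
  pi (genL f *: (genL g *: o0)) = pi (quad_vec z) + r *: pi o0.
Proof.
pose hg := \sum_i c g i *: b i; pose hf := \sum_i c f i *: b i.
exists (fun i j => c g i * c f j).
exists (res_form hg (a f) + (res_form f hg + res_form f (a g))).
have A1 u x : x \in A -> pi (genL u *: (genL x *: o0)) = res_form u x *: pi o0.
  by move=> xA; rewrite Fock_comm coinv_piD pi_gen // add0r pi_scal.
rewrite (gen_split g) scalerDr coinv_piD A1; last exact: split_A S g.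
rewrite -/hg Fock_comm coinv_piD pi_scal (gen_split f) -/hf scalerDr coinv_piD.
rewrite A1; last exact: split_A S f.
have -> : genL hg *: (genL hf *: o0) = quad_vec (fun i j => c g i * c f j).
  rewrite Fock_sum /quad_vec; apply: eq_bigr => i _.
  rewrite Fock_sum scaler_sumr scaler_sumr; apply: eq_bigr => j _.
  by rewrite Fock_scalC scalerA -toUlocM -scalUM.
by rewrite !scalerDl [LHS]addrC [_ *: _ + pi _]addrC -!addrA.
Qed.

Lemma quad_vecB z z' : quad_vec (fun i j => z i j - z' i j) = quad_vec z - quad_vec z'.
Proof.
rewrite -sumrB; apply: eq_bigr => i _; rewrite -sumrB; apply: eq_bigr => j _.
by rewrite scalLD scalLN scalerBl.
Qed.

Lemma quad_vec0 : quad_vec (fun _ _ => 0) = 0.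
Proof.
by rewrite /quad_vec big1 // => i _; rewrite big1 // => j _; apply: scale0r.
Qed.

Lemma quad_vecZ r z : scalL K r *: quad_vec z = quad_vec (fun i j => r * z i j).
Proof.
rewrite scaler_sumr; apply: eq_bigr => i _; rewrite scaler_sumr; apply: eq_bigr => j _.
by rewrite scalerA -toUlocM -scalUM.
Qed.

Lemma pi_quad q : q \in span (@quad_gen k R K) -> exists z r,
  pi (toUloc q *: o0) = pi (quad_vec z) + r *: pi o0.
Proof.
have piB v w : pi (v - w) = pi v - pi w.
  by apply/eqP; rewrite eq_sym subr_eq -coinv_piD subrK.
move: q; apply: span_sub => [|x y [z [r E]] [z' [r' E']]|_ [[s [i [j [_ _ ->]]]]|[s ->]]].
- exists (fun _ _ => 0), 0; rewrite quad_vec0 (scale0r (pi o0)) addr0.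
  by congr pi; apply: scale0r.
- exists (fun i j => z i j - z' i j), (r - r').
  rewrite toUlocD toUlocN scalerBl piB E E' quad_vecB piB scalerBl opprD addrACA.
  by [].
- have [z [r E]] := pi_pair (e i) (e j); exists (fun i j => s * z i j), (s * r).
  by rewrite !toUlocM -!scalerA pi_scal E scalerDr scalerA -pi_scal quad_vecZ.
- exists (fun _ _ => 0), s; rewrite quad_vec0 toUlocM -scalerA Fock_hbar pi_scal.
  by rewrite [pi 0]pi_AF ?rpred0 // add0r.
Qed.

(** The coordinates [c l] are represented by elements of [mpow 0] that are
    orthogonal to [A]: they annihilate the vacuum and act on coinvariants. *)
Lemma coordinate_field l : exists o, [/\ perp A o, mpow 0 o & forall f, res_form o f = c f l].
Proof.
have [|||o oO oE] := @residue_representable k R K (fun g => c g l).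
- by move=> g g'; rewrite (splitD S g g').2.
- by move=> r g; rewrite (splitZ S r g).2.
- by move=> g gO; rewrite (split_onO S gO).2.
by exists o; split=> // x xA; rewrite oE (split_onA S xA).2.
Qed.

(** Each of the two operators contracts one of the two factors [b i] and [b j], in
    either order. *)
Lemma coordinate_quad o o' l m z : mpow 0 o -> mpow 0 o' ->
  (forall f, res_form o f = c f l) -> (forall f, res_form o' f = c f m) ->
  genL o' *: (genL o *: quad_vec z) = scalL K (z l m + z m l) *: o0.
Proof.
move=> oO o'O oE o'E.
have one i j : genL o' *: (genL o *: (genL (b i) *: (genL (b j) *: o0))) =
    scalL K ((l == i)%:R * (m == j)%:R + (l == j)%:R * (m == i)%:R) *: o0.
  have ann g p u : mpow 0 g -> (forall f, res_form g f = c f p) ->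
      genL g *: (genL (b u) *: o0) = scalL K (p == u)%:R *: o0.
    by move=> gO gE; rewrite Fock_comm gen_vac // scaler0 add0r gE (split_b S).
  rewrite (Fock_comm o (b i)) (ann o l) // oE (split_b S) Fock_scalC scalerDr !Fock_scalC.
  rewrite !(ann o' m) // !scalerA -!toUlocM -!scalUM -scalerDl -toUlocD -scalUD addrC.
  by rewrite [(l == j)%:R * _]mulrC.
rewrite /quad_vec !scaler_sumr.
have sumE (F : 'I_n -> R) :
    \sum_i scalL K (F i) *: o0 = scalL K (\sum_i F i) *: o0.
  have D : {morph (fun s => scalL K s *: o0) : s t / s + t}.
    by move=> s t; rewrite scalLD scalerDl.
  by rewrite (big_morph _ D (id1 := 0)) //; apply: scale0r.
transitivity (\sum_i \sum_j
    scalL K (z i j * ((l == i)%:R * (m == j)%:R + (l == j)%:R * (m == i)%:R)) *: o0).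
  apply: eq_bigr => i _; rewrite !scaler_sumr; apply: eq_bigr => j _.
  by rewrite !Fock_scalC one scalerA -toUlocM -scalUM.
under eq_bigr do rewrite sumE.
rewrite sumE; congr (scalL K _ *: _).
have pick (F : 'I_n -> R) p : \sum_i F i * (p == i)%:R = F p.
  rewrite (bigD1 p) //= eqxx mulr1 big1 ?addr0 // => i /negbTE ip.
  by rewrite eq_sym ip mulr0.
under eq_bigr => i _.
  under eq_bigr => j _ do rewrite mulrDr mulrA [(l == j)%:R * _]mulrC mulrA.
  rewrite big_split /= (pick (fun j => z i j * (l == i)%:R)).
  rewrite (pick (fun j => z i j * (m == i)%:R)); over.
by rewrite big_split /= (pick (fun i => z i m)) (pick (fun i => z i l)).
Qed.

(** An antisymmetric combination of products of two fields is a combination of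
    commutators, that is, of constants. *)
Lemma quad_vec_skew z : (forall l m, z l m + z m l = 0) ->
  exists r, quad_vec z = scalL K r *: o0.
Proof.
move=> skew.
pose y := \sum_i \sum_j z i j * res_form (b i) (b j).
have two : quad_vec z + quad_vec z = scalL K y *: o0.
  have tr : quad_vec z = - \sum_i \sum_j scalL K (z i j) *: (genL (b j) *: (genL (b i) *: o0)).
    rewrite [X in - X]exchange_big -sumrN; apply: eq_bigr => i _.
    rewrite -sumrN; apply: eq_bigr => j _; rewrite -scaleNr -scalLN; congr (scalL K _ *: _).
    by apply/eqP; rewrite -addr_eq0 skew.
  have D : {morph (fun s => scalL K s *: o0) : s t / s + t}.
    by move=> s t; rewrite scalLD scalerDl.
  have Z : scalL K 0 *: o0 = 0 by apply: scale0r.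
  rewrite {2}tr /y (big_morph _ D Z) -sumrB; apply: eq_bigr => i _.
  rewrite (big_morph _ D Z) -sumrB; apply: eq_bigr => j _.
  by rewrite -scalerBr Fock_comm addrC addKr scalerA -toUlocM -scalUM.
exists ((2^-1 : k)%:A * y).
rewrite /scalL scalUM toUlocM -scalerA -two scalerDr -scalerDl -scalLD.
have -> : (2^-1 : k)%:A + (2^-1 : k)%:A = 1 :> R.
  by have := half_double (1 : R); rewrite !mulr1.
by rewrite (_ : scalL K 1 = 1) ?scale1r.
Qed.

End QuadraticVectors.

(** The derivation maps the orthogonal of [A] to [A], so the operator commutes
    with this orthogonal on coinvariants. The vacuum being cyclic under it, only the
    image of the vacuum matters. That image is a quadratic vector killed by the
    fields of [coordinate_field], which forces its coefficients to be
    antisymmetric. *)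
Lemma vertical_scalar (x : thetaHat K) : thetaHatA A x -> base x.1 = 0 ->
  exists r, forall w, hat_act_Fock x w - scalL K r *: w \in AF.
Proof.
move=> xA b0; have [n [b [a [c S]]]] := fock_splitting hA.
pose T := hat_act_Fock x.
have Tperp f w : perp A f -> T (genL f *: w) - genL f *: T w \in AF.
  move=> fA; rewrite /T hat_act_Fock_gen addrK; apply: AF_gen_in.
  apply: subalgB; last exact: Acst.
  apply: (FT4 hA) fA; [exact: thetaKR_der|move=> r|exact: thetaKR_cont|exact: xA].
  by rewrite baseE b0 scale0r.
have [q qQ qE] := tau_vac (vert_derivation x.1).
have [z [r Er]] := pi_quad S qQ.
have TE : \pi_(coinv A) (T (vac K)) = \pi_(coinv A) (quad_vec b z) + (r + x.2) *: \pi_(coinv A) (vac K).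
  rewrite /T /hat_act_Fock delta_vac addr0 scalerDl coinv_piD qE Er pi_scal scalerDl.
  by rewrite addrA.
have skew l m : z l m + z m l = 0.
  have [o [oA oO oE]] := coordinate_field S l; have [o' [o'A o'O o'E]] := coordinate_field S m.
  apply: (coinv_faithful hA).
  have TA : T (vac K) - (quad_vec b z + scalL K (r + x.2) *: vac K) \in AF.
    by apply/coinv_eqP; rewrite TE coinv_piD pi_scal.
  have oT : genL o *: T (vac K) \in AF.
    have := Tperp o (vac K) oA; rewrite gen_vac // /T hat_act_Fock0 sub0r.
    by rewrite rpredN.
  move: (T (vac K)) TA oT => tv TA oT; have := AF_perp o'A (AF_perp oA TA).
  rewrite !scalerBr !scalerDr (coordinate_quad S z oO o'O oE o'E) !Fock_scalC.
  rewrite (gen_vac oO) !scaler0 addr0 => H.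
  by have := rpredB (AF_perp o'A oT) H; rewrite subKr.
have [s zs] := quad_vec_skew b skew.
exists (s + (r + x.2)).
apply: (perp_cyclic (P := fun w => T w - scalL K (s + (r + x.2)) *: w \in AF)).
- by rewrite /T hat_act_Fock0 scaler0 subrr rpred0.
- move=> v w Hv Hw; rewrite /T hat_act_FockB scalerBr.
  have Z (V : zmodType) (p p' u u' : V) : p - p' - (u - u') = p - u - (p' - u').
    by rewrite !opprB [LHS](AC (2*2) ((1*4)*(3*2))).
  by rewrite Z rpredB.
- move=> t w Hw; rewrite /T hat_act_Fock_scal b0 [scalL K 0 *: _]scale0r add0r.
  by rewrite scalerA scalLC -scalerA -scalerBr AF_scal.
- move=> f w fA Hw; have := rpredD (Tperp f w fA) (AF_perp fA Hw).
  by rewrite scalerBr addrA subrK Fock_scalC.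
- apply/coinv_eqP; rewrite TE zs !pi_scal -scalerDl.
  by [].
Qed.

End VerticalScalar.

(** * Linearity of the action in the derivation *)

Section Linearity.
Variables (k : numFieldType) (R : comAlgType k) (K : laurentType R).
Implicit Types (f g : K) (x y : thetaHat K) (D E : thetaKR K) (d : thetaR R) (v w : Fock K).

Lemma thetaR_linE (c : k) d d' r : (c *: d + d') r = c%:A * d r + d' r.
Proof. by rewrite -[LHS]/(c *: d r + d' r) mulr_algl. Qed.

Lemma base_linear (c : k) D E : base (c *: D + E) = c *: base D + base E.
Proof.
apply: thetaR_ext => r; rewrite -[RHS]/(c *: base D r + base E r).
rewrite -[LHS]/(coef ((c%:A : R) *: D r%:A + E r%:A) 0).
by rewrite coefD coefZ mulr_algl.
Qed.

Lemma vert_linear_der (c : k) D E f :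
  vert (c *: D + E) f = (c%:A : R) *: vert D f + vert E f.
Proof.
apply: coef_ext => i; rewrite /vert base_linear.
rewrite -[(c *: D + E) f]/((c%:A : R) *: D f + E f).
rewrite coefB (coefD ((c%:A : R) *: D f)) coefZ [RHS]coefD coefZ !coefB !coef_hor.
by rewrite thetaR_linE mulrBr opprD addrACA.
Qed.

Lemma tau_hat_linear (c : R) (F G H : K -> K) :
  derivation F -> derivation G -> derivation H ->
  (forall f, H f = c *: F f + G f) ->
  tau_hat H = scalL K c * tau_hat F + tau_hat G.
Proof.
move=> dF dG dH HE.
have S B : quad_sum H B = scalU K c * quad_sum F B + quad_sum G B.
  rewrite /quad_sum mulr_sumr -big_split; apply: eq_bigr => i _ /=.
  rewrite mulr_sumr -big_split; apply: eq_bigr => j _ /=.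
  rewrite /quad_term; case: ifP => _; last by rewrite mulr0 addr0.
  by rewrite HE res_formDl res_formZl scalerDr scalUD mulrDl scalerAr scalUM mulrA.
have L : quad_lim H = ubar_const (scalU K c) * quad_lim F + quad_lim G.
  apply: cvg_unique (quad_lim_cvg dH) _.
  apply: cvg_close (cvgD (cvgM (cvg_const _) (quad_lim_cvg dF)) (quad_lim_cvg dG)) _ => N.
  by exists 0%N => B _; rewrite S subrr rpred0.
rewrite /tau_hat L mulrDr mulrA -ubar_scalC -mulrA fracD; congr (_ + _).
by rewrite /scalL /toUloc -fracM.
Qed.

Lemma deltaU_linear (c : k) d d' (u : UK K) :
  deltaU (c *: d + d') u = scalU K (c%:A) * deltaU d u + deltaU d' u.
Proof.
elim/UK_ind: u => [r||f|u u' E E'|u E|u u' E E'].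
- by rewrite !deltaU_scal thetaR_linE scalUD scalUM.
- by rewrite !deltaU_hbar mulr0 addr0.
- rewrite !deltaU_gen -genUZ -genUD; congr genU; apply: coef_ext => i.
  by rewrite coefD coefZ !coef_hor thetaR_linE.
- by rewrite !deltaUD E E' mulrDr addrACA.
- by rewrite -[- u]sub0r !deltaUB !deltaU0 E !sub0r opprD mulrN.
- rewrite !deltaUM E E' mulrDl !mulrDr addrACA !mulrA; congr (_ + _ + _).
  by rewrite -(scalUC _ u).
Qed.

Lemma delta_Fock_linear (c : k) d d' w :
  delta_Fock (c *: d + d') w = scalL K (c%:A) *: delta_Fock d w + delta_Fock d' w.
Proof.
elim/quotW: w => u; rewrite !delta_FockE toUloc_act -piFD deltaU_linear.
by [].
Qed.

Lemma hat_act_Fock_linear (c : k) x y w :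
  hat_act_Fock (c *: x + y) w =
  scalL K (c%:A) *: hat_act_Fock x w + hat_act_Fock y w.
Proof.
rewrite /hat_act_Fock.
rewrite (tau_hat_linear (c := c%:A) (vert_derivation x.1) (vert_derivation y.1)); last first.
- by move=> f; apply: vert_linear_der.
- exact: vert_derivation.
rewrite -[(c *: x + y).1]/(c *: x.1 + y.1) base_linear delta_Fock_linear.
rewrite -[(c *: x + y).2]/(c *: x.2 + y.2) scalLD -[c *: x.2]mulr_algl.
rewrite [scalL K (_ * x.2)]/scalL scalUM toUlocM scalerDr [RHS]addrACA; congr (_ + _).
have E (S : pzRingType) (M : lmodType S) (u t1 t2 s1 s2 : S) (m : M) :
    (u * t1 + t2 + (u * s1 + s2)) *: m = u *: ((t1 + s1) *: m) + (t2 + s2) *: m.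
  by rewrite addrACA -mulrDr scalerDl scalerA.
exact: E.
Qed.

Lemma hat_act_Fock_zero w : hat_act_Fock (0 : thetaHat K) w = 0.
Proof.
have := hat_act_Fock_linear 1 0 0 w; rewrite scale1r addr0.
have -> : scalL K (1%:A : R) = 1 by rewrite scale1r.
by rewrite scale1r => /eqP; rewrite -subr_eq subrr eq_sym => /eqP.
Qed.

Lemma hat_act_Fock_cst (r : R) w : hat_act_Fock ((0, r) : thetaHat K) w = scalL K r *: w.
Proof.
have := hat_act_Fock_zero w; rewrite /hat_act_Fock.
rewrite -[(0 : thetaHat K).1]/(0 : thetaKR K) -[(0 : thetaHat K).2]/(0 : R).
rewrite -[((0, r) : thetaHat K).1]/(0 : thetaKR K) -[((0, r) : thetaHat K).2]/r.
rewrite scalerDl [scalL K 0 *: w]scale0r addr0 => H.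
by rewrite scalerDl addrAC H add0r.
Qed.

End Linearity.

(** * The Lie algebra of operators on the coinvariants *)

Section Extension.
Variables (k : numFieldType) (R : comAlgType k) (K : laurentType R).
Variable A : subalgClosed K.
Local Notation V := (coinv A).
Implicit Types (x y : thetaHat K) (v w : V).

Lemma coinv_act_linear (c : k) x y v : thetaHatA A x -> thetaHatA A y ->
  thetaHatA A (c *: x + y) /\
  hat_act_coinv (c *: x + y) v = (c%:A : R) *: hat_act_coinv x v + hat_act_coinv y v.
Proof.
move=> xA yA; have cA : thetaHatA A (c *: x + y).
  move=> a aA; rewrite -[(c *: x + y).1 a]/((c%:A : R) *: x.1 a + y.1 a).
  by rewrite rpredD ?rpredZ ?xA ?yA.
split=> //; elim/quotW: v => v.
rewrite !hat_act_coinvE // -pi_scal -coinv_piD; congr (\pi_V _).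
exact: hat_act_Fock_linear.
Qed.

Lemma thetaHatA0 : thetaHatA A 0.
Proof. by move=> a _; apply: rpred0. Qed.

Lemma coinv_act0 v : hat_act_coinv 0 v = 0 :> V.
Proof.
elim/quotW: v => v; rewrite hat_act_coinvE ?hat_act_Fock_zero; last exact: thetaHatA0.
by apply: pi_AF; apply: rpred0.
Qed.

Lemma thetaHatA_cst r : thetaHatA A (0, r).
Proof. by move=> a _; apply: rpred0. Qed.

Lemma coinv_act_cst (r : R) v : hat_act_coinv ((0, r) : thetaHat K) v = r *: v :> V.
Proof.
elim/quotW: v => v; rewrite hat_act_coinvE ?hat_act_Fock_cst ?pi_scal //.
exact: thetaHatA_cst.
Qed.

Lemma thetaHatA_lie x y : thetaHatA A x -> thetaHatA A y -> thetaHatA A (hat_lie x y).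
Proof.
move=> xA yA a aA; rewrite -[(hat_lie x y).1 a]/(x.1 (y.1 a) - y.1 (x.1 a)).
by apply: subalgB; [apply/xA/yA | apply/yA/xA].
Qed.

Lemma coinv_piB (v w : Fock K) : \pi_V (v - w) = \pi_V v - \pi_V w.
Proof. by apply/eqP; rewrite eq_sym subr_eq -coinv_piD subrK. Qed.

Lemma coinv_act_lie x y v : thetaHatA A x -> thetaHatA A y ->
  hat_act_coinv (hat_lie x y) v =
  hat_act_coinv x (hat_act_coinv y v) - hat_act_coinv y (hat_act_coinv x v).
Proof.
move=> xA yA; have xyA := thetaHatA_lie xA yA; elim/quotW: v => v.
by rewrite (hat_act_coinvE v xyA) (hat_act_coinvE v yA) (hat_act_coinvE v xA)
  (hat_act_coinvE _ xA) (hat_act_coinvE _ yA) hat_lie_Fock coinv_piB.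
Qed.

Lemma coinv_actD x v w : thetaHatA A x ->
  hat_act_coinv x (v + w) = hat_act_coinv x v + hat_act_coinv x w.
Proof.
move=> xA; elim/quotW: v => v; elim/quotW: w => w.
by rewrite -coinv_piD !hat_act_coinvE // hat_act_FockD coinv_piD.
Qed.

Lemma coinv_act_scal x (r : R) v : thetaHatA A x ->
  hat_act_coinv x (r *: v) = base x.1 r *: v + r *: hat_act_coinv x v.
Proof.
move=> xA; elim/quotW: v => v.
by rewrite -pi_scal !hat_act_coinvE // hat_act_Fock_scal coinv_piD !pi_scal.
Qed.

(** Pairs of a derivation of [R] and an operator on the coinvariants that come
    from a common element of theta-hat preserving [A]. Since the second component
    records the action, the action factors through these pairs by construction;
    what has to be proved is that the kernel of [ext_base] is just [R]. *)
Record ext : Type := Ext {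
  ext_base : thetaR R;
  ext_act : V -> V;
  extP : exists2 x, thetaHatA A x & ext_base = base x.1 /\ ext_act = hat_act_coinv x
}.

HB.instance Definition _ := gen_eqMixin ext.
HB.instance Definition _ := gen_choiceMixin ext.
Implicit Types p q : ext.

Lemma ext_eq p q : ext_base p = ext_base q -> (forall v, ext_act p v = ext_act q v) -> p = q.
Proof.
case: p q => d T pP [d' T' qP] /= E /funext E'; subst d' T'.
by congr Ext; apply: Prop_irrelevance.
Qed.

Definition ext_of x (xA : thetaHatA A x) : ext :=
  Ext (ex_intro2 _ _ x xA (conj (erefl (base x.1)) (erefl (hat_act_coinv x)))).

Fact ext_lin_subproof (c : k) p q : exists2 x, thetaHatA A x &
  c *: ext_base p + ext_base q = base x.1 /\
  (fun v => (c%:A : R) *: ext_act p v + ext_act q v) = hat_act_coinv x.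
Proof.
have [x xA [-> ->]] := extP p; have [y yA [-> ->]] := extP q.
have [cA _] := coinv_act_linear c 0 xA yA; exists (c *: x + y) => //.
split; first by rewrite -base_linear.
by apply/funext => v; rewrite (coinv_act_linear c v xA yA).2.
Qed.
Definition ext_lin c p q : ext := Ext (ext_lin_subproof c p q).

Definition ext_zero : ext := ext_of thetaHatA0.

Lemma base0 : base (0 : thetaKR K) = 0.
Proof.
have := base_linear 1 (0 : thetaKR K) 0; rewrite !scale1r addr0.
by move=> /eqP; rewrite -subr_eq subrr eq_sym => /eqP.
Qed.

Fact ext_lie_subproof p q : exists2 x, thetaHatA A x &
  lie (ext_base p) (ext_base q) = base x.1 /\
  (fun v => ext_act p (ext_act q v) - ext_act q (ext_act p v)) = hat_act_coinv x.
Proof.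
have [x xA [-> ->]] := extP p; have [y yA [-> ->]] := extP q.
exists (hat_lie x y); first exact: thetaHatA_lie.
split; first by rewrite -base_lie.
by apply/funext => v; rewrite coinv_act_lie.
Qed.
Definition ext_lie p q : ext := Ext (ext_lie_subproof p q).

Definition ext_add p q := ext_lin 1 p q.
Definition ext_opp p := ext_lin (-1) p ext_zero.
Definition ext_scale c p := ext_lin c p ext_zero.

Fact ext_addA : associative ext_add.
Proof. by move=> p q s; apply: ext_eq => [|v] /=; rewrite !scale1r addrA. Qed.
Fact ext_addC : commutative ext_add.
Proof. by move=> p q; apply: ext_eq => [|v] /=; rewrite !scale1r addrC. Qed.
Fact ext_add0 : left_id ext_zero ext_add.
Proof.
by move=> p; apply: ext_eq => [|v] /=; rewrite ?base0 ?coinv_act0 scaler0 add0r.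
Qed.
Fact ext_addN : left_inverse ext_zero ext_opp ext_add.
Proof.
move=> p; apply: ext_eq => [|v] /=; rewrite ?base0 ?coinv_act0 !scale1r addr0.
  by rewrite scaleN1r addNr.
by rewrite scaleNr scale1r scaleN1r addNr.
Qed.

HB.instance Definition _ := GRing.isZmodule.Build ext ext_addA ext_addC ext_add0 ext_addN.

Lemma ext_baseD p q : ext_base (p + q) = ext_base p + ext_base q.
Proof. by rewrite -[LHS]/(1 *: ext_base p + _) scale1r. Qed.
Lemma ext_actD p q v : ext_act (p + q) v = ext_act p v + ext_act q v.
Proof. by rewrite -[LHS]/((1%:A : R) *: ext_act p v + _) scale1r scale1r. Qed.
Lemma ext_base_scale c p : ext_base (ext_scale c p) = c *: ext_base p.
Proof. by rewrite /= base0 addr0. Qed.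
Lemma ext_act_scale c p v : ext_act (ext_scale c p) v = (c%:A : R) *: ext_act p v.
Proof. by rewrite /= coinv_act0 addr0. Qed.

Fact ext_scaleA c d p : ext_scale c (ext_scale d p) = ext_scale (c * d) p.
Proof.
apply: ext_eq => [|v]; first by rewrite !ext_base_scale scalerA.
by rewrite !ext_act_scale scalerA mulr_algl scalerA.
Qed.
Fact ext_scale1 : left_id 1 ext_scale.
Proof.
by move=> p; apply: ext_eq => [|v]; rewrite ?ext_base_scale ?ext_act_scale !scale1r.
Qed.
Fact ext_scaleDr : right_distributive ext_scale +%R.
Proof.
move=> c p q; apply: ext_eq => [|v].
  by rewrite ext_baseD !ext_base_scale ext_baseD scalerDr.
by rewrite ext_actD !ext_act_scale ext_actD scalerDr.
Qed.
Fact ext_scaleDl p : {morph ext_scale^~ p : c d / c + d}.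
Proof.
move=> c d; apply: ext_eq => [|v].
  by rewrite ext_baseD !ext_base_scale scalerDl.
by rewrite ext_actD !ext_act_scale !scalerDl.
Qed.

HB.instance Definition _ := GRing.Zmodule_isLmodule.Build k ext
  ext_scaleA ext_scale1 ext_scaleDr ext_scaleDl.

Lemma ext_base_lin c p q : ext_base (c *: p + q) = c *: ext_base p + ext_base q.
Proof. by rewrite ext_baseD; congr (_ + _); apply: ext_base_scale. Qed.
Lemma ext_act_lin c p q v :
  ext_act (c *: p + q) v = (c%:A : R) *: ext_act p v + ext_act q v.
Proof. by rewrite ext_actD; congr (_ + _); apply: ext_act_scale. Qed.

Lemma ext_act_add p v w : ext_act p (v + w) = ext_act p v + ext_act p w.
Proof. by have [x xA [_ ->]] := extP p; apply: coinv_actD. Qed.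
Lemma ext_act_scal p (r : R) v : ext_act p (r *: v) = ext_base p r *: v + r *: ext_act p v.
Proof. by have [x xA [-> ->]] := extP p; apply: coinv_act_scal. Qed.
Lemma ext_actZ p (c : k) v : ext_act p ((c%:A : R) *: v) = (c%:A : R) *: ext_act p v.
Proof. by rewrite ext_act_scal thetaR_k scale0r add0r. Qed.
Lemma ext_actB p v w : ext_act p (v - w) = ext_act p v - ext_act p w.
Proof. by apply/eqP; rewrite eq_sym subr_eq -ext_act_add subrK. Qed.

Lemma ext_base_lie p q : ext_base (ext_lie p q) = lie (ext_base p) (ext_base q).
Proof. by []. Qed.
Lemma ext_act_lie p q v :
  ext_act (ext_lie p q) v = ext_act p (ext_act q v) - ext_act q (ext_act p v).
Proof. by []. Qed.

Fact ext_lie_linearl c p q s : ext_lie (c *: p + q) s = c *: ext_lie p s + ext_lie q s.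
Proof.
apply: ext_eq => [|v].
  by rewrite ext_base_lin !ext_base_lie ext_base_lin lie_linearl.
rewrite ext_act_lin !ext_act_lie !ext_act_lin ext_act_add ext_actZ opprD addrACA.
by rewrite scalerBr.
Qed.
Fact ext_liexx p : ext_lie p p = 0.
Proof.
by apply: ext_eq => [|v] /=; rewrite ?liexx ?base0 // subrr coinv_act0.
Qed.
Fact ext_lie_linearr c p q s : ext_lie s (c *: p + q) = c *: ext_lie s p + ext_lie s q.
Proof.
apply: ext_eq => [|v].
  by rewrite ext_base_lin !ext_base_lie ext_base_lin lie_linearr.
rewrite ext_act_lin !ext_act_lie !ext_act_lin ext_act_add ext_actZ opprD addrACA.
by rewrite scalerBr.
Qed.
Fact ext_jacobi p q s :
  ext_lie p (ext_lie q s) + ext_lie q (ext_lie s p) + ext_lie s (ext_lie p q) = 0.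
Proof.
apply: ext_eq => [|v]; first by rewrite !ext_baseD /= lie_jacobi base0.
rewrite !ext_actD /= !ext_actB coinv_act0 !opprB.
rewrite [LHS](AC ((2*2)*(2*2)*(2*2)) ((1*12)*(7*2)*(3*10)*(5*4)*(11*6)*(9*8))) /=.
by rewrite !subrr !addr0.
Qed.

HB.instance Definition _ := Lmodule_isLie.Build k ext
  ext_lie_linearl ext_lie_linearr ext_liexx ext_jacobi.

End Extension.

(** * The central extension *)

Section CentralExtension.
Variables (k : numFieldType) (R : comAlgType k) (K : laurentType R).
Variable A : subalgClosed K.
Hypothesis hA : fock_type A.
Local Notation E := (ext A).
Implicit Types (x y : thetaHat K) (r : R) (p q : E).

Definition ext_scalar r : E := ext_of (@thetaHatA_cst _ R K A r).

Lemma ext_scalar_act r v : ext_act (ext_scalar r) v = r *: v.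
Proof. exact: coinv_act_cst. Qed.

Fact ext_scalar_linear : linear ext_scalar.
Proof.
move=> c r s; apply: ext_eq => [|v].
  by rewrite ext_base_lin /= base0 scaler0 addr0.
by rewrite ext_act_lin !ext_scalar_act scalerDl -[c *: r]mulr_algl scalerA.
Qed.
HB.instance Definition _ := GRing.isLinear.Build k R E *:%R ext_scalar ext_scalar_linear.

Definition ext_anchor p : thetaR R := ext_base p.
Fact ext_anchor_linear : linear ext_anchor.
Proof. by move=> c p q; apply: ext_base_lin. Qed.
HB.instance Definition _ :=
  GRing.isLinear.Build k E (thetaR R) *:%R ext_anchor ext_anchor_linear.

(** This is the faithfulness of [R] on the vacuum. *)
Lemma ext_scalar_inj : injective ext_scalar.
Proof.
move=> r s /(congr1 (fun p => ext_act p (\pi_(coinv A) (vac K)))).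
rewrite !ext_scalar_act => /eqP; rewrite -subr_eq0 -scalerBl -pi_scal => /eqP E0.
apply/eqP; rewrite -subr_eq0; apply/eqP/(coinv_faithful hA).
have -> : scalL K (r - s) *: vac K = scalL K (r - s) *: vac K - 0 by rewrite subr0.
by apply/coinv_eqP; rewrite E0 pi_AF // rpred0.
Qed.

(** Exactness in the middle is [vertical_scalar]: an element over the zero derivation
    comes from a derivation along the fibres. *)
Lemma ext_central : central_extension (thetaRA A) ext_scalar ext_anchor.
Proof.
split.
- exact: ext_scalar_inj.
- by [].
- apply/seteqP; split=> d /=.
    by move=> [p _ <-]; have [x xA [pb _]] := extP p; exists x.1.
  by move=> [D DA ->]; have xA : thetaHatA A (D, 0) by []; exists (ext_of xA).
- move=> p; split=> [p0|[r ->]]; last exact: base0.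
  have [x xA [pb pa]] := extP p; have b0 : base x.1 = 0 by rewrite -pb.
  have [r Hr] := vertical_scalar hA xA b0; exists r; apply: ext_eq => [|v].
    by rewrite /= base0.
  rewrite ext_scalar_act pa; elim/quotW: v => w.
  by rewrite hat_act_coinvE // -pi_scal; apply/coinv_eqP.
- move=> p r; apply: ext_eq => [|v].
    rewrite -[ext_base (lie _ _)]/(lie (ext_base p) (base (0 : thetaKR K))) /= !base0.
    apply: thetaR_ext => s /=.
    by rewrite (der0 (thetaR_der _)) subr0.
  rewrite -[ext_act (lie _ _) v]/(ext_act (ext_lie p (ext_scalar r)) v) ext_act_lie.
  by rewrite !ext_scalar_act ext_act_scal addrK.
Qed.

Lemma ext_representation : representation ext_scalar (@ext_act k R K A).
Proof.
split=> //.
- exact: ext_act_add.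
- by move=> p c v; apply: ext_actZ.
- by move=> c p q v; apply: ext_act_lin.
- exact: ext_scalar_act.
Qed.

(** The value 0 is a default, taken on the elements that do not preserve [A]. *)
Definition ext_map x : E :=
  if pselect (thetaHatA A x) is left xA then ext_of xA else 0.

Lemma ext_mapE x : thetaHatA A x ->
  ext_base (ext_map x) = base x.1 /\ ext_act (ext_map x) = hat_act_coinv x.
Proof. by move=> xA; rewrite /ext_map; case: pselect. Qed.

(** The ground field enters only through the division by nonzero integers. *)
Lemma coinvariants_factor :
  (forall x, thetaHatA A x -> forall z, z \in AU A -> hat_act x z \in AU A) /\
  (forall x, thetaHatA A x -> forall w, hat_act_coinv x (\pi_(coinv A) w) =
                                        \pi_(coinv A) (hat_act_Fock x w)) /\
  (forall x y, thetaHatA A x -> thetaHatA A y -> forall w : coinv A,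
     hat_act_coinv (hat_lie x y) w =
     hat_act_coinv x (hat_act_coinv y w) - hat_act_coinv y (hat_act_coinv x w)) /\
  exists (E : lieType k) (i : {linear R -> E}) (p : {linear E -> thetaR R})
         (rho : E -> coinv A -> coinv A) (phi : thetaHat K -> E),
    [/\ central_extension (thetaRA A) i p,
        representation i rho,
        (forall (c : k) x y, thetaHatA A x -> thetaHatA A y ->
           phi (c *: x + y) = c *: phi x + phi y) /\
        (forall x y, thetaHatA A x -> thetaHatA A y ->
           phi (hat_lie x y) = lie (phi x) (phi y)),
        (forall x, thetaHatA A x -> p (phi x) = base x.1) /\
        (forall r, phi (0, r) = i r) &
        forall x, thetaHatA A x -> forall w, hat_act_coinv x w = rho (phi x) w].
Proof.
split; first by move=> x xA z; apply: hat_act_AU.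
split; first by move=> x xA w; apply: hat_act_coinvE.
split; first by move=> x y xA yA w; apply: coinv_act_lie.
exists E, (ext_scalar : {linear R -> E}), (ext_anchor : {linear E -> thetaR R}).
exists (@ext_act k R K A), ext_map.
split.
- exact: ext_central.
- exact: ext_representation.
- split=> [c x y xA yA|x y xA yA].
    have [cA _] := coinv_act_linear c 0 xA yA.
    have [bc ac] := ext_mapE cA; have [bx ax] := ext_mapE xA; have [by_ ay] := ext_mapE yA.
    apply: ext_eq => [|v]; first by rewrite ext_base_lin bc bx by_ -base_linear.
    by rewrite ext_act_lin ac ax ay (coinv_act_linear c v xA yA).2.
  have [bl al] := ext_mapE (thetaHatA_lie xA yA).
  have [bx ax] := ext_mapE xA; have [by_ ay] := ext_mapE yA.
  apply: ext_eq => [|v]; first by rewrite ext_base_lie bl bx by_ -base_lie.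
  by rewrite ext_act_lie al ax ay coinv_act_lie.
- split=> [x xA|r]; first exact: (ext_mapE xA).1.
  have [br ar] := ext_mapE (@thetaHatA_cst _ R K A r).
  by apply: ext_eq => [|v]; rewrite ?br ?ar.
- by move=> x xA w; rewrite (ext_mapE xA).2.
Qed.

End CentralExtension.

Theorem proposition4p6 (RR : realType) (R : comAlgType RR[i]) (K : laurentType R)
    (A : subalgClosed K) (hA : fock_type A) :
  (forall x, thetaHatA A x -> forall z, z \in AU A -> hat_act x z \in AU A) /\
  (forall x, thetaHatA A x -> forall w, hat_act_coinv x (\pi_(coinv A) w) =
                                        \pi_(coinv A) (hat_act_Fock x w)) /\
  (forall x y, thetaHatA A x -> thetaHatA A y -> forall w : coinv A,
     hat_act_coinv (hat_lie x y) w =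
     hat_act_coinv x (hat_act_coinv y w) - hat_act_coinv y (hat_act_coinv x w)) /\
  exists (E : lieType RR[i]) (i : {linear R -> E}) (p : {linear E -> thetaR R})
         (rho : E -> coinv A -> coinv A) (phi : thetaHat K -> E),
    [/\ central_extension (thetaRA A) i p,
        representation i rho,
        (forall (c : RR[i]) x y, thetaHatA A x -> thetaHatA A y ->
           phi (c *: x + y) = c *: phi x + phi y) /\
        (forall x y, thetaHatA A x -> thetaHatA A y ->
           phi (hat_lie x y) = lie (phi x) (phi y)),
        (forall x, thetaHatA A x -> p (phi x) = base x.1) /\
        (forall r, phi (0, r) = i r) &
        forall x, thetaHatA A x -> forall w, hat_act_coinv x w = rho (phi x) w].
Proof. exact: (@coinvariants_factor RR[i] R K A hA). Qed.
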